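(* Let $1<p<\infty$ and $1/p+1/q=1$. Let $\mathcal{G},\mathcal{V}:\mathcal{M}_p\to\mathbb{R}$ be continuous, with $\mathcal{G}$ Lipschitz continuous, and suppose there are $\alpha,\beta\in\mathbb{R}$ and $\varrho\in\mathcal{M}_p$ such that $\mathcal{V}(\mu)\le \alpha W_p(\mu,\varrho)^p+\beta$ for all $\mu\in\mathcal{M}_p$. Let $\mathcal{U}$ be the generalized value function $$\mathcal{U}(\mu,t)=\inf\left\{\mathcal{G}(\sigma(0))+\int_0^t\left(\tfrac1p\|\dot\sigma(s)\|^p-\mathcal{V}(\sigma(s))\right)ds:\ \sigma\in AC_p([0,t],\mathcal{M}_p),\ \sigma(t)=\mu\right\}.$$ Then there is a positive number $T=T(\alpha,p)$ for which: (i) $\mathcal{U}\in C(\mathcal{M}_p\times(0,T))$; (ii) $\lim_{t\to0^+}\mathcal{U}(\mu,t)=\mathcal{G}(\mu)$ for every $\mu\in\mathcal{M}_p$; (iii) $\mathcal{U}$ is a viscosity solution (in the sense defined in the context) of the Hamilton-Jacobi equation $$\partial_t\mathcal{U}+\frac1q\|\nabla_\mu\mathcal{U}\|^q_{L^q(\mu)}+\mathcal{V}(\mu)=0$$ on $\mathcal{M}_p\times(0,T)$.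
   Context: $\mathcal{M}_p$ is the set $\mathcal{P}_p(\mathbb{R}^d)$ of Borel probability measures on $\mathbb{R}^d$ with finite $p$-th moment, endowed with the $p$-Wasserstein metric $W_p(\mu,\nu)=\inf\{(\iint|x-y|^pd\pi(x,y))^{1/p}:\pi\in\Gamma(\mu,\nu)\}$, where $\Gamma(\mu,\nu)$ is the set of probability measures in $\mathcal{P}_p(\mathbb{R}^d\times\mathbb{R}^d)$ with first marginal $\mu$ and second marginal $\nu$. $\Gamma_0(\mu,\nu)\subset\Gamma(\mu,\nu)$ is the set of minimizers for $W_p(\mu,\nu)$. $AC_p([0,t],\mathcal{M}_p)$ is the set of paths $\sigma:[0,t]\to\mathcal{M}_p$ for which there is $h\in L^p([0,t])$ with $W_p(\sigma(s_1),\sigma(s_2))\le\int_{s_1}^{s_2}h(u)\,du$ for all $0\le s_1\le s_2\le t$; the (a.e.) smallest such $h$ is denoted $\|\dot\sigma\|$ and called the metric derivative of $\sigma$. Cotangent space: $\mathrm{CoTan}_\mu\mathcal{M}_p$ is the closure in $L^q(\mu)$ (of $\mathbb{R}^d$-valued maps) of $\{\nabla\psi:\psi\in C_c^\infty(\mathbb{R}^d)\}$. Viscosity solutions on $\mathcal{M}_p\times(0,T)$ of the equation $\partial_t\mathcal{U}+\frac1q\|\nabla_\mu\mathcal{U}\|^q_{L^q(\mu)}+\mathcal{V}(\mu)=0$: (a) $\mathcal{U}\in USC(\mathcal{M}_p\times(0,T))$ (upper semicontinuous) is a viscosity subsolution if for each $(\mu_0,t_0)\in\mathcal{M}_p\times(0,T)$,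 $a\in\mathbb{R}$ and $\xi\in\mathrm{CoTan}_{\mu_0}\mathcal{M}_p$ such that, as $(\mu,t)\to(\mu_0,t_0)$, $$\mathcal{U}(\mu,t)\le\mathcal{U}(\mu_0,t_0)+\inf_{\pi\in\Gamma_0(\mu_0,\mu)}\iint\xi(x)\cdot(y-x)\,d\pi(x,y)+a(t-t_0)+o(|t-t_0|)+o(W_p(\mu,\mu_0)),$$ one has $a+\frac1q\|\xi\|^q_{L^q(\mu_0)}+\mathcal{V}(\mu_0)\le0$. (b) $\mathcal{U}\in LSC(\mathcal{M}_p\times(0,T))$ (lower semicontinuous) is a viscosity supersolution if for each $(\mu_0,t_0)\in\mathcal{M}_p\times(0,T)$, $a\in\mathbb{R}$ and $\xi\in\mathrm{CoTan}_{\mu_0}\mathcal{M}_p$ such that, as $(\mu,t)\to(\mu_0,t_0)$, $$\mathcal{U}(\mu,t)\ge\mathcal{U}(\mu_0,t_0)+\sup_{\pi\in\Gamma_0(\mu_0,\mu)}\iint\xi(x)\cdot(y-x)\,d\pi(x,y)+a(t-t_0)+o(|t-t_0|)+o(W_p(\mu,\mu_0)),$$ one has $a+\frac1q\|\xi\|^q_{L^q(\mu_0)}+\mathcal{V}(\mu_0)\ge0$. (c) $\mathcal{U}\in C(\mathcal{M}_p\times(0,T))$ is a viscosity solution if it is both a sub- and a supersolution. *)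

(* Defs.v *)
From HB Require Import structures.
From mathcomp Require Import all_boot all_order all_algebra.
From mathcomp Require Import all_classical all_reals all_analysis.

Set Implicit Arguments.
Unset Strict Implicit.
Unset Printing Implicit Defensive.

Import Order.TTheory GRing.Theory Num.Theory.
Import numFieldNormedType.Exports.

Local Open Scope classical_set_scope.
Local Open Scope ring_scope.

(* The library norm on row vectors is the sup norm, hence these Euclidean
   versions.  The topologies, and so the Borel sets, coincide. *)
Definition edot (R : realType) (d : nat) (x y : 'rV[R]_d) : R :=
  \sum_(i < d) x 0 i * y 0 i.

Definition enorm (R : realType) (d : nat) (x : 'rV[R]_d) : R :=
  Num.sqrt (edot x x).

(* R^d with its Borel sigma-algebra.  On the product [borelRd R d * borelRd R d]
   the library puts the product sigma-algebra, which is the Borel one because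
   R^d is second countable. *)
Notation borelRd R d := (g_sigma_algebraType (@open 'rV[R]_d)).

Record Wspace (R : realType) (d : nat) (p : R) := MkWspace {
  wmeasure :> probability (borelRd R d) R ;
  wmoment : (\int[wmeasure]_x ((enorm (x : 'rV[R]_d)) `^ p)%:E < +oo)%E }.

HB.instance Definition _ (R : realType) (d : nat) (p : R) :=
  gen_eqMixin (Wspace d p).
HB.instance Definition _ (R : realType) (d : nat) (p : R) :=
  gen_choiceMixin (Wspace d p).

Section wasserstein.
Context {R : realType} {d : nat} {p : R}.
Implicit Types mu nu : Wspace d p.

Local Notation plan := (probability (borelRd R d * borelRd R d)%type R).

(* Equality as Borel measures: library measures are functions defined on all
   sets, with unspecified values on the non-measurable ones. *)
Definition same_measure mu nu : Prop :=
  forall A : set (borelRd R d), measurable A -> mu A = nu A.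

Definition coupling mu nu (pi : plan) : Prop :=
  [/\ (\int[pi]_z
         ((Num.sqrt (enorm (z.1 : 'rV[R]_d) ^+ 2
                     + enorm (z.2 : 'rV[R]_d) ^+ 2)) `^ p)%:E < +oo)%E,
      forall A : set (borelRd R d), measurable A -> pi (A `*` setT) = mu A
    & forall A : set (borelRd R d), measurable A -> pi (setT `*` A) = nu A].

Definition transport_cost (pi : plan) : \bar R :=
  ((\int[pi]_z ((enorm ((z.1 : 'rV[R]_d) - (z.2 : 'rV[R]_d))) `^ p)%:E)
     `^ p^-1)%E.

Definition Wp mu nu : R :=
  fine (ereal_inf [set transport_cost pi | pi in coupling mu nu]).

Definition optimal_coupling mu nu (pi : plan) : Prop :=
  coupling mu nu pi /\
  forall pi', coupling mu nu pi' -> (transport_cost pi <= transport_cost pi')%E.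

Definition Wball mu (r : R) : set (Wspace d p) := [set nu | Wp mu nu < r].

Definition Wnbhs mu : set_system (Wspace d p) :=
  filter_from [set r : R | 0 < r] (Wball mu).

End wasserstein.

(* Neighbourhoods are generated by the Wasserstein balls; the topology they
   determine on [Wspace] (and on [Wspace * R]) is the one of the metric Wp. *)
HB.instance Definition _ (R : realType) (d : nat) (p : R) :=
  hasNbhs.Build (Wspace d p) Wnbhs.

Section paths.
Context {R : realType} {d : nat} {p : R}.
(* Only the restriction of a path to [0, t] is ever used. *)
Implicit Types sigma : R -> Wspace d p.

Definition speed_bound sigma (t : R) (h : R -> R) : Prop :=
  [/\ measurable_fun `[0, t] h,
      (\int[lebesgue_measure]_(s in `[0%R, t]) ((`|h s| `^ p)%:E) < +oo)%E
    & forall s1 s2, 0 <= s1 -> s1 <= s2 -> s2 <= t ->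
        Wp (sigma s1) (sigma s2) <=
        \int[lebesgue_measure]_(s in `[s1, s2]) h s].

Definition ACp (t : R) : set (R -> Wspace d p) :=
  [set sigma | exists h, speed_bound sigma t h].

Definition is_metric_derivative sigma (t : R) (h : R -> R) : Prop :=
  speed_bound sigma t h /\
  forall k, speed_bound sigma t k ->
    {ae (@lebesgue_measure R), forall s, s \in `[0, t] -> h s <= k s}.

(* Any two such [h] agree almost everywhere on [0, t], so the choice made by
   [xget] does not affect the action integral below. *)
Definition metric_derivative sigma (t : R) : R -> R :=
  xget (fun=> 0) [set h | is_metric_derivative sigma t h].

Definition value_function (G V : Wspace d p -> R) (mu : Wspace d p) (t : R) :
    \bar R :=
  ereal_inf
    [set (G (sigma 0) +
          \int[lebesgue_measure]_(s in `[0, t])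
             (p^-1 * (metric_derivative sigma t s) `^ p - V (sigma s)))%:E
    | sigma in [set sigma | ACp t sigma /\ same_measure (sigma t) mu]].

End paths.

Section cotangent.
Context {R : realType} {d : nat} {p : R}.

Definition partial (i : 'I_d) (f : 'rV[R]_d -> R) : 'rV[R]_d -> R :=
  'D_(delta_mx 0 i) f.

Definition gradient (f : 'rV[R]_d -> R) (x : 'rV[R]_d) : 'rV[R]_d :=
  \row_i partial i f x.

Definition smooth (f : 'rV[R]_d -> R) : Prop :=
  forall s : seq 'I_d, let g := foldr partial f s in
    continuous g /\ forall i x, derivable g x (delta_mx 0 i).

Definition test_function (f : 'rV[R]_d -> R) : Prop :=
  smooth f /\ compact (closure [set x | f x != 0]).

Definition Lqnorm (q : R) (mu : Wspace d p) (xi : 'rV[R]_d -> 'rV[R]_d) :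
    \bar R :=
  ('N[mu]_(q%:E) [(fun x : borelRd R d => (enorm (xi x))%:E)])%E.

Definition CoTan (q : R) (mu : Wspace d p) : set ('rV[R]_d -> 'rV[R]_d) :=
  [set xi : 'rV[R]_d -> 'rV[R]_d |
    [/\ measurable_fun setT (xi : borelRd R d -> borelRd R d),
        (Lqnorm q mu xi < +oo)%E
      & forall e : R, 0 < e -> exists2 psi, test_function psi &
          (Lqnorm q mu (fun x => (xi x - gradient psi x)%R) < e%:E)%E]].

End cotangent.

Section viscosity.
Context {R : realType} {d : nat} {p : R}.
Implicit Types (u : Wspace d p * R -> R) (z : Wspace d p * R).

Definition cylinder (T : R) : set (Wspace d p * R) :=
  [set z | 0 < z.2 < T].

Definition usc_on (D : set (Wspace d p * R)) u : Prop :=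
  forall z0, D z0 -> forall c, u z0 < c -> \forall z \near z0, u z < c.

Definition lsc_on (D : set (Wspace d p * R)) u : Prop :=
  forall z0, D z0 -> forall c, c < u z0 -> \forall z \near z0, c < u z.

Definition continuous_on (D : set (Wspace d p * R)) u : Prop :=
  forall z0, D z0 -> u z @[z --> z0] --> u z0.

Definition pairings (mu0 : Wspace d p) (xi : 'rV[R]_d -> 'rV[R]_d)
    (mu : Wspace d p) : set (\bar R) :=
  [set (\int[pi]_z
          (edot (xi z.1) ((z.2 : 'rV[R]_d) - (z.1 : 'rV[R]_d)))%:E)%E
  | pi in optimal_coupling mu0 mu].

Definition little_o z0 (r g : Wspace d p * R -> R) : Prop :=
  forall e : R, 0 < e -> \forall z \near z0, `|r z| <= e * `|g z|.

Definition superdifferential u z0 (a : R) (xi : 'rV[R]_d -> 'rV[R]_d) : Prop :=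
  exists r1 r2 : Wspace d p * R -> R,
    [/\ little_o z0 r1 (fun z => z.2 - z0.2),
        little_o z0 r2 (fun z => Wp z.1 z0.1)
      & (\forall z \near z0,
         (u z)%:E <= (u z0)%:E + ereal_inf (pairings z0.1 xi z.1)
                     + (a * (z.2 - z0.2) + r1 z + r2 z)%:E)%E].

Definition subdifferential u z0 (a : R) (xi : 'rV[R]_d -> 'rV[R]_d) : Prop :=
  exists r1 r2 : Wspace d p * R -> R,
    [/\ little_o z0 r1 (fun z => z.2 - z0.2),
        little_o z0 r2 (fun z => Wp z.1 z0.1)
      & (\forall z \near z0,
         (u z0)%:E + ereal_sup (pairings z0.1 xi z.1)
           + (a * (z.2 - z0.2) + r1 z + r2 z)%:E <= (u z)%:E)%E].

Definition hamiltonian (q : R) (V : Wspace d p -> R) (mu : Wspace d p)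
    (xi : 'rV[R]_d -> 'rV[R]_d) : R :=
  q^-1 * (fine (Lqnorm q mu xi)) `^ q + V mu.

Definition viscosity_subsolution (q T : R) (V : Wspace d p -> R) u : Prop :=
  usc_on (cylinder T) u /\
  forall z0, cylinder T z0 -> forall a xi, CoTan q z0.1 xi ->
    superdifferential u z0 a xi -> a + hamiltonian q V z0.1 xi <= 0.

Definition viscosity_supersolution (q T : R) (V : Wspace d p -> R) u : Prop :=
  lsc_on (cylinder T) u /\
  forall z0, cylinder T z0 -> forall a xi, CoTan q z0.1 xi ->
    subdifferential u z0 a xi -> 0 <= a + hamiltonian q V z0.1 xi.

Definition viscosity_solution (q T : R) (V : Wspace d p -> R) u : Prop :=
  [/\ continuous_on (cylinder T) u, viscosity_subsolution q T V u
    & viscosity_supersolution q T V u].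

End viscosity.

(* Main.v *)
Require Import Defs.
From HB Require Import structures.
From mathcomp Require Import all_boot all_order all_algebra.
From mathcomp Require Import all_classical all_reals all_analysis.
From mathcomp Require Import measurable_realfun ring lra.
Import Order.TTheory GRing.Theory Num.Theory.
Import numFieldNormedType.Exports.
Local Open Scope classical_set_scope.
Local Open Scope ring_scope.

(* The value function is an infimum over paths [sigma] with a speed bound [h],
   the cost being [G (sigma 0) + energy - integral of V].  For [t] below the
   horizon, which depends only on the growth rate of [V] and on [p], the
   possible gain from [V] is absorbed by the kinetic energy, so near-optimal
   paths have bounded energy.  Continuity and dynamic programming then follow by
   replacing the last piece of a near-optimal path by a segment (a displacement
   interpolation along a coupling).

   Couplings are handled as joint laws [(X, Y)] on a probability space; finitely
   supported measures are dense, the triangle inequality is obtained by gluing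
   plans along a finitely valued approximation, and an optimal coupling between
   any measure and a finitely supported one exists because all such plans have
   densities bounded by one constant, among which the elements of least [L^2]
   norm of nested convex sets of almost optimal densities converge.

   Subsolution: with [v = |xi|^(q-2) xi], move [mu0] to a finitely supported
   measure within [h^2] of the law of [id - h v].  To first order the pairing of
   a cotangent vector with a plan depends only on the marginals, so the pairing
   with the optimal plan is [- h |xi|^q + o(h)], while the segment back to [mu0]
   costs [h |xi|^q / p + o(h)].  Supersolution: follow a near-optimal path
   backwards during time [h], perturb its point to a finitely supported measure,
   and bound the pairing below by [- |xi| W]; Young's inequality against the
   energy spent concludes. *)

(** Two obstacles shape the proof. The differentials quantify over optimal plans, and without any
    optimal plan the infimum of the pairings is [+oo] and the supremum [-oo], so that the inequality
    says nothing. Attainment is established here only towards finitely supported measures; hence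
    each test point is moved to such a measure at distance at most [h^2], negligible after division
    by the time step [h]. Paths too are optimal only up to [h^2], and in the supersolution the
    continuity of the value function, already established, carries its value to the moved point with
    the same error. The second obstacle is the metric derivative. No difference quotient is taken:
    speed bounds are stable under minima and decreasing limits, which yields a smallest one, and
    since the action is monotone in the speed, upper estimates may use any explicit speed bound. The
    horizon is [1 / (1 + 2 p A 2^p)] because the gain from [V] up to time [t <= 1] contains
    [A 2^p p t^p] times the energy, which must not exceed half of the energy; a further quarter is
    spent on the Lipschitz datum [G]. *)

Set Implicit Arguments.
Unset Strict Implicit.
Unset Printing Implicit Defensive.

(** * Euclidean space *)

Section Euclid.
Context {R : realType} {d : nat}.
Implicit Types x y z : 'rV[R]_d.

Lemma edotC x y : edot x y = edot y x.
Proof. by apply: eq_bigr => i _; rewrite mulrC. Qed.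

Lemma edotDl x y z : edot (x + y) z = edot x z + edot y z.
Proof. by rewrite /edot -big_split; apply: eq_bigr => i _ /=; rewrite mxE mulrDl. Qed.

Lemma edotZl a x y : edot (a *: x) y = a * edot x y.
Proof. by rewrite /edot mulr_sumr; apply: eq_bigr => i _ /=; rewrite mxE mulrA. Qed.

Lemma edotDr x y z : edot x (y + z) = edot x y + edot x z.
Proof. by rewrite !(edotC x) edotDl. Qed.

Lemma edotZr a x y : edot x (a *: y) = a * edot x y.
Proof. by rewrite !(edotC x) edotZl. Qed.

Lemma edotNl x y : edot (- x) y = - edot x y.
Proof. by rewrite -scaleN1r edotZl mulN1r. Qed.

Lemma edotNr x y : edot x (- y) = - edot x y.
Proof. by rewrite edotC edotNl edotC. Qed.

Lemma edotBl x y z : edot (x - y) z = edot x z - edot y z.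
Proof. by rewrite edotDl edotNl. Qed.

Lemma edot_ge0 x : 0 <= edot x x.
Proof. by apply: sumr_ge0 => i _; rewrite -expr2 sqr_ge0. Qed.

Lemma enorm_ge0 x : 0 <= enorm x.
Proof. exact: sqrtr_ge0. Qed.

Lemma enorm_sqr x : enorm x ^+ 2 = edot x x.
Proof. by rewrite sqr_sqrtr// edot_ge0. Qed.

Lemma enormZ a x : enorm (a *: x) = `|a| * enorm x.
Proof. by rewrite /enorm edotZl edotZr mulrA -expr2 sqrtrM ?sqr_ge0// sqrtr_sqr. Qed.

Lemma enormN x : enorm (- x) = enorm x.
Proof. by rewrite -scaleN1r enormZ normrN1 mul1r. Qed.

Lemma enorm_distC x y : enorm (x - y) = enorm (y - x).
Proof. by rewrite -enormN opprB. Qed.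

Lemma enorm0 : enorm (0 : 'rV[R]_d) = 0.
Proof. by rewrite -(scale0r 0) enormZ normr0 mul0r. Qed.

Lemma coord_le_enorm x i : `|x 0 i| <= enorm x.
Proof.
rewrite -sqrtr_sqr ler_wsqrtr// /edot (bigD1 i)//= expr2 lerDl.
by apply: sumr_ge0 => j _; rewrite -expr2 sqr_ge0.
Qed.

Lemma enorm_eq0 x : enorm x = 0 -> x = 0.
Proof.
move=> x0; apply/rowP => i; rewrite mxE; apply/eqP.
by rewrite -normr_le0 -x0 coord_le_enorm.
Qed.

(* Expand the nonnegative square norm of [|y|^2 x - (x.y) y]. *)
Lemma edot_le x y : edot x y <= enorm x * enorm y.
Proof.
have [y0|yn0] := eqVneq (enorm y) 0.
  rewrite y0 mulr0 (enorm_eq0 y0) /edot big1// => i _.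
  by rewrite mxE mulr0.
apply: le_trans (ler_norm _) _.
rewrite -(@ler_pXn2r _ 2)// ?nnegrE ?mulr_ge0 ?enorm_ge0//.
rewrite real_normK ?num_real// exprMn !enorm_sqr.
have y2 : 0 < edot y y by rewrite -enorm_sqr exprn_gt0// lt_def yn0 enorm_ge0.
have := edot_ge0 (edot y y *: x - edot x y *: y).
rewrite edotBl !(edotDr, edotNr, edotZl, edotZr) (edotC y x) => H.
rewrite -subr_ge0 -(pmulr_rge0 _ y2).
apply: le_trans H _; rewrite le_eqVlt; apply/orP; left; apply/eqP; ring.
Qed.

Lemma norm_edot_le x y : `|edot x y| <= enorm x * enorm y.
Proof.
rewrite ler_norml edot_le andbT -lerN2 opprK -edotNl.
by rewrite -(enormN x) edot_le.
Qed.

Lemma ler_enormD x y : enorm (x + y) <= enorm x + enorm y.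
Proof.
rewrite -(@ler_pXn2r _ 2)// ?nnegrE ?addr_ge0 ?enorm_ge0//.
rewrite sqrrD !enorm_sqr edotDl !edotDr (edotC y x).
have := edot_le x y; lra.
Qed.

Lemma ler_enorm_dist z x y : enorm (x - y) <= enorm (x - z) + enorm (z - y).
Proof. by rewrite (le_trans _ (ler_enormD _ _))// addrA subrK. Qed.

Lemma ler_enormB x y : enorm (x - y) <= enorm x + enorm y.
Proof. by rewrite -(enormN y) ler_enormD. Qed.

Lemma enorm_le_sum x : enorm x <= \sum_(i < d) `|x 0 i|.
Proof.
rewrite -(@ler_pXn2r _ 2)// ?nnegrE ?enorm_ge0// ?sumr_ge0//.
rewrite enorm_sqr expr2 mulr_suml; apply: ler_sum => i _.
rewrite -expr2 -real_normK ?num_real// expr2 ler_wpM2l//.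
by rewrite (bigD1 i)//= lerDl sumr_ge0.
Qed.

Lemma norm_le_enorm x : `|x| <= enorm x.
Proof.
rewrite /Num.norm/= mx_normrE.
by apply/bigmax_leP; split => [|[i j] _ /=]; rewrite ?enorm_ge0// ord1 coord_le_enorm.
Qed.

Lemma coord_le_norm x i : `|x 0 i| <= `|x|.
Proof.
rewrite [leRHS]/Num.norm/= mx_normrE.
by rewrite (le_bigmax _ (fun ij : 'I_1 * 'I_d => `|x ij.1 ij.2|) (0, i)).
Qed.

End Euclid.

Lemma exists_natSinv_lt {R : realType} (e : R) : 0 < e ->
  exists n : nat, n.+1%:R^-1 < e.
Proof.
move=> e0; near \oo => n; exists n; near: n.
exact: (near_infty_natSinv_lt (PosNum e0)).
Unshelve. all: by end_near. Qed.

Lemma measurable_forall d1 (T : measurableType d1) (I : countType) (A : I -> set T) :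
  (forall i, measurable (A i)) -> measurable [set t | forall i, A i t].
Proof.
move=> mA; rewrite [X in measurable X](_ : _ = ~` \bigcup_i ~` A i).
  by apply/measurableC/countable_bigcupT_measurable => // i; exact: measurableC.
rewrite setC_bigcup; apply/seteqP; split => t /= At i => [_|]; first by rewrite setCK; exact: At.
by have := At i Logic.I; rewrite setCK.
Qed.

(** * The Borel sigma-algebra of R^d through coordinates *)

Section Borel.
Context {R : realType} {d : nat}.
Local Notation Rd := (borelRd R d).

Lemma open_measurable_rV (A : set 'rV[R]_d) : open A -> measurable (A : set Rd).
Proof. by move=> oA; exact: sub_sigma_algebra. Qed.

Lemma continuous_measurable_rV (f : 'rV[R]_d -> R) : continuous f ->
  measurable_fun setT (f : Rd -> R).
Proof.
move=> cf; apply: (measurability _ (RGenOInfty.measurableE R)) => _ [_ [a ->] <-].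
rewrite setTI; apply: open_measurable_rV.
apply: open_comp => [x _|]; first exact: cf.
exact: interval_open.
Qed.

Lemma continuous_coord (i : 'I_d) : continuous (fun x : 'rV[R]_d => x 0 i).
Proof. exact: coord_continuous. Qed.

Lemma measurable_coord (i : 'I_d) : measurable_fun setT (fun x : Rd => (x : 'rV[R]_d) 0 i).
Proof. have H := @continuous_coord i; exact: (continuous_measurable_rV H). Qed.

(** Every open set is a countable union of open cubes with rational centre and radius [1/(n+1)], and
    the preimage of a cube is a finite intersection of conditions on the coordinates. *)
Lemma measurable_fun_rV d1 (T : measurableType d1) (f : T -> Rd) :
  (forall i, measurable_fun setT (fun x => (f x : 'rV[R]_d) 0 i)) ->
  measurable_fun setT f.
Proof.
move=> mf; apply: (@measurability _ _ _ _ setT f (@open 'rV[R]_d)) => // _ [U oU <-].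
rewrite setTI.
pose B (cn : 'rV[rat]_d * nat) : set 'rV[R]_d :=
  [set x | forall i, `|ratr (cn.1 0 i) - x 0 i| < cn.2.+1%:R^-1].
have UE : U = \bigcup_(cn in [set cn | B cn `<=` U]) B cn.
  apply/seteqP; split => [x Ux|x [cn /= /[apply]]//].
  have /nbhs_ballP[e /= e0 eU] : nbhs x U by exact: open_nbhs_nbhs.
  (* A cube of this radius that contains [x] has all its points within [e] of [x]. *)
  have [n ne] : exists n : nat, n.+1%:R^-1 < e / 2.
    exact/exists_natSinv_lt/divr_gt0.
  have n0 : 0 < n.+1%:R^-1 :> R by rewrite invr_gt0.
  pose c : 'rV[rat]_d := \row_i xget 0 [set q : rat | `|ratr q - x 0 i| < n.+1%:R^-1].
  have cP i : `|ratr (c 0 i) - x 0 i| < n.+1%:R^-1.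
    rewrite mxE; case: xgetP => [q _ //|].
    have [q] := @rat_in_itvoo R (x 0 i - n.+1%:R^-1) (x 0 i + n.+1%:R^-1)
      ltac:(by rewrite ltrBlDr -addrA ltrDl addr_gt0).
    rewrite in_itv/= => qP /(_ q) [] /=.
    by rewrite ltr_distl.
  exists (c, n) => //= y yB; apply: eU; split => // j i; rewrite ord1 /ball/=.
  have := yB i; have := cP i => /= + +.
  rewrite distrC => h1 h2; have := ler_distD (ratr (c 0 i)) (x 0 i) (y 0 i).
  by move=> h3; apply: le_lt_trans h3 _; rewrite [e]splitr ltrD// (lt_trans _ ne).
rewrite UE preimage_bigcup bigcup_mkcond.
apply: countable_bigcupT_measurable => // cn; case: ifP => // _.
apply: measurable_forall => i.
rewrite -[X in measurable X]setTI.
apply: (measurable_fun_ltr (f := fun t => `|ratr (cn.1 0 i) - (f t : 'rV[R]_d) 0 i|)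
  (g := cst cn.2.+1%:R^-1)) => //.
by apply: measurableT_comp => //; exact: measurable_funB.
Qed.


Lemma measurable_coordT d1 (T : measurableType d1) (f : T -> Rd) i :
  measurable_fun setT f -> measurable_fun setT (fun x => (f x : 'rV[R]_d) 0 i).
Proof. by move=> mf; have := measurableT_comp (measurable_coord i) mf. Qed.

Lemma measurable_edot d1 (T : measurableType d1) (f g : T -> Rd) :
  measurable_fun setT f -> measurable_fun setT g ->
  measurable_fun setT (fun x => edot (f x) (g x)).
Proof.
move=> mf mg; apply: measurable_sum => i.
by apply: measurable_funM; exact: measurable_coordT.
Qed.

Lemma measurable_sqrtr : measurable_fun setT (@Num.sqrt R).
Proof. have H := @sqrt_continuous R; exact: continuous_measurable_fun. Qed.

Lemma measurable_enorm d1 (T : measurableType d1) (f : T -> Rd) :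
  measurable_fun setT f -> measurable_fun setT (fun x => enorm (f x)).
Proof.
move=> mf; apply: (measurableT_comp measurable_sqrtr).
exact: measurable_edot.
Qed.

Lemma measurable_rVD d1 (T : measurableType d1) (f g : T -> Rd) :
  measurable_fun setT f -> measurable_fun setT g ->
  measurable_fun setT (fun x => (f x : 'rV[R]_d) + g x : Rd).
Proof.
move=> mf mg; apply: measurable_fun_rV => i.
under eq_fun do rewrite mxE.
by apply: measurable_funD; exact: measurable_coordT.
Qed.

Lemma measurable_rVZ d1 (T : measurableType d1) (a : T -> R) (f : T -> Rd) :
  measurable_fun setT a -> measurable_fun setT f ->
  measurable_fun setT (fun x => a x *: (f x : 'rV[R]_d) : Rd).
Proof.
move=> ma mf; apply: measurable_fun_rV => i.
under eq_fun do rewrite mxE.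
by apply: measurable_funM => //; exact: measurable_coordT.
Qed.

Lemma measurable_rVB d1 (T : measurableType d1) (f g : T -> Rd) :
  measurable_fun setT f -> measurable_fun setT g ->
  measurable_fun setT (fun x => (f x : 'rV[R]_d) - g x : Rd).
Proof.
move=> mf mg; apply: measurable_fun_rV => i.
under eq_fun do rewrite !mxE.
by apply: measurable_funB; exact: measurable_coordT.
Qed.

Lemma measurable_singleton (y : Rd) : measurable [set y].
Proof.
rewrite -[X in measurable X]setCK; apply: measurableC.
apply: (@open_measurable_rV (~` [set (y : 'rV[R]_d)])); apply: closed_openC.
apply: accessible_closed_set1.
exact/hausdorff_accessible/norm_hausdorff.
Qed.

End Borel.

(** * Moments and L^p norms *)

Section Lp.
Context d (T : measurableType d) {R : realType} (mu : {measure set T -> \bar R}).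
Implicit Types (f g : T -> R) (r : R).

Definition finite_pmoment r f : Prop :=
  measurable_fun setT f /\ (\int[mu]_x (`|f x| `^ r)%:E < +oo)%E.

(** An infinite integral defaults to 0 here, so the number is meaningful only together with
    [finite_pmoment]. *)
Definition pnorm r f : R := (\int[mu]_x (`|f x| `^ r)) `^ r^-1.

Lemma pnorm_ge0 r f : 0 <= pnorm r f.
Proof. exact: powR_ge0. Qed.

Lemma measurable_normpow r f : measurable_fun setT f ->
  measurable_fun setT (fun x => `|f x| `^ r).
Proof.
move=> mf; apply: (measurableT_comp (measurable_powR r)).
exact: measurableT_comp.
Qed.

Lemma finite_pmoment_integrable r f : finite_pmoment r f ->
  mu.-integrable setT (fun x => (`|f x| `^ r)%:E).
Proof.
move=> [mf fy]; apply/integrableP; split.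
  exact/measurable_EFinP/measurable_normpow.
by under eq_integral do rewrite gee0_abs ?lee_fin ?powR_ge0//.
Qed.

Lemma pmoment_fin r f : finite_pmoment r f ->
  (\int[mu]_x (`|f x| `^ r)%:E)%E = (\int[mu]_x (`|f x| `^ r))%:E.
Proof.
by move=> fp; rewrite fineK//; apply: integrable_fin_num => //; exact: finite_pmoment_integrable.
Qed.

Lemma Lnorm_pnorm r f : finite_pmoment r f ->
  ('N[mu]_r%:E[EFin \o f] = (pnorm r f)%:E)%E.
Proof.
move=> fp; rewrite unlock /pnorm -poweR_EFin; congr (_ `^ _)%E.
by rewrite -pmoment_fin//; apply: eq_integral => x _ /=; rewrite poweR_EFin.
Qed.

Lemma finite_pmoment_Lnorm r f : 0 < r -> measurable_fun setT f ->
  ('N[mu]_r%:E[EFin \o f] < +oo)%E -> finite_pmoment r f.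
Proof.
move=> r0 mf fy; split => //.
rewrite (_ : (\int[mu]_x _)%E = ('N[mu]_r%:E[EFin \o f] `^ r)%E) ?poweR_lty//.
by rewrite poweR_Lnorm ?gt_eqF//; apply: eq_integral => x _ /=; rewrite poweR_EFin.
Qed.

Lemma pnorm_pow r f : 0 < r -> pnorm r f `^ r = \int[mu]_x (`|f x| `^ r).
Proof.
move=> r0; rewrite /pnorm -powRrM mulVf ?gt_eqF// powRr1//.
by apply: Rintegral_ge0 => x _; exact: powR_ge0.
Qed.

Lemma le_finite_pmoment r f g : 0 < r -> measurable_fun setT f ->
  (forall x, `|f x| <= `|g x|) -> finite_pmoment r g ->
  finite_pmoment r f /\ pnorm r f <= pnorm r g.
Proof.
move=> r0 mf fg gp.
have lefg x : `|f x| `^ r <= `|g x| `^ r.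
  by apply: ge0_ler_powR; rewrite ?nnegrE// ltW.
have fp : finite_pmoment r f.
  split=> //; apply: le_lt_trans (proj2 gp); apply: ge0_le_integral => //.
  - exact/measurable_EFinP/measurable_normpow.
  - by apply/measurable_EFinP/measurable_normpow; case: gp.
  - by move=> x _; rewrite lee_fin.
split; first exact: fp.
apply: ge0_ler_powR.
- by rewrite invr_ge0 ltW.
- by rewrite nnegrE; apply: Rintegral_ge0 => x _; exact: powR_ge0.
- by rewrite nnegrE; apply: Rintegral_ge0 => x _; exact: powR_ge0.
apply: le_Rintegral => //; exact: finite_pmoment_integrable.
Qed.

Lemma finite_pmomentD r f g : 1 <= r -> finite_pmoment r f -> finite_pmoment r g ->
  finite_pmoment r (f \+ g) /\ pnorm r (f \+ g) <= pnorm r f + pnorm r g.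
Proof.
move=> r1 fp gp; have r0 : 0 < r by rewrite (lt_le_trans _ r1).
have [mf _] := fp; have [mg _] := gp.
have := @minkowski_EFin _ _ _ mu f g r mf mg r1.
rewrite (Lnorm_pnorm fp) (Lnorm_pnorm gp) => H.
have fgp : finite_pmoment r (f \+ g).
  apply: finite_pmoment_Lnorm => //; first exact: measurable_funD.
  by apply: le_lt_trans H _; rewrite -EFinD ltry.
by split => //; move: H; rewrite (Lnorm_pnorm fgp) -EFinD lee_fin.
Qed.

Lemma finite_pmomentZ r a f : 0 < r -> finite_pmoment r f ->
  finite_pmoment r (fun x => a * f x) /\ pnorm r (fun x => a * f x) = `|a| * pnorm r f.
Proof.
move=> r0 fp; have [mf fy] := fp.
have E x : `|a * f x| `^ r = `|a| `^ r * `|f x| `^ r by rewrite normrM powRM.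
split.
  split; first exact: measurable_funM.
  under eq_integral do rewrite E EFinM.
  rewrite ge0_integralZl_EFin ?powR_ge0//.
  - by rewrite pmoment_fin// -EFinM ltry.
  - exact/measurable_EFinP/measurable_normpow.
rewrite /pnorm; under eq_Rintegral do rewrite E.
rewrite RintegralZl//; last exact: finite_pmoment_integrable.
rewrite powRM ?powR_ge0//; last by apply: Rintegral_ge0 => x _; exact: powR_ge0.
by rewrite -powRrM mulfV ?gt_eqF// powRr1.
Qed.

Lemma hoelder_pnorm (r s : R) f g : 0 < r -> 0 < s -> r^-1 + s^-1 = 1 ->
  finite_pmoment r f -> finite_pmoment s g ->
  mu.-integrable setT (EFin \o (f \* g)) /\
  \int[mu]_x (`|f x * g x|) <= pnorm r f * pnorm s g.
Proof.
move=> r0 s0 rs fp gp; have [mf _] := fp; have [mg _] := gp.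
have := hoelder mu mf mg r0 s0 rs.
rewrite Lnorm1 (Lnorm_pnorm fp) (Lnorm_pnorm gp) -EFinM => H.
have fgI : mu.-integrable setT (EFin \o (f \* g)).
  apply/integrableP; split; first exact/measurable_EFinP/measurable_funM.
  by apply: le_lt_trans H _; rewrite ltry.
split => //; rewrite -lee_fin; apply: le_trans H; rewrite /Rintegral.
by rewrite fineK//; apply: integrable_fin_num => //; exact: (integrable_abse fgI).
Qed.

End Lp.

Section Lp_probability.
Context d (T : measurableType d) {R : realType} (P : probability T R).

Lemma finite_pmoment_cst (r a : R) : 0 < r ->
  finite_pmoment P r (cst a) /\ pnorm P r (cst a) = `|a|.
Proof.
move=> r0; split.
  split; first exact: measurable_cst.
  rewrite [X in (X < _)%E](_ : _ = \int[P]_x (cst (`|a| `^ r)%:E x))%E//.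
  by rewrite integral_cst//= probability_setT mule1 ltry.
rewrite /pnorm/= Rintegral_cst//= probability_setT mulr1 -powRrM mulfV ?gt_eqF//.
by rewrite powRr1.
Qed.

Lemma Rintegral_le_pnorm (r s : R) (f : T -> R) : 0 < r -> 0 < s -> r^-1 + s^-1 = 1 ->
  finite_pmoment P r f ->
  P.-integrable setT (EFin \o f) /\ \int[P]_x `|f x| <= pnorm P r f.
Proof.
move=> r0 s0 rs fp; have [cp c1] := finite_pmoment_cst 1 s0.
have [] := hoelder_pnorm r0 s0 rs fp cp.
rewrite c1 normr1 mulr1 => a H; split.
  by apply: eq_integrable a => // x _ /=; rewrite mulr1.
by apply: le_trans H; under [leRHS]eq_Rintegral do rewrite mulr1.
Qed.

End Lp_probability.

Section law.
Context d1 d2 (T : measurableType d1) (T' : measurableType d2) {R : realType}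
  (P : probability T R).

Definition to_mfun (X : T -> T') (mX : measurable_fun setT X) : {mfun T >-> T'} :=
  HB.pack X (isMeasurableFun.Build _ _ _ _ X mX).

Definition law (X : T -> T') (mX : measurable_fun setT X) : probability T' R :=
  distribution P (to_mfun mX).

Lemma ge0_integral_law (X : T -> T') (mX : measurable_fun setT X) (f : T' -> \bar R) :
  measurable_fun setT f -> (forall y, 0 <= f y)%E ->
  (\int[law mX]_y f y = \int[P]_x f (X x))%E.
Proof. by move=> mf f0; rewrite ge0_integral_pushforward// preimage_setT. Qed.

Lemma integral_law (X : T -> T') (mX : measurable_fun setT X) (f : T' -> R) :
  measurable_fun setT f -> P.-integrable setT (fun x => (f (X x))%:E) ->
  (law mX).-integrable setT (EFin \o f) /\
  \int[law mX]_y f y = \int[P]_x f (X x).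
Proof.
move=> mf fI; split.
  by apply: integrable_pushforward => //; exact/measurable_EFinP.
by rewrite /Rintegral integral_pushforward// ?preimage_setT//; exact/measurable_EFinP.
Qed.

Lemma finite_pmoment_law (X : T -> T') (mX : measurable_fun setT X) (r : R) (f : T' -> R) :
  measurable_fun setT f ->
  (finite_pmoment (law mX) r f <-> finite_pmoment P r (f \o X)) /\
  pnorm (law mX) r f = pnorm P r (f \o X).
Proof.
move=> mf.
have E : (\int[law mX]_y (`|f y| `^ r)%:E = \int[P]_x (`|f (X x)| `^ r)%:E)%E.
  rewrite (@ge0_integral_law X mX (fun y => (`|f y| `^ r)%:E))//.
  exact/measurable_EFinP/measurable_normpow.
split; last by rewrite /pnorm /Rintegral E.
rewrite /finite_pmoment E; split => [[_ H]|[_ H]]; split => //.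
exact: measurableT_comp.
Qed.

End law.

(** * Joint laws and couplings *)

Section has_law_transfer.
Context {R : realType} d1 d2 (T : measurableType d1) (T' : measurableType d2).

(** The probability space is left free: it can be a plan with its two projections, a glued measure,
    or [mu] itself with the identity. Values are compared on measurable sets only, as in
    [same_measure]. *)
Definition has_law (P : probability T R) (X : T -> T') (mu : probability T' R) :=
  measurable_fun setT X /\ forall A : set T', measurable A -> P (X @^-1` A) = mu A.

Variables (P : probability T R) (X : T -> T') (mu : probability T' R).
Hypothesis lX : has_law P X mu.

Lemma has_law_ge0_integral (f : T' -> \bar R) :
  measurable_fun setT f -> (forall y, 0 <= f y)%E ->
  (\int[P]_x f (X x) = \int[mu]_y f y)%E.
Proof.
move=> mf f0; have [mX XE] := lX.
rewrite -(ge0_integral_law P mX)//.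
by apply: eq_measure_integral => A mA _; exact: XE.
Qed.

Lemma has_law_integrable (f : T' -> R) : measurable_fun setT f ->
  mu.-integrable setT (EFin \o f) <-> P.-integrable setT (fun x => (f (X x))%:E).
Proof.
move=> mf; have [mX XE] := lX.
have mef : measurable_fun setT (EFin \o f) by exact/measurable_EFinP.
have E : (\int[P]_x `|(f (X x))%:E| = \int[mu]_y `|(f y)%:E|)%E.
  by rewrite -(has_law_ge0_integral (f := fun y => `|(f y)%:E|%E))//; exact: measurableT_comp.
split=> /integrableP[_ H]; apply/integrableP; split => //.
- by apply/measurable_EFinP; exact: measurableT_comp.
- by rewrite E.
- by rewrite -E.
Qed.

Lemma has_law_integral (f : T' -> R) : measurable_fun setT f ->
  mu.-integrable setT (EFin \o f) -> \int[P]_x f (X x) = \int[mu]_y f y.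
Proof.
move=> mf /(has_law_integrable mf) Pf; have [mX XE] := lX.
have [fI <-] := integral_law mX mf Pf.
by rewrite /Rintegral; congr fine; apply: eq_measure_integral => A mA _; exact: XE.
Qed.

Lemma has_law_pnorm (r : R) (f : T' -> R) : measurable_fun setT f ->
  (finite_pmoment P r (f \o X) <-> finite_pmoment mu r f) /\
  pnorm P r (f \o X) = pnorm mu r f.
Proof.
move=> mf; have [mX XE] := lX.
have E : (\int[P]_x (`|f (X x)| `^ r)%:E = \int[mu]_y (`|f y| `^ r)%:E)%E.
  rewrite -(has_law_ge0_integral (f := fun y => (`|f y| `^ r)%:E))//.
  exact/measurable_EFinP/measurable_normpow.
split; last by rewrite /pnorm /Rintegral /= E.
rewrite /finite_pmoment /= E; split => [[_ H]|[_ H]]; split => //.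
exact: measurableT_comp.
Qed.

End has_law_transfer.

Section Wlaw.
Context {R : realType} {d : nat} {p : R}.
Local Notation Rd := (borelRd R d).
Local Notation plan := (probability (Rd * Rd)%type R).
Implicit Types mu nu : Wspace d p.

Section moment.
Context d1 (T : measurableType d1) (P : probability T R) (X : T -> Rd) (mu : Wspace d p).
Hypothesis lX : has_law P X mu.

Lemma has_law_moment : finite_pmoment P p (fun w => enorm (X w)).
Proof.
have mE : measurable_fun setT (fun x : Rd => enorm x) by exact: measurable_enorm.
apply/(proj1 (has_law_pnorm lX p mE)); split => //.
by under eq_integral do rewrite ger0_norm ?enorm_ge0//; exact: wmoment.
Qed.

(** Rests on [|Y| <= |X| + |X - Y|]. It gives a perturbed random point the finite moment that [Wlaw]
    requires. *)
Lemma has_law_neq0 (Y : T -> Rd) : measurable_fun setT Y ->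
  finite_pmoment P p (fun w => enorm (X w - Y w)) -> 1 <= p ->
  finite_pmoment P p (fun w => enorm (Y w)).
Proof.
move=> mY XY p1; have [mX _] := lX.
have [H _] := finite_pmomentD p1 has_law_moment XY.
apply: (proj1 (le_finite_pmoment _ _ _ H)) => /=.
- exact: lt_le_trans p1.
- exact: measurable_enorm.
move=> x; rewrite ger0_norm ?enorm_ge0// ger0_norm ?addr_ge0 ?enorm_ge0//.
have := ler_enormB (X x) (X x - Y x); rewrite opprB addrC subrK; lra.
Qed.

End moment.

(** Transparent, so that its measure reduces to [law P mX]; [has_law_Wlaw] is then immediate. *)
Definition Wlaw d1 (T : measurableType d1) (P : probability T R) (X : T -> Rd)
  (mX : measurable_fun setT X) (fX : finite_pmoment P p (fun w => enorm (X w))) : Wspace d p.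
Proof.
apply: (@MkWspace R d p (law P mX)).
rewrite (ge0_integral_law P mX (f := fun x : Rd => (enorm (x : 'rV[R]_d) `^ p)%:E)).
- by have [_] := fX; under eq_integral do rewrite ger0_norm ?enorm_ge0//.
- apply/measurable_EFinP/(measurableT_comp (measurable_powR p)).
  exact: measurable_enorm.
- by move=> y; rewrite lee_fin powR_ge0.
Defined.

Lemma has_law_Wlaw d1 (T : measurableType d1) (P : probability T R) (X : T -> Rd)
  (mX : measurable_fun setT X) (fX : finite_pmoment P p (fun w => enorm (X w))) :
  has_law P X (Wlaw mX fX).
Proof. by split. Qed.

Lemma has_law_id mu : has_law mu id mu.
Proof. by split. Qed.

Lemma coupling_fst mu nu (pi : plan) : coupling mu nu pi -> has_law pi fst mu.
Proof.
move=> [_ H _]; split => // A mA; rewrite -H//; congr (pi _).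
by apply/seteqP; split => [[x y]|[x y] []].
Qed.

Lemma coupling_snd mu nu (pi : plan) : coupling mu nu pi -> has_law pi snd nu.
Proof.
move=> [_ _ H]; split => // A mA; rewrite -H//; congr (pi _).
by apply/seteqP; split => [[x y]|[x y] []].
Qed.

Hypothesis p1 : 1 < p.
Let p0 : 0 < p := lt_trans ltr01 p1.

Lemma has_law_dist d1 (T : measurableType d1) (P : probability T R) (X Y : T -> Rd) mu nu :
  has_law P X mu -> has_law P Y nu -> finite_pmoment P p (fun w => enorm (X w - Y w)).
Proof.
move=> lX lY; have [mX _] := lX; have [mY _] := lY.
have [H _] := finite_pmomentD (ltW p1) (has_law_moment lX) (has_law_moment lY).
apply: (proj1 (le_finite_pmoment _ _ _ H)) => //.
  exact/measurable_enorm/measurable_rVB.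
move=> x /=; rewrite ger0_norm ?enorm_ge0// ger0_norm ?addr_ge0 ?enorm_ge0//.
exact: ler_enormB.
Qed.

(** The moment condition on the plan follows from those on the marginals, because
    [sqrt (a^2 + b^2) <= a + b] for [a, b >= 0]. *)
Lemma coupling_has_law mu nu (pi : plan) :
  has_law pi fst mu -> has_law pi snd nu -> coupling mu nu pi.
Proof.
move=> l1 l2; split.
- have [H _] := finite_pmomentD (ltW p1) (has_law_moment l1) (has_law_moment l2).
  have [] := @le_finite_pmoment _ _ _ pi p
    (fun z : Rd * Rd => Num.sqrt (enorm (z.1 : 'rV[R]_d) ^+ 2 + enorm (z.2 : 'rV[R]_d) ^+ 2)) _ p0 _ _ H.
  + apply: (measurableT_comp measurable_sqrtr); apply: measurable_funD.
      by apply: measurable_funX; exact: measurable_enorm.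
    by apply: measurable_funX; exact: measurable_enorm.
  + move=> x /=; rewrite ger0_norm ?sqrtr_ge0// ger0_norm ?addr_ge0 ?enorm_ge0//.
    have h1 := enorm_ge0 (x.1 : 'rV[R]_d); have h2 := enorm_ge0 (x.2 : 'rV[R]_d).
    rewrite -[leRHS]ger0_norm ?addr_ge0// -sqrtr_sqr ler_wsqrtr// sqrrD.
    by rewrite -addrA lerD2l lerDr mulrn_wge0// mulr_ge0.
  + by move=> [_ +] _; under eq_integral do rewrite ger0_norm ?sqrtr_ge0//.
- move=> A mA; rewrite -(proj2 l1)//; congr (pi _).
  by apply/seteqP; split => [[x y] []|[x y]].
- move=> A mA; rewrite -(proj2 l2)//; congr (pi _).
  by apply/seteqP; split => [[x y] []|[x y]].
Qed.

Lemma transport_costE mu nu (pi : plan) : coupling mu nu pi ->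
  transport_cost (p := p) pi = (pnorm pi p (fun z => enorm ((z.1 : 'rV[R]_d) - z.2)))%:E.
Proof.
move=> c; have H := has_law_dist (coupling_fst c) (coupling_snd c).
have := Lnorm_pnorm H; rewrite unlock => <-.
rewrite /transport_cost; apply: (congr1 (fun x => x `^ p^-1)%E).
by apply: eq_integral => x _ /=; rewrite ger0_norm ?enorm_ge0// poweR_EFin.
Qed.

Lemma law_pair_coupling d1 (T : measurableType d1) (P : probability T R) (X Y : T -> Rd) mu nu :
  has_law P X mu -> has_law P Y nu ->
  exists pi : plan, [/\ coupling mu nu pi,
    (forall A, measurable A -> pi A = P ((fun w => (X w, Y w)) @^-1` A)) &
    pnorm pi p (fun z => enorm ((z.1 : 'rV[R]_d) - z.2)) = pnorm P p (fun w => enorm (X w - Y w))].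
Proof.
move=> lX lY; have [mX XE] := lX; have [mY YE] := lY.
have mXY : measurable_fun setT (fun w => (X w, Y w)) by exact: measurable_fun_pair.
exists (law P mXY); split => //.
  by apply: coupling_has_law; split.
have mE : measurable_fun setT (fun z : Rd * Rd => enorm ((z.1 : 'rV[R]_d) - z.2)).
  exact/measurable_enorm/measurable_rVB.
by rewrite (proj2 (finite_pmoment_law P mXY p mE)).
Qed.

(** Serves twice: it makes the infimum defining [Wp] finite, and it is the reference measure for the
    densities of plans in [semidiscrete_optimal]. *)
Lemma product_plan mu nu : exists2 pi : plan, coupling mu nu pi &
  forall A B, measurable A -> measurable B -> pi (A `*` B) = (mu A * nu B)%E.
Proof.
have E A B : measurable A -> measurable B -> ((mu \x nu) (A `*` B) = mu A * nu B)%E.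
  by move=> mA mB; exact: product_measure1E.
exists (mu \x nu)%E; last exact: E.
apply: coupling_has_law => //; split => // A mA.
- rewrite (_ : _ @^-1` _ = A `*` setT); last by apply/seteqP; split => [[x y]|[x y] []].
  transitivity (mu A * nu setT)%E; first exact: E.
  by rewrite (_ : nu setT = 1%E) ?mule1//; exact: probability_setT.
- rewrite (_ : _ @^-1` _ = setT `*` A); last by apply/seteqP; split => [[x y]|[x y] []].
  transitivity (mu setT * nu A)%E; first exact: E.
  by rewrite (_ : mu setT = 1%E) ?mul1e//; exact: probability_setT.
Qed.

Lemma Wp_eq mu nu :
  ereal_inf [set transport_cost (p := p) pi | pi in coupling mu nu] = (Wp mu nu)%:E /\ 0 <= Wp mu nu.
Proof.
have [pi0 c0 _] := product_plan mu nu.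
have ge0 : (0 <= ereal_inf [set transport_cost (p := p) pi | pi in coupling mu nu])%E.
  by apply: le_ereal_inf_tmp => _ [pi c <-]; rewrite (transport_costE c) lee_fin pnorm_ge0.
split; last exact: fine_ge0.
rewrite /Wp fineK// ge0_fin_numE//.
apply: (@le_lt_trans _ _ (transport_cost (p := p) pi0)).
  by apply: ereal_inf_lbound; exists pi0.
by rewrite (transport_costE c0) ltry.
Qed.

Lemma Wp_ge0 mu nu : 0 <= Wp mu nu.
Proof. by have [] := Wp_eq mu nu. Qed.

Lemma Wp_le_pnorm d1 (T : measurableType d1) (P : probability T R) (X Y : T -> Rd) mu nu :
  has_law P X mu -> has_law P Y nu -> Wp mu nu <= pnorm P p (fun w => enorm (X w - Y w)).
Proof.
move=> lX lY; have [pi [c _ <-]] := law_pair_coupling lX lY.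
rewrite -lee_fin -(proj1 (Wp_eq mu nu)) -(transport_costE c).
by apply: ereal_inf_lbound; exists pi.
Qed.

Lemma Wp_adherent mu nu (e : R) : 0 < e -> exists2 pi : plan, coupling mu nu pi &
  pnorm pi p (fun z => enorm ((z.1 : 'rV[R]_d) - z.2)) < Wp mu nu + e.
Proof.
move=> e0; have [E W0] := Wp_eq mu nu.
have [|_ [pi c <-] H] := @lb_ereal_inf_adherent _ [set transport_cost (p := p) pi | pi in coupling mu nu] e e0.
  by rewrite E.
by exists pi => //; move: H; rewrite (transport_costE c) E -EFinD lte_fin.
Qed.

Lemma Wp_xx mu : Wp mu mu = 0.
Proof.
apply/eqP; rewrite eq_le Wp_ge0 andbT.
apply: le_trans (Wp_le_pnorm (has_law_id mu) (has_law_id mu)) _.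
rewrite /pnorm (_ : Rintegral _ _ _ = 0) ?powR0 ?invr_neq0 ?gt_eqF//.
rewrite -[RHS](mul0r (fine (mu setT))) -(Rintegral_cst mu measurableT).
by apply: eq_Rintegral => x _; rewrite subrr enorm0 normr0 powR0 ?gt_eqF.
Qed.

Lemma Wp_sym mu nu : Wp mu nu = Wp nu mu.
Proof.
suff H (m n : Wspace d p) : Wp m n <= Wp n m by apply/le_anti; rewrite !H.
apply/ler_addgt0Pr => e e0; have [pi c /ltW] := Wp_adherent n m e0; apply: le_trans.
apply: le_trans (Wp_le_pnorm (coupling_snd c) (coupling_fst c)) _.
by rewrite le_eqVlt; apply/orP; left; apply/eqP; congr pnorm; apply/funext => z; rewrite enorm_distC.
Qed.

Lemma same_measure_has_law d1 (T : measurableType d1) (P : probability T R) (X : T -> Rd) mu nu :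
  has_law P X mu -> same_measure mu nu -> has_law P X nu.
Proof. by move=> [mX XE] s; split => // A mA; rewrite XE// s. Qed.

Lemma has_law_same_measure d1 (T : measurableType d1) (P : probability T R) (X : T -> Rd) mu nu :
  has_law P X mu -> has_law P X nu -> same_measure mu nu.
Proof. by move=> [mX XE] [_ YE] A mA; rewrite -XE// -YE. Qed.

Lemma same_measure_Wp mu nu : same_measure mu nu -> Wp mu nu = 0.
Proof.
move=> s; apply/eqP; rewrite eq_le Wp_ge0 andbT -(Wp_xx mu).
apply/ler_addgt0Pr => e e0; have [pi c /ltW] := Wp_adherent mu mu e0; apply: le_trans.
by apply: Wp_le_pnorm; [exact: coupling_fst c|exact: (same_measure_has_law (coupling_snd c))].
Qed.

End Wlaw.

(** * Simple approximation and the Wasserstein metric *)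

Lemma le_powR {R : realType} (p x y : R) : 0 <= p -> 0 <= x -> x <= y -> x `^ p <= y `^ p.
Proof.
by move=> p0 x0 xy; apply: ge0_ler_powR => //; rewrite nnegrE// (le_trans x0).
Qed.

Lemma lt_powR {R : realType} (p x y : R) : 0 < p -> 0 <= x -> x < y -> x `^ p < y `^ p.
Proof.
by move=> p0 x0 xy; apply: gt0_ltr_powR => //; rewrite nnegrE// (le_trans x0)// ltW.
Qed.

Lemma powRVK {R : realType} (p x : R) : 0 < p -> 0 <= x -> (x `^ p^-1) `^ p = x.
Proof. by move=> p0 x0; rewrite -powRrM mulVf ?gt_eqF// powRr1. Qed.

Lemma cvg_powR0 {R : realType} (u : R^nat) (p : R) : 0 < p -> (forall n, 0 <= u n) ->
  u @ \oo --> 0 -> u n `^ p @[n --> \oo] --> 0.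
Proof.
move=> p0 u0 /cvgrPdist_lt cu; apply/cvgrPdist_lt => e e0.
have := cu (e `^ p^-1); rewrite powR_gt0// => /(_ isT); apply: filterS => n.
rewrite !sub0r !normrN !ger0_norm ?powR_ge0// => h.
by rewrite -(powRVK p0 (ltW e0)) lt_powR.
Qed.

Lemma cvg_sumr {R : realType} (I : Type) (r : seq I) (f : I -> R^nat) (l : I -> R) :
  (forall i, f i @ \oo --> l i) -> \sum_(i <- r) f i n @[n --> \oo] --> \sum_(i <- r) l i.
Proof.
move=> fl; elim: r => [|a r IH].
  by under eq_fun do rewrite big_nil; rewrite big_nil; exact: cvg_cst.
by under eq_fun do rewrite big_cons; rewrite big_cons; exact: cvgD.
Qed.

Section simple_approximation.
Context d1 (T : measurableType d1) {R : realType}.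
Import HBSimple HBNNSimple.

(** The monotone approximations of the positive and negative parts are subtracted. At each point one
    of the two parts vanishes, and its approximation with it, so the difference stays dominated by
    [|f|]. *)
Lemma simple_approximation_bounded (f : T -> R) : measurable_fun setT f ->
  exists g : (T -> R)^nat, [/\ forall n, measurable_fun setT (g n),
    forall n, exists s : seq R, forall x, g n x \in s,
    forall n x, `|g n x| <= `|f x| & forall x, g ^~ x @ \oo --> f x].
Proof.
move=> mf.
have mef : measurable_fun setT (EFin \o f) by exact/measurable_EFinP.
have mp := measurable_funepos mef; have mn := measurable_funeneg mef.
pose fp := nnsfun_approx measurableT mp; pose fn := nnsfun_approx measurableT mn.
have pE x : ((EFin \o f)^\+ x)%E = (Num.max (f x) 0)%:E by rewrite funeposE/= -EFin_max.
have nE x : ((EFin \o f)^\- x)%E = (Num.max (- f x) 0)%:E by rewrite funenegE/= -EFin_max.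
have cp x : (fun n => fp n x) @ \oo --> Num.max (f x) 0.
  have := @cvg_nnsfun_approx _ _ _ _ measurableT _ mp (fun x _ => funepos_ge0 _ x) x Logic.I.
  by rewrite pE => /fine_cvgP[].
have cn x : (fun n => fn n x) @ \oo --> Num.max (- f x) 0.
  have := @cvg_nnsfun_approx _ _ _ _ measurableT _ mn (fun x _ => funeneg_ge0 _ x) x Logic.I.
  by rewrite nE => /fine_cvgP[].
have lp n x : fp n x <= Num.max (f x) 0.
  by rewrite /fp nnsfun_approxE -lee_fin -pE le_approx.
have ln n x : fn n x <= Num.max (- f x) 0.
  by rewrite /fn nnsfun_approxE -lee_fin -nE le_approx.
exists (fun n x => fp n x - fn n x); split.
- by move=> n; apply: measurable_funB.
- move=> n.
  have /finite_seqP[s1 s1E] := @fimfunP _ _ (fp n).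
  have /finite_seqP[s2 s2E] := @fimfunP _ _ (fn n).
  exists [seq a - b | a <- s1, b <- s2] => x; apply/allpairsP; exists (fp n x, fn n x); split => //=.
  + have : range (fp n) (fp n x) by exists x.
    by rewrite s1E.
  + have : range (fn n) (fn n x) by exists x.
    by rewrite s2E.
- move=> n x; have := lp n x; have := ln n x.
  have : 0 <= fp n x by []. have : 0 <= fn n x by [].
  rewrite ler_norml; have [|] := leP 0 (f x) => h; rewrite ?(ger0_norm h) ?(ltr0_norm h).
    have -> : Num.max (- f x) 0 = 0 by apply/max_idPr; lra.
    by move=> *; apply/andP; lra.
  have -> : Num.max (- f x) 0 = - f x by apply/max_idPl; lra.
  by move=> *; apply/andP; lra.
- move=> x.
  apply: (@cvg_trans _ (nbhs (Num.max (f x) 0 - Num.max (- f x) 0))); first exact: cvgB (cp x) (cn x).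
  suff -> : Num.max (f x) 0 - Num.max (- f x) 0 = f x by [].
  by rewrite !maxEle; case: ifP; case: ifP; lra.
Qed.

Context {d : nat}.
Local Notation Rd := (borelRd R d).

Lemma simple_approximation_rV (X : T -> Rd) : measurable_fun setT X ->
  exists Y : (T -> Rd)^nat, [/\ forall n, measurable_fun setT (Y n),
    forall n, exists s : seq 'rV[R]_d, forall x, (Y n x : 'rV[R]_d) \in s,
    forall n x, enorm (X x - Y n x) <= (2 * d%:R) * enorm (X x)
    & forall x, enorm (X x - Y n x) @[n --> \oo] --> 0].
Proof.
move=> mX.
have /choice[g gP] : forall i : 'I_d, exists g : (T -> R)^nat,
  [/\ forall n, measurable_fun setT (g n),
    forall n, exists s : seq R, forall x, g n x \in s,
    forall n x, `|g n x| <= `|(X x : 'rV[R]_d) 0 i| & forall x, g ^~ x @ \oo --> (X x : 'rV[R]_d) 0 i].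
  by move=> i; apply: simple_approximation_bounded; exact: measurable_coordT.
pose Y n x : 'rV[R]_d := \row_i g i n x.
exists Y; split.
- move=> n; apply: measurable_fun_rV => i.
  rewrite (_ : (fun x => _) = g i n); last by apply/funext => x; rewrite mxE.
  by have [] := gP i.
- move=> n; have /choice[s sP] : forall i, exists s : seq R, forall x, g i n x \in s.
    by move=> i; have [_ H _ _] := gP i.
  (* All vectors whose [i]-th coordinate is taken from [s i]. One common index bound, the sum of the
     sizes, serves every coordinate; an index beyond [size (s i)] merely returns the default 0. *)
  exists (codom (fun f : {ffun 'I_d -> 'I_(\sum_i size (s i))} => \row_i (s i)`_(f i) : 'rV[R]_d)) => x.
  have lt i : (index (g i n x) (s i) < \sum_i size (s i))%N.
    apply: (@leq_trans (size (s i))); first by rewrite index_mem.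
    by rewrite (bigD1 i)//= leq_addr.
  apply/codomP; exists [ffun i => Ordinal (lt i)]; apply/rowP => i.
  by rewrite !mxE ffunE /= nth_index.
(* Each coordinate errs by at most [2 |X x|], hence the factor [2 d]. *)
- move=> n x; apply: le_trans (enorm_le_sum _) _.
  rewrite [leRHS](_ : _ = \sum_(i < d) 2 * enorm (X x)); last first.
    by rewrite sumr_const card_ord -mulr_natl; ring.
  apply: ler_sum => i _; rewrite !mxE.
  have [_ _ H _] := gP i; have := H n x => {}H.
  apply: le_trans (ler_normB _ _) _; rewrite mulr_natl mulr2n.
  by apply: lerD; [|apply: le_trans H _]; exact: coord_le_enorm.
- move=> x.
  apply: (@squeeze_cvgr _ _ _ _ (fun=> 0) (fun n => \sum_(i < d) `|(X x : 'rV[R]_d) 0 i - g i n x|)).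
  + apply: nearW => n; rewrite enorm_ge0 /=; apply: le_trans (enorm_le_sum _) _.
    by apply: ler_sum => i _; rewrite !mxE.
  + exact: cvg_cst.
  + rewrite [X in _ --> X](_ : _ = \sum_(i < d) 0); last by rewrite big1.
    apply: cvg_sumr => i.
    have [_ _ _ /(_ x) H] := gP i.
    by rewrite -(normr0 R) -(subrr ((X x : 'rV[R]_d) 0 i)); apply: cvg_norm; apply: cvgB => //; exact: cvg_cst.
Qed.

Variable P : probability T R.

Lemma simple_approximation_pnorm (p : R) (X : T -> Rd) (e : R) : 0 < p -> 0 < e ->
  measurable_fun setT X -> finite_pmoment P p (fun w => enorm (X w)) ->
  exists (Y : T -> Rd) (s : seq 'rV[R]_d), [/\ measurable_fun setT Y,
    forall x, (Y x : 'rV[R]_d) \in s,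
    finite_pmoment P p (fun w => enorm (X w - Y w)) &
    pnorm P p (fun w => enorm (X w - Y w)) < e].
Proof.
move=> p0 e0 mX fX.
have [Y [mY sY dY cY]] := simple_approximation_rV mX.
have mD n : measurable_fun setT (fun w => enorm (X w - Y n w)).
  by apply: measurable_enorm; exact: measurable_rVB.
have fD n : finite_pmoment P p (fun w => enorm (X w - Y n w)).
  have [H _] := finite_pmomentZ (2 * d%:R) p0 fX.
  apply: (proj1 (le_finite_pmoment p0 _ _ H)) => //.
  by move=> x; rewrite ger0_norm ?enorm_ge0// (le_trans (dY n x))// ler_norm.
have c : pnorm P p (fun w => enorm (X w - Y n w)) `^ p @[n --> \oo] --> 0.
  under eq_fun do rewrite pnorm_pow//.
  have [H _] := finite_pmomentZ (2 * d%:R) p0 fX.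
  have [] := @dominated_convergence _ _ _ P setT measurableT
    (fun n w => (`|enorm (X w - Y n w)| `^ p)%:E) (cst 0)
    (fun w => (`|2 * d%:R * enorm (X w)| `^ p)%:E).
  + by move=> n; exact/measurable_EFinP/measurable_normpow.
  + exact: measurable_cst.
  + apply: aeW => x _.
    apply: cvg_EFin; first exact: nearW.
    rewrite (_ : fine \o _ = (fun n => (enorm (X x - Y n x)) `^ p)).
      by apply: cvg_powR0 => // n; exact: enorm_ge0.
    by apply/funext => n /=; rewrite ger0_norm// enorm_ge0.
  + exact: finite_pmoment_integrable.
  + apply: aeW => x n _ /=; rewrite lee_fin ger0_norm ?powR_ge0//.
    rewrite (ger0_norm (enorm_ge0 _)).
    apply: le_powR; [exact: ltW|exact: enorm_ge0|].
    by rewrite (le_trans (dY n x))// ler_norm.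
  move=> _ _; rewrite integral0 => /fine_cvgP[_]; exact.
have : \forall n \near \oo, pnorm P p (fun w => enorm (X w - Y n w)) `^ p < e `^ p.
  by apply: cvgr_lt c _ _; rewrite powR_gt0.
move=> [N _ /(_ N (leqnn N))] /= H.
have [s sP] := sY N.
exists (Y N), s; split; [exact: mY|exact: sP|exact: fD|].
rewrite ltNge; apply/negP => le.
move: H; rewrite ltNge; apply/negP; rewrite negbK.
by apply: le_powR => //; exact: ltW.
Qed.

End simple_approximation.

Section to_probability.
Context d (T : measurableType d) {R : realType} (m : {measure set T -> \bar R}).
Hypothesis m1 : m setT = 1%E.

Definition to_probability of m setT = 1%E : set T -> \bar R := m.

HB.instance Definition _ := Measure.on (to_probability m1).
HB.instance Definition _ := Measure_isProbability.Build _ _ _ (to_probability m1) m1.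

End to_probability.

(** * Gluing two measures along labels *)

Section gluing.
Context {R : realType} d1 d2 (T1 : measurableType d1) (T2 : measurableType d2).

(* Given the common label, the two points are drawn independently. *)
Lemma glue (P1 : probability T1 R) (P2 : probability T2 R) (n : nat)
  (A : nat -> set T1) (B : nat -> set T2) :
  (forall k, measurable (A k)) -> (forall k, measurable (B k)) ->
  trivIset setT A -> trivIset setT B ->
  \big[setU/set0]_(k < n) A k = setT -> \big[setU/set0]_(k < n) B k = setT ->
  (forall k, (k < n)%N -> P1 (A k) = P2 (B k)) ->
  exists gam : probability (T1 * T2)%type R,
    [/\ has_law gam fst P1, has_law gam snd P2 &
        gam (\big[setU/set0]_(k < n) (A k `*` B k)) = 1%E].
Proof.
move=> mA mB tA tB cA cB AB.
have c0 k : 0 <= (fine (P1 (A k)))^-1 by rewrite invr_ge0 fine_ge0.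
have mAB k : measurable (A k `*` B k) by exact: measurableX.
(* The glued measure sums the product measures restricted to [A k] times [B k], each divided by the
   common mass of [A k] and [B k]. A class of mass zero gets weight [0^-1 = 0], which is consistent
   with its null marginals. *)
pose m k := mscale (NngNum (c0 k)) (mrestr (P1 \x P2)%E (mAB k)).
pose g : {measure set (T1 * T2) -> \bar R} := msum m n.
have fin1 k : P1 (A k) = (fine (P1 (A k)))%:E by rewrite fineK// fin_num_measure.
have gE S1 S2 : measurable S1 -> measurable S2 ->
    g (S1 `*` S2) = (\sum_(k < n) ((fine (P1 (A k)))^-1)%:E *
      (P1 (S1 `&` A k) * P2 (S2 `&` B k)))%E.
  move=> m1 m2; rewrite /g/= /msum; apply: eq_bigr => k _.
  rewrite /m/= /mscale/= /mrestr/=; congr (_ * _)%E.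
  rewrite -[in RHS](product_measure1E P1 P2); [|exact: measurableI..].
  congr ((P1 \x P2)%E _); apply/seteqP; split => [[x y] /= [[? ?] [? ?]]|[x y] /= [[? ?] [? ?]]];
    by repeat split.
have sumA S : measurable S -> (\sum_(k < n) P1 (S `&` A k))%E = P1 S.
  move=> mS; have U : \big[setU/set0]_(k < n) (S `&` A k) = S by rewrite -big_distrr/= cA setIT.
  rewrite -[in RHS]U; apply/esym/(measure_semi_additive_ord_I P1 (F := fun k => S `&` A k)).
  - by move=> k _; exact: measurableI.
  - exact/trivIset_setIl/(sub_trivIset _ tA).
  - by rewrite U.
have sumB S : measurable S -> (\sum_(k < n) P2 (S `&` B k))%E = P2 S.
  move=> mS; have U : \big[setU/set0]_(k < n) (S `&` B k) = S by rewrite -big_distrr/= cB setIT.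
  rewrite -[in RHS]U; apply/esym/(measure_semi_additive_ord_I P2 (F := fun k => S `&` B k)).
  - by move=> k _; exact: measurableI.
  - exact/trivIset_setIl/(sub_trivIset _ tB).
  - by rewrite U.
have g1 S : measurable S -> g (S `*` setT) = P1 S.
  move=> mS; rewrite gE// -sumA//; apply: eq_bigr => k _.
  rewrite setTI -AB//; have [z|nz] := eqVneq (fine (P1 (A k))) 0.
    rewrite fin1 z invr0 mul0e; apply/esym/eqP; rewrite eq_le measure_ge0 andbT.
    have -> : 0%E = P1 (A k) :> \bar R by rewrite fin1 z.
    by apply: le_measure; rewrite ?inE//; exact: measurableI.
  by rewrite fin1 muleCA -EFinM mulVf// mule1.
have g2 S : measurable S -> g (setT `*` S) = P2 S.
  move=> mS; rewrite gE// -sumB//; apply: eq_bigr => k _.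
  rewrite setTI; have [z|nz] := eqVneq (fine (P1 (A k))) 0.
    rewrite fin1 z mul0e mule0; apply/esym/eqP; rewrite eq_le measure_ge0 andbT.
    have -> : 0%E = P2 (B k) :> \bar R by rewrite -AB// fin1 z.
    by apply: le_measure; rewrite ?inE//; exact: measurableI.
  by rewrite [in X in (_ * X)%E]fin1 muleA -EFinM mulVf// mul1e.
have gT : g setT = 1%E by rewrite -setXTT g1// probability_setT.
exists (to_probability gT); split.
- split => // S mS; rewrite -g1//; congr (g _).
  by apply/seteqP; split => [[x y]|[x y] []].
- split => // S mS; rewrite -g2//; congr (g _).
  by apply/seteqP; split => [[x y]|[x y] []].
- rewrite -gT /=/g /= /msum; apply: eq_bigr => k _.
  rewrite /m/= /mscale/= /mrestr/=; congr (_ * _)%E; congr ((P1 \x P2)%E _).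
  rewrite setTI; apply/setIidPr.
  by move=> z zk; rewrite (bigD1 k)//=; left.
Qed.

(** In the triangle inequality the labels are the indices of the values of a finitely valued
    approximation, evaluated at the two copies of the middle point. *)
Lemma glue_label (P1 : probability T1 R) (P2 : probability T2 R) (n : nat)
  (a : T1 -> nat) (b : T2 -> nat) :
  (forall k, measurable (a @^-1` [set k])) -> (forall k, measurable (b @^-1` [set k])) ->
  (forall x, (a x < n)%N) -> (forall y, (b y < n)%N) ->
  (forall k, P1 (a @^-1` [set k]) = P2 (b @^-1` [set k])) ->
  exists gam : probability (T1 * T2)%type R,
    [/\ has_law gam fst P1, has_law gam snd P2, measurable [set z : T1 * T2 | a z.1 = b z.2] &
        gam [set z | a z.1 = b z.2] = 1%E].
Proof.
move=> ma mb an bn ab.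
have cov T (f : T -> nat) : (forall x, (f x < n)%N) -> \big[setU/set0]_(k < n) (f @^-1` [set k : nat]) = setT.
  by move=> fn; apply/seteqP; split => // x _; rewrite (bigD1 (Ordinal (fn x)))//=; left.
have tr T (f : T -> nat) : trivIset setT (fun k => f @^-1` [set k]) by move=> i j _ _ [x [<- <-]].
have E : [set z : T1 * T2 | a z.1 = b z.2] =
    \big[setU/set0]_(k < n) ((a @^-1` [set k : nat]) `*` (b @^-1` [set k : nat])).
  rewrite -(bigcup_mkord n (fun k => (a @^-1` [set k : nat]) `*` (b @^-1` [set k : nat]))).
  apply/seteqP; split => [[x y] /= xy|[x y] [k _ [/= -> ->]]]//.
  by exists (a x); rewrite //= an.
have [gam [g1 g2 g3]] := glue ma mb (tr _ a) (tr _ b) (cov _ _ an) (cov _ _ bn) (fun k _ => ab k).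
exists gam; split => //; last by rewrite E.
by rewrite E; apply: bigsetU_measurable => k _; exact: measurableX.
Qed.

End gluing.

Lemma has_law_comp {R : realType} d1 d2 d3 (T1 : measurableType d1) (T2 : measurableType d2)
  (T3 : measurableType d3) (P : probability T1 R) (Q : probability T2 R) (S : probability T3 R)
  (X : T1 -> T2) (Y : T2 -> T3) : has_law P X Q -> has_law Q Y S -> has_law P (Y \o X) S.
Proof.
move=> [mX XE] [mY YE]; split; first exact: measurableT_comp.
move=> A mA; rewrite -YE// -XE//.
by rewrite -[X in measurable X]setTI; exact: mY.
Qed.

Section metric.
Context {R : realType} {d : nat} {p : R}.
Hypothesis p1 : 1 < p.
Local Notation Rd := (borelRd R d).
Implicit Types mu nu : Wspace d p.
Let p0 : 0 < p := lt_trans ltr01 p1.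

Lemma pnorm_triangle3 d1 (T : measurableType d1) (P : probability T R) (X A B Y : T -> Rd) :
  measurable_fun setT X -> measurable_fun setT A -> measurable_fun setT B -> measurable_fun setT Y ->
  finite_pmoment P p (fun w => enorm (X w - A w)) ->
  finite_pmoment P p (fun w => enorm (A w - B w)) ->
  finite_pmoment P p (fun w => enorm (B w - Y w)) ->
  pnorm P p (fun w => enorm (X w - Y w)) <= pnorm P p (fun w => enorm (X w - A w)) +
   pnorm P p (fun w => enorm (A w - B w)) + pnorm P p (fun w => enorm (B w - Y w)).
Proof.
move=> mX mA mB mY XA AB BY.
have [H1 L1] := finite_pmomentD (ltW p1) XA AB.
have [H2 L2] := finite_pmomentD (ltW p1) H1 BY.
apply: (@le_trans _ _ _ _ _ _ (le_trans L2 _)); last first.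
  by rewrite lerD2r; exact: L1.
apply: (proj2 (le_finite_pmoment p0 _ _ H2)).
  by apply: measurable_enorm; exact: measurable_rVB.
move=> x /=; rewrite ger0_norm ?enorm_ge0// ger0_norm ?addr_ge0 ?enorm_ge0//.
apply: le_trans (ler_enorm_dist (B x) _ _) _.
by rewrite lerD2r; exact: ler_enorm_dist.
Qed.

Lemma pnorm_ae0 d1 (T : measurableType d1) (P : probability T R) (X Y : T -> Rd) (D : set T) :
  measurable_fun setT X -> measurable_fun setT Y -> measurable D -> P D = 1%E ->
  (forall w, D w -> X w = Y w) ->
  finite_pmoment P p (fun w => enorm (X w - Y w)) /\
  pnorm P p (fun w => enorm (X w - Y w)) = 0.
Proof.
move=> mX mY mD D1 XY.
have mXY : measurable_fun setT (fun w => enorm (X w - Y w)).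
  by apply: measurable_enorm; exact: measurable_rVB.
have E : (\int[P]_x (`|enorm (X x - Y x)| `^ p)%:E = 0)%E.
  rewrite -[RHS](integral0 P setT); apply: ae_eq_integral => //.
    exact/measurable_EFinP/measurable_normpow.
  exists (~` D); split; first exact: measurableC.
    by have := probability_setC P mD; rewrite D1 subee.
  move=> w /= H Dw; apply: H => _.
  by rewrite XY// subrr enorm0 normr0 powR0// gt_eqF.
split; first by split => //; rewrite E ltry.
by rewrite /pnorm /Rintegral E /= powR0// invr_neq0// gt_eqF.
Qed.

(** The two copies of the middle point in the glued measure share only the value of [Y]. Each lies,
    in [L^p], within [e / 4] of it, and both plans are within [e / 4] of optimal, so the four errors
    add up to [e]. *)
Lemma Wp_triangle nu mu kap : Wp mu kap <= Wp mu nu + Wp nu kap.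
Proof.
apply/ler_addgt0Pr => e e0.
have e4 : 0 < e / 4 by rewrite divr_gt0.
have [pi1 c1 L1] := Wp_adherent p1 mu nu e4.
have [pi2 c2 L2] := Wp_adherent p1 nu kap e4.
have [Y [s [mY sY fY LY]]] := simple_approximation_pnorm p0 e4 (proj1 (has_law_id nu)) (has_law_moment (has_law_id nu)).
(* Duplicates are removed so that the index [k] stands for exactly the value [nth 0 t k], and its
   level set is a level set of [Y]. *)
pose t := undup s.
have tY x : (Y x : 'rV[R]_d) \in t by rewrite mem_undup.
pose n := size t.
pose a (y : Rd) := index (Y y : 'rV[R]_d) t.
have an y : (a y < n)%N by rewrite index_mem.
have ma k : measurable (a @^-1` [set k]).
  have [kn|nk] := ltnP k n; last first.
    rewrite (_ : a @^-1` _ = set0)//; apply/seteqP; split => // y /= yk.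
    by move: nk; rewrite -yk leqNgt an.
  rewrite (_ : a @^-1` _ = Y @^-1` [set (nth 0 t k : Rd)]).
    by rewrite -[X in measurable X]setTI; apply: mY => //; exact: measurable_singleton.
  apply/seteqP; split => y /=; first by move=> <-; rewrite /= nth_index.
  by rewrite /a => ->; rewrite index_uniq// undup_uniq.
have l12 := coupling_snd c1; have l21 := coupling_fst c2.
have l11 := coupling_fst c1; have l22 := coupling_snd c2.
have m1 k : measurable ((a \o snd) @^-1` [set k] : set (Rd * Rd)).
  by rewrite -[X in measurable X]setTI; exact: (proj1 l12 measurableT _ (ma k)).
have m2 k : measurable ((a \o fst) @^-1` [set k] : set (Rd * Rd)).
  by rewrite -[X in measurable X]setTI; exact: (proj1 l21 measurableT _ (ma k)).
have [gam [g1 g2 mD gD]] := @glue_label R _ _ _ _ pi1 pi2 n (a \o snd) (a \o fst) m1 m2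
  (fun z => an z.2) (fun z => an z.1)
  (fun k => etrans (proj2 l12 _ (ma k)) (esym (proj2 l21 _ (ma k)))).
have gx := has_law_comp g1 l11; have gy := has_law_comp g1 l12.
have gy' := has_law_comp g2 l21; have gz := has_law_comp g2 l22.
apply: le_trans (Wp_le_pnorm p1 gx gz) _.
have mYy : measurable_fun setT (fun w : (Rd * Rd) * (Rd * Rd) => Y w.1.2).
  exact: measurableT_comp mY (proj1 gy).
have mYy' : measurable_fun setT (fun w : (Rd * Rd) * (Rd * Rd) => Y w.2.1).
  exact: measurableT_comp mY (proj1 gy').
have YY (w : (Rd * Rd) * (Rd * Rd)) : (a \o snd) w.1 = (a \o fst) w.2 -> Y w.1.2 = Y w.2.1.
  by rewrite /= /a => H; rewrite -(nth_index 0 (tY w.1.2)) H nth_index.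
have [fYY YY0] := pnorm_ae0 mYy mYy' mD gD YY.
have mdY : measurable_fun setT (fun y : Rd => enorm ((y : 'rV[R]_d) - Y y)).
  by apply: measurable_enorm; exact: measurable_rVB.
have [/(proj2)/(_ fY) fy Ey] := has_law_pnorm gy p mdY.
have [/(proj2)/(_ fY) fy' Ey'] := has_law_pnorm gy' p mdY.
have mdz : measurable_fun setT (fun z : Rd * Rd => enorm ((z.1 : 'rV[R]_d) - z.2)).
  by apply: measurable_enorm; exact: measurable_rVB.
have [_ E1] := has_law_pnorm g1 p mdz.
have [_ E2] := has_law_pnorm g2 p mdz.
have sw : (fun w : (Rd * Rd) * (Rd * Rd) => enorm ((Y w.2.1 : 'rV[R]_d) - w.2.1)) =
  (fun y : Rd => enorm ((y : 'rV[R]_d) - Y y)) \o (fst \o snd).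
  by apply/funext => w /=; rewrite enorm_distC.
have T1 := pnorm_triangle3 (P := gam) (proj1 gx) (proj1 gy) (proj1 gy') (proj1 gz)
  (has_law_dist p1 gx gy) (has_law_dist p1 gy gy') (has_law_dist p1 gy' gz).
have fy'' : finite_pmoment gam p (fun w => enorm ((Y w.2.1 : 'rV[R]_d) - w.2.1)) by rewrite sw.
have T2 := pnorm_triangle3 (P := gam) (proj1 gy) mYy mYy' (proj1 gy') fy fYY fy''.
rewrite YY0 sw Ey' [X in _ <= X + _ + _]Ey in T2.
rewrite [X in _ <= X + _ + _]E1 [X in _ <= _ + X]E2 in T1.
apply: le_trans T1 _.
move: L1 L2 LY T2; clear; move=> *; lra.
Qed.


Lemma Wp_same_l mu mu' nu : same_measure mu mu' -> Wp mu nu = Wp mu' nu.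
Proof.
move=> s; have h := same_measure_Wp p1 s; have h' := Wp_sym p1 mu mu'.
have := Wp_triangle mu' mu nu; have := Wp_triangle mu mu' nu.
by move=> h1 h2; apply/le_anti/andP; lra.
Qed.

(** [gam s] is the law of [(1 - s) x + s y] under [pi], for every real [s]; two such points differ
    by [(s - s') (y - x)], so the Lipschitz constant is the cost of the chosen plan. *)
Lemma interpolation mu nu (pi : probability (Rd * Rd)%type R) : coupling mu nu pi ->
  exists gam : R -> Wspace d p, [/\ same_measure (gam 0) mu, same_measure (gam 1) nu &
    forall s s', Wp (gam s) (gam s') <=
      `|s - s'| * pnorm pi p (fun z => enorm ((z.1 : 'rV[R]_d) - z.2))].
Proof.
move=> c; have l1 := coupling_fst c; have l2 := coupling_snd c.
pose X s (z : Rd * Rd) : Rd := ((1 - s) *: (z.1 : 'rV[R]_d) + s *: (z.2 : 'rV[R]_d)).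
have mX s : measurable_fun setT (X s).
  by apply: measurable_rVD; apply: measurable_rVZ.
have dX s s' z : enorm ((X s z : 'rV[R]_d) - X s' z) = `|s - s'| * enorm ((z.1 : 'rV[R]_d) - z.2).
  rewrite distrC -enormZ; congr enorm; apply/rowP => i; rewrite !mxE; ring.
have fz := has_law_dist p1 l1 l2.
have X0 z : X 0 z = z.1 by rewrite /X subr0 scale1r scale0r addr0.
have X1 z : X 1 z = z.2 by rewrite /X subrr scale1r scale0r add0r.
have fX s : finite_pmoment pi p (fun z => enorm (X s z)).
  apply: (has_law_neq0 l1 (mX s) _ (ltW p1)).
  have -> : (fun w => enorm (((w : Rd * Rd).1 : 'rV[R]_d) - X s w)) =
      (fun w => `|0 - s| * enorm ((w.1 : 'rV[R]_d) - w.2)).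
    by apply/funext => w; rewrite -dX X0.
  exact: (proj1 (finite_pmomentZ _ p0 fz)).
exists (fun s => Wlaw (mX s) (fX s)); split.
- apply: (@has_law_same_measure _ _ _ _ _ pi (X 0)); first exact: has_law_Wlaw.
  by have -> : X 0 = fst by apply/funext.
- apply: (@has_law_same_measure _ _ _ _ _ pi (X 1)); first exact: has_law_Wlaw.
  by have -> : X 1 = snd by apply/funext.
- move=> s s'.
  apply: le_trans (Wp_le_pnorm p1 (has_law_Wlaw (mX s) (fX s)) (has_law_Wlaw (mX s') (fX s'))) _.
  rewrite le_eqVlt; apply/orP; left; apply/eqP.
  under [X in pnorm _ _ X]eq_fun do rewrite dX.
  by rewrite (proj2 (finite_pmomentZ _ p0 fz)) normr_id.
Qed.

End metric.

(** * Integrals along paths *)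

(** Confining only [x] to [K] allows the extension to functions on the whole space that vanish
    outside [K]. Compactness enters as a near-covering: a [del] that works locally around each point
    of [K] works on all of [K]. *)
Lemma compact_unif_continuous {R : realType} (V : normedModType R) (K : set V) (f : V -> R) (e : R) :
  compact K -> continuous f -> 0 < e ->
  exists2 del, 0 < del & forall x y, K x -> `|x - y| < del -> `|f x - f y| < e.
Proof.
move=> /compact_near_coveringP cK cf e0.
pose P (del : R) (x : V) := forall y, `|x - y| < del -> `|f x - f y| < e.
have H : (forall x, K x -> \forall x' \near x & i \near 0^'+, P i x').
  move=> x Kx; have /cvgrPdist_lt/(_ (e / 2)) := cf x.
  rewrite divr_gt0// => /(_ isT)/nbhs_normP[r /= r0 rP].
  near=> x' i => y xy.
  have h1 : `|x - x'| < r / 2.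
    near: x'; apply/nbhs_normP; exists (r / 2) => //=; exact: divr_gt0.
  have h2 : i < r / 2 by near: i; apply: nbhs_right_lt; rewrite divr_gt0.
  have h3 : `|x - y| < r.
    by rewrite (le_lt_trans (ler_distD x' _ _))// [r]splitr ltrD// (lt_trans xy).
  rewrite (le_lt_trans (ler_distD (f x) _ _))// [e]splitr ltrD//.
    by rewrite distrC rP// /ball/= (lt_le_trans h1)// ler_pdivrMr// mulr2n mulrDr mulr1 lerDl ltW.
  by rewrite rP.
have [r /= r0 rP] : \forall del \near 0^'+, K `<=` P del by exact: cK.
exists (r / 2); first by rewrite divr_gt0.
move=> x y Kx; apply: rP => //=; rewrite ?divr_gt0//.
by rewrite sub0r normrN gtr0_norm ?divr_gt0// ltr_pdivrMr// mulr2n mulrDr mulr1 ltrDl.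
Unshelve. all: by end_near. Qed.

Section interval_integrals.
Context {R : realType}.
Local Notation mu := (@lebesgue_measure R).
Implicit Types (f g : R -> R) (a b c : R).

Definition integrable_on a b f := mu.-integrable `[a, b] (EFin \o f).
Definition itg a b f : R := \int[mu]_(s in `[a, b]) f s.

Lemma integrable_onS a b a' b' f : a <= a' -> b' <= b -> integrable_on a b f -> integrable_on a' b' f.
Proof.
move=> aa bb; apply: integrableS => //.
by apply: subset_itv; rewrite bnd_simp.
Qed.

Lemma itg_split b a c f : a <= b -> b <= c -> integrable_on a c f ->
  itg a c f = itg a b f + itg b c f.
Proof.
move=> ab bc fI; rewrite /itg.
have := @Rintegral_itvB R f (BLeft a) (BRight c) b fI.
rewrite !bnd_simp => /(_ ab bc) H.
rewrite -(@Rintegral_itv_obnd_cbnd R b (BRight c) f); last first.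
  apply: integrableS fI => //; apply: subset_itv; rewrite bnd_simp//.
by rewrite -H addrC subrK.
Qed.

Lemma lebesgue_measure_segment a b : a <= b -> mu `[a, b] = (b - a)%:E.
Proof.
move=> ab; have := @lebesgue_measure_itv R `[a, b]; rewrite /= lte_fin => E.
apply: etrans E _.
have [|ba] := ltP a b; first by rewrite -EFinD.
by rewrite (@le_anti _ _ a b) ?ab//= subrr.
Qed.

Lemma lebesgue_measure_segment_lty a b : (mu `[a, b] < +oo)%E.
Proof.
have [ab|ba] := leP a b; first by rewrite lebesgue_measure_segment// ltry.
rewrite (_ : `[a, b]%classic = set0) ?measure0//; apply/seteqP; split => // x /=.
rewrite in_itv/= => /andP[ax xb]; move: ba; rewrite ltNge => /negP; apply.
exact: le_trans xb.
Qed.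

Lemma itg_cst a b (k : R) : a <= b -> itg a b (fun=> k) = k * (b - a).
Proof.
move=> ab; rewrite /itg Rintegral_cst//; congr (_ * _).
exact: (congr1 fine (lebesgue_measure_segment ab)).
Qed.


Lemma integrable_on_cst a b (k : R) : integrable_on a b (fun=> k).
Proof.
apply: measurable_bounded_integrable => //.
- exact: lebesgue_measure_segment_lty.
- exists `|k|; split; first exact: num_real.
  by move=> x kx y _ /=; exact: ltW.
Qed.

Lemma itgD a b f g : integrable_on a b f -> integrable_on a b g ->
  itg a b (fun s => f s + g s) = itg a b f + itg a b g /\ integrable_on a b (fun s => f s + g s).
Proof.
move=> fI gI; split; first exact: RintegralD.
by have := integrableD _ fI gI; exact.
Qed.

Lemma itgB a b f g : integrable_on a b f -> integrable_on a b g ->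
  itg a b (fun s => f s - g s) = itg a b f - itg a b g /\ integrable_on a b (fun s => f s - g s).
Proof.
move=> fI gI; split; first exact: RintegralB.
by have := integrableB _ fI gI; exact.
Qed.

Lemma itgZ a b k f : integrable_on a b f ->
  itg a b (fun s => k * f s) = k * itg a b f /\ integrable_on a b (fun s => k * f s).
Proof.
move=> fI; split; first exact: RintegralZl.
by have := integrableZl _ k fI; exact.
Qed.

Lemma le_itg a b f g : integrable_on a b f -> integrable_on a b g ->
  (forall x, a <= x <= b -> f x <= g x) -> itg a b f <= itg a b g.
Proof.
by move=> fI gI fg; apply: le_Rintegral => // x; rewrite /= in_itv/=; exact: fg.
Qed.

Lemma integrable_on_norm a b f : integrable_on a b f -> integrable_on a b (fun s => `|f s|).
Proof. exact: integrable_norm. Qed.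

Lemma norm_itg a b f : integrable_on a b f -> `|itg a b f| <= itg a b (fun s => `|f s|).
Proof. exact: le_normr_Rintegral. Qed.

Definition subdivision a b (n k : nat) : R := a + k%:R * ((b - a) / n%:R).

Lemma subdivision0 a b n : subdivision a b n 0 = a.
Proof. by rewrite /subdivision mul0r addr0. Qed.

Lemma subdivision_last a b n : (0 < n)%N -> subdivision a b n n = b.
Proof.
by move=> n0; rewrite /subdivision mulrC divfK ?pnatr_eq0 -?lt0n// addrC subrK.
Qed.

Lemma subdivision_le a b n i j : a <= b -> (i <= j)%N -> subdivision a b n i <= subdivision a b n j.
Proof.
by move=> ab ij; rewrite lerD2l ler_wpM2r ?ler_nat// divr_ge0// subr_ge0.
Qed.

Lemma subdivision_step a b n k : subdivision a b n k.+1 - subdivision a b n k = (b - a) / n%:R.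
Proof. by rewrite /subdivision -natr1; ring. Qed.

Lemma itg_subdivision a b n f : a <= b -> (0 < n)%N -> integrable_on a b f ->
  itg a b f = \sum_(k < n) itg (subdivision a b n k) (subdivision a b n k.+1) f.
Proof.
move=> ab n0 fI.
have H k : (k <= n)%N -> itg a (subdivision a b n k) f =
    \sum_(i < k) itg (subdivision a b n i) (subdivision a b n i.+1) f.
  elim: k => [|k IH] kn.
    by rewrite big_ord0 subdivision0 /itg set_itv1 Rintegral_set1.
  rewrite big_ord_recr/= -IH; last exact: ltnW.
  apply: itg_split; last first.
  - apply: integrable_onS fI => //.
    by rewrite -[leRHS](subdivision_last a b n0) subdivision_le.
  - exact: subdivision_le.
  - by rewrite -{1}(subdivision0 a b n) subdivision_le.
by rewrite -H// subdivision_last.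
Qed.

(* Replace [f] by a continuous L1 approximation, which has almost constant sign
   or is small on each piece of a fine subdivision. *)
Lemma sum_norm_itg_subdivision a b f (e : R) : a <= b -> integrable_on a b f -> 0 < e ->
  exists2 n, (0 < n)%N & itg a b (fun s => `|f s|) - e <=
   \sum_(k < n) `|itg (subdivision a b n k) (subdivision a b n k.+1) f|.
Proof.
move=> ab fI e0.
have [g gc [gI ge]] : exists2 g, continuous g & integrable_on a b g /\ itg a b (fun s => `|f s - g s|) < e / 4.
  have [||g_ [gc gI gl]] := @approximation_continuous_integrable R `[a, b] f _ _ fI.
  - exact: measurable_itv.
  - exact: lebesgue_measure_segment_lty.
  have /fine_cvgP[_ gl'] := gl.
  have [N _ /(_ N (leqnn N)) /= HN] : \forall n \near \oo,
      itg a b (fun s => `|f s - g_ n s|) < e / 4.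
    by apply: (cvgr_lt 0) => //; rewrite divr_gt0.
  by exists (g_ N); [exact: gc|split; [exact: gI|exact: HN]].
have b0 : 0 < 4 * (b - a + 1) by rewrite mulr_gt0// ltr_wpDl// subr_ge0.
(* The [L^1] error of [g] enters twice, for less than [e / 2], and the oscillation contributes
   [2 eta (b - a) <= e / 2]. The summand 1 keeps the denominator positive when [a = b]. *)
pose eta := e / (4 * (b - a + 1)).
have eta0 : 0 < eta by rewrite divr_gt0.
have [del del0 gdel] := compact_unif_continuous (@segment_compact R a b) gc eta0.
have ba0 : 0 < b - a + 1 by rewrite ltr_wpDl// subr_ge0.
have [n ndel] : exists n : nat, n.+1%:R^-1 < del / (b - a + 1) by apply/exists_natSinv_lt/divr_gt0.
exists n.+1 => //.
set x := subdivision a b n.+1.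
have xle k : x k <= x k.+1 by exact: subdivision_le.
have xa k : a <= x k by rewrite -{1}(subdivision0 a b n.+1) subdivision_le.
have xb k : (k <= n.+1)%N -> x k <= b.
  by move=> kn; rewrite -[leRHS](subdivision_last a b (ltn0Sn n)) subdivision_le.
have dI : integrable_on a b (fun s => `|f s - g s|).
  exact/integrable_on_norm/(proj2 (itgB fI gI)).
have step k : x k.+1 - x k < del.
  rewrite subdivision_step; apply: (@le_lt_trans _ _ ((b - a + 1) / n.+1%:R)).
    by rewrite ler_wpM2r// lerDl.
  by rewrite mulrC -ltr_pdivlMr.
(* Compare [f] with the constant [g (x k)] on the piece: for a constant, the integral of the
   absolute value is the absolute value of the integral. *)
have key (k : 'I_n.+1) : itg (x k) (x k.+1) (fun s => `|f s|) <=
    `|itg (x k) (x k.+1) f| + 2 * itg (x k) (x k.+1) (fun s => `|f s - g s|) + 2 * eta * (x k.+1 - x k).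
  have xkb : x k.+1 <= b by exact: xb.
  have fIk := integrable_onS (xa k) xkb fI; have gIk := integrable_onS (xa k) xkb gI.
  have dIk := integrable_onS (xa k) xkb dI.
  have [eB IB] := itgB fIk gIk.
  have [eG IG] := itgB gIk (integrable_on_cst (x k) (x k.+1) (g (x k))).
  have [eS IS] := itgD (integrable_on_norm gIk) dIk.
  have h1 := norm_itg IB.
  have gx s : x k <= s <= x k.+1 -> `|g s - g (x k)| <= eta.
    move=> /andP[s1 s2]; rewrite distrC; apply/ltW/gdel.
      by rewrite /= in_itv/= xa (le_trans (xle k)).
    by rewrite distrC ger0_norm ?subr_ge0// (le_lt_trans _ (step k))// lerB.
  have h2 : `|itg (x k) (x k.+1) (fun s => g s - g (x k))| <= eta * (x k.+1 - x k).
    apply: le_trans (norm_itg IG) _; rewrite -itg_cst//.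
    by apply: le_itg gx; [exact: integrable_on_norm|exact: integrable_on_cst].
  have h3 : itg (x k) (x k.+1) (fun s => `|f s|) <= itg (x k) (x k.+1) (fun s => `|g s| + `|f s - g s|).
    apply: le_itg => //; first exact: integrable_on_norm.
    by move=> s _; rewrite -{1}(subrK (g s) (f s)) addrC ler_normD.
  have h4 : itg (x k) (x k.+1) (fun s => `|g s|) <= (`|g (x k)| + eta) * (x k.+1 - x k).
    rewrite -itg_cst//; apply: le_itg; [exact: integrable_on_norm|exact: integrable_on_cst|].
    move=> s /gx H; rewrite -{1}(subrK (g (x k)) (g s)) addrC.
    by rewrite (le_trans (ler_normD _ _))// lerD2l.
  have h5 : `|g (x k)| * (x k.+1 - x k) = `|g (x k) * (x k.+1 - x k)|.
    by rewrite normrM (ger0_norm (_ : 0 <= x k.+1 - x k))// subr_ge0.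
  rewrite itg_cst// in eG.
  have h6 (F G C : R) : `|C| <= `|F| + `|F - G| + `|G - C|.
    have -> : C = F - (F - G) - (G - C) by ring.
    rewrite (le_trans (ler_normB _ _))// (_ : G - (F - (F - G) - (G - C)) = G - C) ?lerD2r; last by ring.
    by rewrite (le_trans (ler_normB _ _))// (_ : F - _ = F - G)//; ring.
  have {}h6 := h6 (itg (x k) (x k.+1) f) (itg (x k) (x k.+1) g) (g (x k) * (x k.+1 - x k)).
  rewrite -eB -eG -h5 in h6.
  move: h1 h2 h3 h4 h6; rewrite eS mulrDl.
  set A := itg _ _ (fun s => `|f s|); set B := itg _ _ (fun s => `|g s|).
  set C := itg _ _ (fun s => `|f s - g s|).
  set D := `|itg _ _ f|; set E := `|itg _ _ (fun s => f s - g s)|; set F := `|itg _ _ (fun s => g s - _)|.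
  set H := `|g _| * _; rewrite -mulrA; set J := eta * _.
  clearbody A B C D E F H J => *; lra.
rewrite (itg_subdivision ab (ltn0Sn n) (integrable_on_norm fI)).
apply: (@le_trans _ _ (\sum_(k < n.+1) (`|itg (x k) (x k.+1) f| +
   2 * itg (x k) (x k.+1) (fun s => `|f s - g s|) + 2 * eta * (x k.+1 - x k)) - e)).
  by rewrite lerB// ler_sum.
rewrite !big_split/= -!mulr_sumr.
rewrite -(itg_subdivision ab (ltn0Sn n) dI).
rewrite -(big_mkord xpredT (fun i => x i.+1 - x i)) telescope_sumr//.
rewrite /x subdivision0 subdivision_last//.
have : 2 * eta * (b - a) <= e / 2.
  rewrite /eta mulrA -mulrA ler_pdivlMr//.
  rewrite (_ : _ * 2 = e * ((b - a) / (b - a + 1))); last by field; rewrite gt_eqF.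
  by rewrite ger_pMr// ler_pdivrMr// mul1r lerDl.
move: ge; set S := \sum_(k < n.+1) _; set Z := itg _ _ _; set K := 2 * eta * _.
clearbody S Z K => *; lra.
Qed.

End interval_integrals.

(** * Speed bounds and the metric derivative *)

#[global] Instance ae_lebesgue_filter (R : realType) :
  Filter (nbhs (almost_everywhere (@lebesgue_measure R))).
Proof. exact: ae_filter_ringOfSetsType. Qed.

Section interval_integrals_ae.
Context {R : realType}.
Local Notation mu := (@lebesgue_measure R).
Implicit Types (f g : R -> R) (a b c : R).

Lemma integrable_on_measurable a b f : integrable_on a b f -> measurable_fun `[a, b] f.
Proof. by move=> /integrableP[/measurable_EFinP]. Qed.

Lemma le_integrable_on a b f g : measurable_fun `[a, b] f -> integrable_on a b g ->
  (forall s, a <= s <= b -> `|f s| <= g s) -> integrable_on a b f.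
Proof.
move=> mf gI fg; apply: le_integrable gI => //; first exact/measurable_EFinP.
move=> s; rewrite /= in_itv/= => sab; rewrite lee_fin.
by rewrite (le_trans (fg s sab))// ler_norm.
Qed.

Lemma itg_cvg a b (f_ : (R -> R)^nat) f g :
  (forall n, measurable_fun `[a, b] (f_ n)) -> measurable_fun `[a, b] f ->
  (forall s, a <= s <= b -> f_ ^~ s @ \oo --> f s) -> integrable_on a b g ->
  (forall n s, a <= s <= b -> `|f_ n s| <= g s) ->
  itg a b (f_ n) @[n --> \oo] --> itg a b f.
Proof.
move=> mf_ mf cf gI fg.
have fI : integrable_on a b f.
  apply: le_integrable_on gI _ => // s sab.
  have := cvg_norm (cf s sab) => /(_ _) H.
  rewrite -(cvg_lim (@Rhausdorff R) H); apply: limr_le; first by apply/cvg_ex; exists `|f s|.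
  by apply: nearW => n; exact: fg.
have M_ n : measurable_fun `[a, b] (EFin \o f_ n) by exact/measurable_EFinP.
have M : measurable_fun `[a, b] (EFin \o f) by exact/measurable_EFinP.
have [] := @dominated_convergence _ _ _ mu `[a, b] (measurable_itv _)
  (fun n s => (f_ n s)%:E) (fun s => (f s)%:E) (fun s => (g s)%:E).
- exact: M_.
- exact: M.
- apply: aeW => s; rewrite /= in_itv/= => sab.
  by apply: cvg_EFin; [exact: nearW|exact: cf].
- exact: gI.
- by apply: aeW => s n; rewrite /= in_itv/= => sab; rewrite lee_fin; exact: fg.
move=> _ _ H; apply/fine_cvg.
rewrite fineK//; apply: integrable_fin_num => //.
Qed.

Lemma itg_ge0_ae0 a b f : integrable_on a b f -> (forall s, a <= s <= b -> 0 <= f s) ->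
  itg a b f <= 0 -> {ae mu, forall s, s \in `[a, b] -> f s = 0}.
Proof.
move=> fI f0 f1.
have E : (\int[mu]_(s in `[a, b]) `|(f s)%:E| = 0)%E.
  rewrite (_ : (\int[mu]_(s in _) _)%E = (\int[mu]_(s in `[a, b]) (f s)%:E)%E); last first.
    apply: eq_integral => s; rewrite inE/= in_itv/= => sab.
    by rewrite ger0_norm ?f0.
  have I0 : (0 <= \int[mu]_(s in `[a, b]) (f s)%:E)%E.
    by apply: integral_ge0 => s; rewrite /= in_itv/= => sab; rewrite lee_fin f0.
  apply/eqP; rewrite eq_le I0 andbT -(@fineK _ (\int[mu]_(s in `[a, b]) (f s)%:E)%E) ?lee_fin//.
  exact: integrable_fin_num.
have := (@ae_eq_integral_abs _ _ _ mu `[a, b] (measurable_itv _) (EFin \o f)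
   (measurable_int _ fI)).1 E.
by apply: filterS => s H sab; have /(_ sab) := H => -[].
Qed.

(** Apply [sum_norm_itg_subdivision] to [g - f]: its integral over each piece is nonnegative, so the
    sum of absolute values is just the integral. Hence [|g - f|] has an integral no larger than
    [g - f], and the two agree almost everywhere. *)
Lemma itg_le_ae a b f g : a <= b -> integrable_on a b f -> integrable_on a b g ->
  (forall s1 s2, a <= s1 -> s1 <= s2 -> s2 <= b -> itg s1 s2 f <= itg s1 s2 g) ->
  {ae mu, forall s, s \in `[a, b] -> f s <= g s}.
Proof.
move=> ab fI gI fg.
have [eB IB] := itgB gI fI.
have nI := integrable_on_norm IB.
have [eN IN] := itgB nI IB.
suff : itg a b (fun s => `|g s - f s| - (g s - f s)) <= 0.
  move=> /(itg_ge0_ae0 IN (fun s _ => ltac:(rewrite subr_ge0; exact: ler_norm))).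
  apply: filterS => s /[apply] /eqP; rewrite subr_eq0 => /eqP H.
  by rewrite -subr_ge0 -H.
rewrite eN subr_le0; apply/ler_addgt0Pr => e e0.
have [n n0] := sum_norm_itg_subdivision ab IB e0.
rewrite lerBlDr => /le_trans; apply; rewrite lerD2r.
rewrite (itg_subdivision ab n0 IB); apply: ler_sum => k _.
have h1 : a <= subdivision a b n k by rewrite -{1}(subdivision0 a b n) subdivision_le.
have h2 : subdivision a b n k <= subdivision a b n k.+1 by rewrite subdivision_le.
have h3 : subdivision a b n k.+1 <= b.
  by rewrite -[leRHS](subdivision_last a b n0) subdivision_le.
rewrite ger0_norm// (proj1 (itgB _ _)) ?subr_ge0 ?fg//; exact: integrable_onS IB || exact: integrable_onS gI || exact: integrable_onS fI.
Qed.

Lemma le_itg_ae a b f g : integrable_on a b f -> integrable_on a b g ->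
  (forall s, a <= s <= b -> 0 <= f s) -> (forall s, a <= s <= b -> 0 <= g s) ->
  {ae mu, forall s, s \in `[a, b] -> f s <= g s} -> itg a b f <= itg a b g.
Proof.
move=> fI gI f0 g0 fg; rewrite /itg /Rintegral fine_le//.
- exact: integrable_fin_num.
- exact: integrable_fin_num.
apply: ae_ge0_le_integral => //.
- exact: measurable_int fI.
- exact: measurable_int gI.
Qed.

End interval_integrals_ae.

Section speed.
Context {R : realType} {d : nat} {p : R}.
Hypothesis p1 : 1 < p.
Local Notation mu := (@lebesgue_measure R).
Implicit Types (sigma : R -> Wspace d p) (h k : R -> R) (t : R).
Let p0 : 0 < p := lt_trans ltr01 p1.

Lemma le_powR_affine (x : R) : `|x| <= 1 + `|x| `^ p.
Proof.
have [x1|x1] := leP `|x| 1; first by rewrite (le_trans x1)// lerDl powR_ge0.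
rewrite (le_trans (le1r_powR (ltW x1) (ltW p1)))// lerDr//.
Qed.

Lemma speed_bound_powR sigma t h : speed_bound sigma t h ->
  integrable_on 0 t (fun s => `|h s| `^ p).
Proof.
move=> [mh hy _]; apply/integrableP; split.
  apply/measurable_EFinP; apply: (measurableT_comp (measurable_powR p)).
  exact: measurableT_comp.
rewrite (_ : (\int[_]_(x in _) _)%E = (\int[mu]_(s in `[0%R, t]) ((`|h s| `^ p)%:E))%E)//.
by apply: eq_integral => s _ /=; rewrite ger0_norm// powR_ge0.
Qed.

Lemma speed_bound_integrable sigma t h : speed_bound sigma t h -> integrable_on 0 t h.
Proof.
move=> sb; have hp := speed_bound_powR sb; have [mh _ _] := sb.
apply: (le_integrable_on mh (proj2 (itgD (integrable_on_cst 0 t 1) hp))) => s _.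
exact: le_powR_affine.
Qed.

Lemma speed_bound_W sigma t h s1 s2 : speed_bound sigma t h -> 0 <= s1 -> s1 <= s2 -> s2 <= t ->
  Wp (sigma s1) (sigma s2) <= itg s1 s2 h.
Proof. by move=> [_ _]; exact. Qed.

Lemma speed_bound_intro sigma t k : measurable_fun `[0, t] k ->
  integrable_on 0 t (fun s => `|k s| `^ p) ->
  (forall s1 s2, 0 <= s1 -> s1 <= s2 -> s2 <= t -> Wp (sigma s1) (sigma s2) <= itg s1 s2 k) ->
  speed_bound sigma t k.
Proof.
move=> mk kI W; split => //.
have /integrableP[_] := kI.
rewrite (_ : (\int[_]_(x in _) _)%E = (\int[mu]_(s in `[0%R, t]) ((`|k s| `^ p)%:E))%E)//.
by apply: eq_integral => s _ /=; rewrite ger0_norm// powR_ge0.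
Qed.

Lemma measurable_normpow_itv (a b : R) h : measurable_fun `[a, b] h ->
  measurable_fun `[a, b] (fun s => `|h s| `^ p).
Proof.
move=> mh; apply: (measurableT_comp (measurable_powR p)).
exact: measurableT_comp.
Qed.

Lemma speed_bound_norm sigma t h : speed_bound sigma t h -> speed_bound sigma t (fun s => `|h s|).
Proof.
move=> sb; have hI := speed_bound_integrable sb; have [mh _ _] := sb.
apply: speed_bound_intro; first exact: measurableT_comp.
  by under eq_fun do rewrite normr_id; exact: speed_bound_powR sb.
move=> s1 s2 a b c; rewrite (le_trans (speed_bound_W sb a b c))//.
have hI' := integrable_onS a c hI.
by apply: le_itg => //; [exact: integrable_on_norm|move=> s _; exact: ler_norm].
Qed.

Lemma Wp_chain sigma (x : nat -> R) n :
  Wp (sigma (x 0%N)) (sigma (x n)) <= \sum_(k < n) Wp (sigma (x k)) (sigma (x k.+1)).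
Proof.
elim: n => [|n IH]; first by rewrite big_ord0 Wp_xx.
rewrite big_ord_recr/= (le_trans (Wp_triangle p1 (sigma (x n)) _ _))//.
by rewrite lerD2r.
Qed.

(** Write [min h k = (h + k - |h - k|) / 2]. On each piece of a subdivision the distance is at most
    the smaller of the two integrals, which has the same form with the absolute value of the
    integral of [h - k]. For a fine subdivision these absolute values nearly add up to the integral
    of [|h - k|], and the pieces are joined by the triangle inequality. *)
Lemma speed_bound_min sigma t h k : speed_bound sigma t h -> speed_bound sigma t k ->
  speed_bound sigma t (fun s => Num.min (h s) (k s)).
Proof.
move=> sh sk; have hI := speed_bound_integrable sh; have kI := speed_bound_integrable sk.
have [mh _ _] := sh; have [mk _ _] := sk.
have mm : measurable_fun `[0, t] (fun s => Num.min (h s) (k s)) by exact: measurable_minr.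
have [_ sI] := itgD (speed_bound_powR sh) (speed_bound_powR sk).
apply: speed_bound_intro => //.
  apply: (le_integrable_on _ sI); first exact: measurable_normpow_itv.
  by move=> s _; rewrite ger0_norm ?powR_ge0// minEle; case: ifP => _; rewrite ?lerDl ?lerDr powR_ge0.
move=> a b a0 ab bt.
have hI' := integrable_onS a0 bt hI; have kI' := integrable_onS a0 bt kI.
have [eB IB] := itgB hI' kI'; have [eD ID] := itgD hI' kI'.
have [eM IM] := itgB ID (integrable_on_norm IB).
have [eZ _] := itgZ (2^-1) IM.
have E : itg a b (fun s => Num.min (h s) (k s)) = 2^-1 * (itg a b h + itg a b k - itg a b (fun s => `|h s - k s|)).
  rewrite -eD -eM -eZ; congr itg; apply/funext => s.
  rewrite minEle; case: ifPn => [hk|]; first by rewrite ler0_norm ?subr_le0//; field.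
  by rewrite -ltNge => hk; rewrite gtr0_norm ?subr_gt0//; field.
rewrite E; apply/ler_addgt0Pr => e e0.
have [n n0 Hn] := sum_norm_itg_subdivision ab IB e0.
have := Wp_chain sigma (subdivision a b n) n.
rewrite subdivision0 subdivision_last// => /le_trans; apply.
apply: (@le_trans _ _ (\sum_(i < n) 2^-1 * (itg (subdivision a b n i) (subdivision a b n i.+1) h +
  itg (subdivision a b n i) (subdivision a b n i.+1) k -
  `|itg (subdivision a b n i) (subdivision a b n i.+1) (fun s => h s - k s)|))).
  apply: ler_sum => i _.
  have h1 : a <= subdivision a b n i by rewrite -{1}(subdivision0 a b n) subdivision_le.
  have h2 : subdivision a b n i <= subdivision a b n i.+1 by rewrite subdivision_le.
  have h3 : subdivision a b n i.+1 <= b.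
    by rewrite -[leRHS](subdivision_last a b n0) subdivision_le.
  have H1 := speed_bound_W sh (le_trans a0 h1) h2 (le_trans h3 bt).
  have H2 := speed_bound_W sk (le_trans a0 h1) h2 (le_trans h3 bt).
  rewrite (proj1 (itgB (integrable_onS h1 h3 hI') (integrable_onS h1 h3 kI'))).
  move: H1 H2; set A := itg _ _ h; set B := itg _ _ k; set W := Wp _ _.
  clearbody A B W; have [H|H] := leP 0 (A - B).
    by rewrite (ger0_norm H); move=> *; lra.
  by rewrite (ltr0_norm H); move=> *; lra.
rewrite -mulr_sumr big_split/= big_split/= sumrN.
rewrite -(itg_subdivision ab n0 hI') -(itg_subdivision ab n0 kI').
move: Hn; set A := itg _ _ h; set B := itg _ _ k; set C := itg _ _ _; set S := \sum_(i < n) _.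
clearbody A B C S => *; lra.
Qed.

(** The integral over every subinterval dominates a distance, hence is nonnegative. *)
Lemma speed_bound_ae_ge0 sigma t h : 0 <= t -> speed_bound sigma t h ->
  {ae mu, forall s, s \in `[0, t] -> 0 <= h s}.
Proof.
move=> t0 sh; apply: (itg_le_ae t0 (integrable_on_cst 0 t 0) (speed_bound_integrable sh)).
move=> s1 s2 a b c; rewrite itg_cst// mul0r.
by rewrite (le_trans (Wp_ge0 p1 _ _) (speed_bound_W sh a b c)).
Qed.

Lemma speed_bound_norm_itg sigma t h : 0 <= t -> speed_bound sigma t h ->
  itg 0 t (fun s => `|h s|) = itg 0 t h.
Proof.
move=> t0 sh; have hI := speed_bound_integrable sh.
have [eB IB] := itgB (integrable_on_norm hI) hI.
apply/le_anti/andP; split; last first.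
  by apply: le_itg => //; [exact: integrable_on_norm|move=> s _; exact: ler_norm].
rewrite -subr_le0 -eB -[leRHS](mul0r (t - 0)) -itg_cst//.
apply: le_itg_ae => //; first exact: integrable_on_cst.
  by move=> s _; rewrite subr_ge0 ler_norm.
by apply: filterS (speed_bound_ae_ge0 t0 sh) => s /[apply] hs; rewrite ger0_norm ?subrr.
Qed.

(* The infimum of a sequence of speed bounds that minimizes the total length. *)
Lemma metric_derivative_exists sigma t : 0 <= t -> ACp t sigma ->
  exists h, is_metric_derivative sigma t h.
Proof.
move=> t0 [h0 sh0].
pose L := [set itg 0 t h | h in speed_bound sigma t].
have L0 : L !=set0 by exists (itg 0 t h0); exists h0.
have Llb : has_lbound L.
  exists 0 => _ [h sh <-].
  by rewrite (le_trans (Wp_ge0 p1 _ _) (speed_bound_W sh (lexx 0) t0 (lexx t))).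
have Linf : has_inf L by split.
have /choice[k kP] : forall n : nat, exists k, speed_bound sigma t k /\ itg 0 t k < inf L + n.+1%:R^-1.
  move=> n; have [|_ [k sk <-] Hk] := @inf_adherent _ L (n.+1%:R^-1) _ Linf; first by rewrite invr_gt0.
  by exists k.
(* Running minima of [|k 0|, ..., |k n|]: they are still speed bounds, and converge pointwise
   because they decrease and stay nonnegative. *)
pose m := fix m n := if n is n'.+1 then (fun s => Num.min (m n' s) `|k n s|) else (fun s => `|k 0%N s|).
have m0 n s : 0 <= m n s by elim: n => [|n IH] //=; rewrite le_min IH normr_ge0.
have msb n : speed_bound sigma t (m n).
  elim: n => [|n IH] /=; first by apply: speed_bound_norm; case: (kP 0%N).
  by apply: speed_bound_min => //; apply: speed_bound_norm; case: (kP n.+1).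
have mdec s : nonincreasing_seq (m ^~ s).
  by apply/nonincreasing_seqP => n /=; rewrite ge_min lexx.
have mcvg s : m ^~ s @ \oo --> inf (range (m ^~ s)).
  by apply: nonincreasing_cvgn => //; exists 0 => _ [n _ <-].
pose g s := inf (range (m ^~ s)).
have g0 s : 0 <= g s.
  apply: lb_le_inf; first by exists (m 0%N s), 0%N.
  by move=> _ [n _ <-].
have gm n s : g s <= m n s.
  by apply: ge_inf; [exists 0 => _ [? _ <-]|exists n].
have mm n : measurable_fun `[0, t] (m n) by case: (msb n).
have mg : measurable_fun `[0, t] g by apply: (measurable_fun_cvg mm) => s _; exact: mcvg.
have mI n := speed_bound_integrable (msb n).
have cv (a b : R) : 0 <= a -> b <= t -> itg a b (m n) @[n --> \oo] --> itg a b g.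
  move=> a0 bt; have sub : `[a, b] `<=` `[0, t] by apply: subset_itv; rewrite bnd_simp.
  apply: (@itg_cvg _ a b m g (m 0%N)).
  - by move=> n; apply: measurable_funS (mm n).
  - exact: measurable_funS mg.
  - by move=> s _; exact: mcvg.
  - exact: integrable_onS (mI 0%N).
  - by move=> n s _; rewrite ger0_norm//; apply: mdec.
have sg : speed_bound sigma t g.
  apply: speed_bound_intro => //.
    apply: (le_integrable_on (measurable_normpow_itv mg) (speed_bound_powR (msb 0%N))).
    move=> s _; rewrite ger0_norm ?powR_ge0// !ger0_norm//.
    by apply: le_powR => //; exact: ltW.
  move=> s1 s2 a b c; have C := cv _ _ a c.
  rewrite -(cvg_lim (@Rhausdorff R) C); apply: limr_ge; first by apply/cvg_ex; eexists; exact: C.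
  by apply: nearW => n; exact: speed_bound_W (msb n) a b c.
have gL : itg 0 t g <= inf L.
  apply/ler_addgt0Pr => e e0; have [n ne] := exists_natSinv_lt e0.
  have [sk Hk] := kP n.
  have gk : itg 0 t g <= itg 0 t (fun s => `|k n s|).
    apply: le_itg; [exact: speed_bound_integrable sg|exact/integrable_on_norm/(speed_bound_integrable sk)|].
    move=> s _; apply: le_trans (gm n s) _; case: n {ne sk Hk} => //= n.
    by rewrite ge_min lexx orbT.
  rewrite (speed_bound_norm_itg t0 sk) in gk.
  by apply: ltW; rewrite (le_lt_trans gk)// (lt_trans Hk)// ltrD2l.
exists g; split => // j sj.
(* [min g j] is again a speed bound, so its total is at least [inf L], hence at least that of [g];
   being below [g], it equals [g] almost everywhere. *)
have smin := speed_bound_min sg sj.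
have [eB IB] := itgB (speed_bound_integrable sg) (speed_bound_integrable smin).
have : itg 0 t (fun s => g s - Num.min (g s) (j s)) <= 0.
  rewrite eB subr_le0 (le_trans gL)//; apply: ge_inf => //.
  by exists (fun s => Num.min (g s) (j s)).
move=> /(itg_ge0_ae0 IB) H.
have {}H := H (fun s _ => ltac:(by rewrite subr_ge0 ge_min lexx)).
apply: filterS H => s /[apply] /eqP; rewrite subr_eq0 => /eqP ->.
by rewrite ge_min lexx orbT.
Qed.

Lemma metric_derivativeP sigma t : 0 <= t -> ACp t sigma ->
  is_metric_derivative sigma t (metric_derivative sigma t).
Proof.
move=> t0 /(metric_derivative_exists t0)[h hP].
exact: (@xgetPex _ (fun=> 0) [set h | is_metric_derivative sigma t h] (ex_intro _ h hP)).
Qed.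

End speed.

(** * Action and value function *)

Section Young.
Context {R : realType} (p q : R).
Hypothesis p1 : 1 < p.
Hypothesis pq : p^-1 + q^-1 = 1.

Lemma conjugate_gt1 : 1 < q.
Proof.
have p0 : 0 < p := lt_trans ltr01 p1.
have : 0 < p^-1 < 1 by rewrite invr_gt0 p0 invf_lt1.
move=> /andP[a b].
have qE : q^-1 = 1 - p^-1 by rewrite -pq addrC addKr.
have qi : 0 < q^-1 < 1 by rewrite qE subr_gt0 b ltrBlDr ltrDl a.
move: qi => /andP[q0 q1]; rewrite invr_gt0 in q0.
by rewrite -invf_lt1.
Qed.

Lemma young (l x : R) : 0 <= l -> 0 <= x -> l * x <= p^-1 * x `^ p + q^-1 * l `^ q.
Proof.
move=> l0 x0; have q1 := conjugate_gt1.
have := @conjugate_powR R x l p q x0 l0 (lt_trans ltr01 p1) (lt_trans ltr01 q1) pq.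
by rewrite mulrC (mulrC p^-1) (mulrC q^-1).
Qed.

End Young.

Section paths.
Context {R : realType} {d : nat} {p q : R}.
Hypothesis p1 : 1 < p.
Hypothesis pq : p^-1 + q^-1 = 1.
Local Notation mu := (@lebesgue_measure R).
Implicit Types (sigma : R -> Wspace d p) (h k : R -> R) (t : R) (V G : Wspace d p -> R).
Let p0 : 0 < p := lt_trans ltr01 p1.
Let q1 : 1 < q := conjugate_gt1 p1 pq.
Let q0 : 0 < q := lt_trans ltr01 q1.

Definition Wcontinuous V := forall nu (e : R), 0 < e ->
  exists2 r : R, 0 < r & forall nu', Wp nu nu' < r -> `|V nu - V nu'| < e.

(** The absolute value matters because a speed bound is nonnegative only almost everywhere, while a
    power of a negative base defaults to 1. *)
Definition energy h (a b : R) : R := p^-1 * itg a b (fun s => `|h s| `^ p).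

Lemma energy_ge0 h a b : 0 <= energy h a b.
Proof.
rewrite mulr_ge0 ?invr_ge0 ?(ltW p0)//; apply: Rintegral_ge0 => s _; exact: powR_ge0.
Qed.

Lemma energy_split sigma t h s : speed_bound sigma t h -> 0 <= s -> s <= t ->
  energy h 0 t = energy h 0 s + energy h s t.
Proof.
move=> sh s0 st; rewrite /energy -mulrDr; congr (_ * _).
by apply: itg_split => //; exact: speed_bound_powR sh.
Qed.

Lemma energy_sub sigma t h a b : speed_bound sigma t h -> 0 <= a -> a <= b -> b <= t ->
  energy h a b <= energy h 0 t.
Proof.
move=> sh a0 ab bt.
have hI := speed_bound_powR sh.
rewrite (energy_split sh (le_trans a0 ab) bt).
have E : energy h 0 b = energy h 0 a + energy h a b.
  rewrite /energy -mulrDr; congr (_ * _).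
  by apply: itg_split => //; apply: integrable_onS hI.
by rewrite E -addrA addrCA lerDl addr_ge0// energy_ge0.
Qed.

(** Young's inequality integrated along the path. The slope [l] is free: a large one shows that
    brief pieces cover little distance ([W_small]), a matched one gives Jensen's inequality, and one
    just above the norm of the cotangent vector yields the supersolution property. *)
Lemma W_young sigma t h (l s1 s2 : R) : speed_bound sigma t h -> 0 <= l ->
  0 <= s1 -> s1 <= s2 -> s2 <= t ->
  l * Wp (sigma s1) (sigma s2) <= energy h s1 s2 + (s2 - s1) * (q^-1 * l `^ q).
Proof.
move=> sh l0 a b c.
have hI := integrable_onS a c (speed_bound_integrable p1 sh).
have pI := integrable_onS a c (speed_bound_powR sh).
have nI := integrable_on_norm hI.
have W1 : l * Wp (sigma s1) (sigma s2) <= l * itg s1 s2 (fun s => `|h s|).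
  rewrite ler_wpM2l// (le_trans (speed_bound_W sh a b c))//.
  by apply: le_itg => // s _; exact: ler_norm.
apply: le_trans W1 _.
have [<- lI] := itgZ l nI.
have [eP PI] := itgZ p^-1 pI.
rewrite /energy -eP mulrC -itg_cst//.
have cI := integrable_on_cst s1 s2 (q^-1 * l `^ q).
have [<- DI] := itgD PI cI.
by apply: le_itg => // s _; exact: young.
Qed.

Lemma W_small (E e : R) : 0 < E -> 0 < e -> exists2 del : R, 0 < del &
  forall sigma t h s1 s2, speed_bound sigma t h -> energy h s1 s2 <= E ->
    0 <= s1 -> s1 <= s2 -> s2 <= t -> s2 - s1 <= del -> Wp (sigma s1) (sigma s2) < e.
Proof.
(* With this slope [l e = 2 E], whereas the energy contributes at most [E] and the choice of [del]
   limits the other term to [E / 2]. *)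
move=> E0 e0; pose l := 2 * E / e.
have l0 : 0 < l by rewrite divr_gt0 ?mulr_gt0.
have k0 : 0 < q^-1 * l `^ q by rewrite mulr_gt0 ?invr_gt0 ?powR_gt0.
exists (E / 2 / (q^-1 * l `^ q)); first by rewrite !divr_gt0.
move=> sigma t h s1 s2 sh hE a b c sd.
have := W_young sh (ltW l0) a b c.
rewrite -(ltr_pM2l l0) => H; apply: le_lt_trans H _.
have -> : l * e = 2 * E by rewrite /l divfK ?gt_eqF.
rewrite ler_pdivlMr// in sd; lra.
Qed.

Lemma integrable_on_V sigma t h V : Wcontinuous V -> 0 <= t -> speed_bound sigma t h ->
  integrable_on 0 t (fun s => V (sigma s)).
Proof.
move=> cV t0 sh.
(* Time is clamped to [[0, t]], where the path is controlled; the clamped composition is then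
   continuous on the whole line. *)
pose cl (s : R) := Num.max 0 (Num.min s t).
have cl0 s : 0 <= cl s by rewrite le_max lexx.
have clt s : cl s <= t by rewrite ge_max t0 ge_min lexx orbT.
have cld s s' : s <= s' -> cl s <= cl s' /\ cl s' - cl s <= s' - s.
  move=> ss; rewrite /cl !maxEle !minEle.
  by case: ifP; case: ifP; case: ifP; case: ifP; move=> *; split; lra.
have E0 : 0 < energy h 0 t + 1 by rewrite ltr_wpDl// energy_ge0.
have cont : continuous (fun s => V (sigma (cl s))).
  move=> s; apply/cvgrPdist_lt => e e0.
  have [r r0 rP] := cV (sigma (cl s)) e e0.
  have [del del0 dP] := W_small E0 r0.
  have key s1 s2 : s1 <= s2 -> s2 - s1 < del -> Wp (sigma (cl s1)) (sigma (cl s2)) < r.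
    move=> ss sd; have [c1 c2] := cld _ _ ss.
    apply: (dP _ t h) => //; last by rewrite (le_trans c2)// ltW.
    by rewrite (le_trans (energy_sub sh _ _ _))// lerDl.
  near=> s'; apply: rP.
  have H : `|s - s'| < del by near: s'; exact: cvgr_dist_lt.
  have [ss|ss] := leP s s'.
    by apply: key => //; rewrite distrC ger0_norm ?subr_ge0 in H.
  by rewrite Wp_sym//; apply: key; [exact: ltW|rewrite gtr0_norm ?subr_gt0 in H].
have I : integrable_on 0 t (fun s => V (sigma (cl s))).
  apply: continuous_compact_integrable; first exact: segment_compact.
  exact: continuous_subspaceT.
apply: eq_integrable I => // s; rewrite inE/= in_itv/= => /andP[s0 st].
by rewrite /cl (min_idPl st) (max_idPr s0).
Unshelve. all: by end_near. Qed.

Definition action G V sigma h t : R :=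
  G (sigma 0) + energy h 0 t - itg 0 t (fun s => V (sigma s)).

Lemma action_md G V sigma t (h := metric_derivative sigma t) : Wcontinuous V -> 0 <= t ->
  ACp t sigma ->
  G (sigma 0) + \int[lebesgue_measure]_(s in `[0, t])
     (p^-1 * (metric_derivative sigma t s) `^ p - V (sigma s)) = action G V sigma h t
  /\ speed_bound sigma t h.
Proof.
move=> cV t0 aS; have [sh hmin] := metric_derivativeP p1 t0 aS; rewrite -/h in sh hmin.
split => //.
have VI := integrable_on_V cV t0 sh.
have pI := speed_bound_powR sh.
have [mh _ _] := sh.
(* The value function is defined with [h s] without absolute value. Where [h s < 0] its power is 1,
   whence the dominating function [1 + |h|^p]; since this happens on a null set only, the two
   energies agree. *)
have mI : integrable_on 0 t (fun s => h s `^ p).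
  apply: (le_integrable_on _ (proj2 (itgD (integrable_on_cst 0 t 1) pI))).
    exact: (measurableT_comp (measurable_powR p)).
  move=> s _; rewrite ger0_norm ?powR_ge0//; have [h0|h0] := leP 0 (h s).
    by rewrite ger0_norm// lerDr.
  by rewrite lt0_powR1// lerDl powR_ge0.
have [eZ ZI] := itgZ p^-1 mI.
have [eB BI] := itgB ZI VI.
have ae0 := speed_bound_ae_ge0 p1 t0 sh.
have E : itg 0 t (fun s => h s `^ p) = itg 0 t (fun s => `|h s| `^ p).
  have pw (f : R -> R) s : 0 <= s <= t -> 0 <= f s `^ p by move=> _; exact: powR_ge0.
  apply/le_anti/andP; split; apply: (le_itg_ae _ _ (pw _) (pw _)) => //.
  - by apply: filterS ae0 => s /[apply] hs; rewrite ger0_norm.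
  - by apply: filterS ae0 => s /[apply] hs; rewrite ger0_norm.
by rewrite /action /energy -E -eZ -addrA -eB.
Qed.

(** Through [value_function_le], any speed bound of a path bounds the value from above, so the
    metric derivative itself never has to be computed. *)
Lemma action_le G V sigma t h k : 0 <= t -> is_metric_derivative sigma t h ->
  speed_bound sigma t k -> action G V sigma h t <= action G V sigma k t.
Proof.
move=> t0 [sh hmin] sk; rewrite lerD2r lerD2l; apply: ler_wpM2l.
  by rewrite invr_ge0 (ltW p0).
apply: le_itg_ae; [exact: speed_bound_powR sh|exact: speed_bound_powR sk|..].
- by move=> s _; exact: powR_ge0.
- by move=> s _; exact: powR_ge0.
apply: filterS2 (speed_bound_ae_ge0 p1 t0 sh) (hmin k sk) => s h0 hk st.
apply: le_powR; rewrite ?(ltW p0)// (ger0_norm (h0 st)).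
by rewrite (le_trans (hk st))// ler_norm.
Qed.

Lemma value_function_le G V sigma t k nu : Wcontinuous V -> 0 <= t ->
  same_measure (sigma t) nu -> speed_bound sigma t k ->
  (value_function G V nu t <= (action G V sigma k t)%:E)%E.
Proof.
move=> cV t0 st sk; have aS : ACp t sigma by exists k.
have [E sh] := action_md G cV t0 aS.
apply: ge_ereal_inf; exists (action G V sigma (metric_derivative sigma t) t)%:E.
  by exists sigma => //; rewrite E.
by rewrite lee_fin; apply: action_le => //; exact: metric_derivativeP.
Qed.

Lemma value_function_lt G V t nu (c : R) : Wcontinuous V -> 0 <= t ->
  (value_function G V nu t < c%:E)%E -> exists sigma h,
  [/\ same_measure (sigma t) nu, speed_bound sigma t h & action G V sigma h t < c].
Proof.
move=> cV t0 /ereal_inf_lt[_ [sigma [aS st] <-]].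
have [-> sh] := action_md G cV t0 aS; rewrite lte_fin => H.
by exists sigma, (metric_derivative sigma t).
Qed.

End paths.

(** * Extending paths by segments *)

Section powers.
Context {R : realType} (p q : R).
Hypothesis p1 : 1 < p.
Hypothesis pq : p^-1 + q^-1 = 1.
Let p0 : 0 < p := lt_trans ltr01 p1.
Let q0 : 0 < q := lt_trans ltr01 (conjugate_gt1 p1 pq).

Lemma conjugate_mul : (p - 1) * q = p.
Proof.
have qE : q^-1 = 1 - p^-1 by rewrite -pq addrC addKr.
have pn : p != 0 by rewrite gt_eqF.
have qn : q != 0 by rewrite gt_eqF.
have -> : p - 1 = p * q^-1 by rewrite qE; field.
by rewrite mulfVK.
Qed.

Lemma powR_conjugate (x : R) : (x `^ (p - 1)) `^ q = x `^ p.
Proof. by rewrite -powRrM conjugate_mul. Qed.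

(* Young's inequality at [l = y `^ (p - 1)]. *)
Lemma powR_tangent (x y : R) : 0 <= x -> 0 <= y ->
  y `^ p - x `^ p <= p * y `^ (p - 1) * (y - x).
Proof.
move=> x0 y0.
have := young p1 pq (powR_ge0 y (p - 1)) x0; rewrite powR_conjugate => H.
have qE : q^-1 = 1 - p^-1 by rewrite -pq addrC addKr.
have E : y `^ (p - 1) * y = y `^ p by rewrite mulrC mulr_powRB1.
have H2 : p * (y `^ (p - 1) * x) <= x `^ p + (p - 1) * y `^ p.
  rewrite -(ler_pM2l p0) in H; apply: le_trans H _.
  rewrite qE le_eqVlt; apply/orP; left; apply/eqP; field; by rewrite gt_eqF.
rewrite mulrBr -!mulrA E; lra.
Qed.

Lemma powRD_le (x y : R) : 0 <= x -> 0 <= y -> (x + y) `^ p <= 2 `^ p * (x `^ p + y `^ p).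
Proof.
wlog xy : x y / x <= y.
  move=> H x0 y0; have [xy|/ltW yx] := leP x y; first exact: H.
  by rewrite addrC [X in _ * X]addrC; exact: H.
move=> x0 y0; apply: (@le_trans _ _ ((2 * y) `^ p)).
  by apply: le_powR; [exact: ltW|exact: addr_ge0|lra].
by rewrite powRM// ler_wpM2l ?powR_ge0// lerDr powR_ge0.
Qed.

(* [t * (w / t) `^ p / p] is the cost of covering a distance [w] in time [t]. *)
Lemma segment_cost_pert (del e : R) : 0 < del -> 0 < e -> exists2 r, 0 < r &
  forall r' w c tau, 0 <= r' -> r' <= r -> 0 <= w -> w <= 1 -> 0 <= c -> c <= w + 3 * r' ->
   `|tau - del| <= 2 * r' ->
    0 < tau /\ p^-1 * (tau * (c / tau) `^ p) <= p^-1 * (del * (w / del) `^ p) + e.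
Proof.
move=> del0 e0.
(* [X] bounds the perturbed speed [c / tau], since [c <= 4] and [tau >= del / 2]. [C] is the
   coefficient of [r'] in the bound for [tau (y^p - x^p) + (tau - del) x^p], where [x = w / del] and
   [y = c / tau]. *)
pose X := 8 / del.
pose C := 2 * (1 / del) `^ p + 2 * del * (p * X `^ (p - 1)) * (6 / del + 4 / del / del).
have C0 : 0 < C.
  by rewrite ltr_wpDr// ?mulr_ge0 ?addr_ge0 ?divr_ge0 ?powR_ge0 ?(ltW del0) ?(ltW p0)// mulr_gt0// powR_gt0// divr_gt0.
pose r := Num.min 1 (Num.min (del / 8) (p * e / C)).
have r0 : 0 < r by rewrite !lt_min ltr01 !divr_gt0// mulr_gt0.
exists r => // r' w c tau r'0; rewrite !le_min => /and3P[r1 r2 r3] w0 w1 c0 cw.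
rewrite ler_norml => /andP[t1 t2].
have tau1 : del / 2 <= tau by lra.
have tau2 : tau <= 2 * del by lra.
have tau0 : 0 < tau by lra.
split => //.
have iv0 : 0 < tau^-1 by rewrite invr_gt0.
have iv : tau^-1 <= 2 / del.
  by rewrite -(invf_div del 2) lef_pV2 ?posrE// divr_gt0.
have id0 : 0 < del^-1 by rewrite invr_gt0.
set x := w / del; set y := c / tau.
have x0 : 0 <= x by rewrite divr_ge0// ltW.
have y0 : 0 <= y by rewrite divr_ge0// ltW.
have xd : x <= 1 / del by rewrite ler_pM2r.
have yX : y <= X.
  apply: (@le_trans _ _ (4 * (2 / del))); last by rewrite /X; lra.
  by apply: ler_pM => //; [exact: ltW|lra].
have yx : y - x <= r' * (6 / del + 4 / del / del).
  have h1 : y <= (w + 3 * r') * tau^-1 by rewrite ler_wpM2r// ltW.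
  have h2 : w * tau^-1 - x = w * ((del - tau) * (tau^-1 * del^-1)).
    by rewrite /x; field; rewrite !gt_eqF.
  have h3 : (del - tau) * (tau^-1 * del^-1) <= 2 * r' * (2 / del * del^-1).
    apply: (@le_trans _ _ (2 * r' * (tau^-1 * del^-1))).
      by apply: ler_wpM2r; [rewrite mulr_ge0// ltW|lra].
    by apply: ler_wpM2l; [lra|rewrite ler_wpM2r// ltW].
  have h4 : w * ((del - tau) * (tau^-1 * del^-1)) <= 2 * r' * (2 / del * del^-1).
    have [n|n] := leP 0 ((del - tau) * (tau^-1 * del^-1)).
      by apply: le_trans h3; rewrite ler_piMl.
    apply: (@le_trans _ _ 0); first exact: mulr_ge0_le0 w0 (ltW n).
    by rewrite !mulr_ge0 ?(ltW id0).
  have h5 : 3 * r' * tau^-1 <= 3 * r' * (2 / del) by rewrite ler_wpM2l// mulr_ge0.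
  rewrite mulrDl in h1; move: h1 h2 h4 h5.
  set a := w * tau^-1; set b := 3 * r' * tau^-1; set g := w * (_ * _) => *.
  have -> : r' * (6 / del + 4 / del / del) = 3 * r' * (2 / del) + 2 * r' * (2 / del * del^-1) by ring.
  lra.
have key : y `^ p - x `^ p <= p * X `^ (p - 1) * (r' * (6 / del + 4 / del / del)).
  apply: le_trans (powR_tangent x0 y0) _.
  have [n|n] := leP 0 (y - x).
    apply: ler_pM => //; first by rewrite mulr_ge0 ?powR_ge0// ltW.
    by rewrite ler_pM2l//; apply: le_powR => //; rewrite subr_ge0 ltW.
  apply: (@le_trans _ _ 0).
    by rewrite mulr_ge0_le0 ?(ltW n)// mulr_ge0 ?powR_ge0// ltW.
  by rewrite !mulr_ge0 ?powR_ge0 ?addr_ge0 ?mulr_ge0 ?(ltW id0) ?(ltW p0).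
rewrite -(ler_pM2l p0) mulrDr !mulrA !mulfV ?gt_eqF// !mul1r.
have xp : x `^ p <= (1 / del) `^ p by apply: le_powR => //; exact: ltW.
have k1 : tau * (y `^ p - x `^ p) <= 2 * del * (p * X `^ (p - 1) * (r' * (6 / del + 4 / del / del))).
  have [n|n] := leP 0 (y `^ p - x `^ p); first by apply: ler_pM => //; exact: ltW.
  apply: (@le_trans _ _ 0); first by rewrite mulr_ge0_le0 ?(ltW n)// ltW.
  by rewrite !mulr_ge0 ?powR_ge0 ?addr_ge0 ?mulr_ge0 ?(ltW id0) ?(ltW p0) ?(ltW del0).
have k2 : (tau - del) * x `^ p <= 2 * r' * (1 / del) `^ p.
  have [n|n] := leP 0 (tau - del); first by apply: ler_pM => //; exact: powR_ge0.
  apply: (@le_trans _ _ 0); first by rewrite mulr_le0_ge0 ?powR_ge0// ltW.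
  by rewrite !mulr_ge0 ?powR_ge0.
have k3 : r' * C <= p * e by rewrite -ler_pdivlMr.
have k4 : r' * C = 2 * r' * (1 / del) `^ p + 2 * del * (p * X `^ (p - 1) * (r' * (6 / del + 4 / del / del))).
  by rewrite /C; ring.
rewrite k4 in k3; move: k1 k2 k3; set a := y `^ p; set b := x `^ p.
set z := 2 * del * _; set z' := _ * (1 / del) `^ p; clearbody a b z z' => *; lra.
Qed.

End powers.

Section extension.
Context {R : realType} {d : nat} {p q : R}.
Hypothesis p1 : 1 < p.
Hypothesis pq : p^-1 + q^-1 = 1.
Local Notation mu := (@lebesgue_measure R).
Implicit Types (sigma : R -> Wspace d p) (h k : R -> R) (t : R) (V G : Wspace d p -> R).
Local Notation Rd := (borelRd R d).
Let p0 : 0 < p := lt_trans ltr01 p1.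

Lemma eq_itg (a b : R) (f g : R -> R) : (forall s, a <= s <= b -> f s = g s) -> itg a b f = itg a b g.
Proof.
by move=> fg; apply: eq_Rintegral => s; rewrite inE/= in_itv/=; exact: fg.
Qed.

(** The left end is excluded because a spliced function takes its left-hand branch at the
    junction. *)
Lemma eq_itg_oc (a b : R) (f g : R -> R) : integrable_on a b f -> integrable_on a b g ->
  (forall s, a < s <= b -> f s = g s) -> itg a b f = itg a b g.
Proof.
have sub : ([set` Interval (BRight a) (BRight b)] : set R) `<=` `[a, b]%classic.
  by apply: subset_itv; rewrite bnd_simp.
move=> fI gI fg; rewrite /itg.
rewrite -(@Rintegral_itv_obnd_cbnd R a (BRight b) f); last exact: integrableS fI.
rewrite -(@Rintegral_itv_obnd_cbnd R a (BRight b) g); last exact: integrableS gI.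
by apply: eq_Rintegral => s; rewrite inE/= in_itv/=; exact: fg.
Qed.

Lemma measurable_fun_splice (a b c : R) (f g : R -> R) : a <= b -> b <= c ->
  measurable_fun `[a, b] f -> measurable_fun `[b, c] g ->
  measurable_fun `[a, c] (fun s => if s <= b then f s else g s).
Proof.
move=> ab bc mf mg.
rewrite (_ : `[a, c]%classic = `[a, b]%classic `|` `]b, c]%classic :> set R); last first.
  by rewrite -itv_bndbnd_setU// bnd_simp.
apply/measurable_funU => //; split.
- apply: eq_measurable_fun mf => s; rewrite inE/= in_itv/= => /andP[_ ->].
  by [].
- have mg' : measurable_fun `]b, c] g.
    by apply: measurable_funS mg => //; apply: subset_itv; rewrite bnd_simp.
  apply: eq_measurable_fun mg' => s; rewrite inE/= in_itv/= => /andP[bs _].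
  by rewrite leNgt bs.
Qed.

Lemma integrable_on_splice (a b c : R) (f g : R -> R) : a <= b -> b <= c ->
  integrable_on a b f -> integrable_on b c g ->
  integrable_on a c (fun s => if s <= b then f s else g s).
Proof.
move=> ab bc fI gI.
have F := (integrable_mkcond (mu := mu) (EFin \o f) (measurable_itv `[a, b])).1 fI.
have G := (integrable_mkcond (mu := mu) (EFin \o g) (measurable_itv `[b, c])).1 gI.
have nF := integrable_abse F; have nG := integrable_abse G.
have S := @integrableS _ _ _ mu setT `[a, c]%classic _ measurableT (measurable_itv _) (@subsetT _ _)
  (integrableD measurableT nF nG).
apply: le_integrable S => //.
  have M := measurable_fun_splice ab bc (integrable_on_measurable fI) (integrable_on_measurable gI).
  exact/measurable_EFinP.
move=> s; rewrite /= in_itv/= => /andP[as_ sc] /=.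
have [sb|bs] := leP s b.
  rewrite patchE mem_set/= ?in_itv/= ?as_ ?sb//.
  by rewrite gee0_abs ?adde_ge0// leeDl.
rewrite [X in (_ + `|X|)%E]patchE mem_set/= ?in_itv/= ?sc ?(ltW bs)//.
by rewrite gee0_abs ?adde_ge0// leeDr.
Qed.

(** After time [s] the interpolation along [pi] is run at the constant speed [c / tau]. It starts at
    a measure that is only [same_measure] with [sigma s], which [Wp] does not distinguish. *)
Lemma extend_path sigma s h (tau : R) (nu : Wspace d p) (pi : probability (Rd * Rd)%type R)
  (c := pnorm pi p (fun z => enorm ((z.1 : 'rV[R]_d) - z.2))) :
  0 <= s -> 0 < tau -> speed_bound sigma s h -> coupling (sigma s) nu pi ->
  exists sigma' h', [/\ speed_bound sigma' (s + tau) h', same_measure (sigma' (s + tau)) nu,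
    (forall u, u <= s -> sigma' u = sigma u),
    (forall u, s <= u <= s + tau -> Wp (sigma s) (sigma' u) <= c) &
    energy (p := p) h' 0 (s + tau) = energy (p := p) h 0 s + p^-1 * (tau * (c / tau) `^ p)].
Proof.
move=> s0 tau0 sh cpi.
have [gam [g0 g1 gW]] := interpolation p1 cpi; rewrite -/c in gW.
have c0 : 0 <= c by exact: pnorm_ge0.
have st : s <= s + tau by rewrite lerDl ltW.
pose sig u := if u <= s then sigma u else gam ((u - s) / tau).
pose h' u := if u <= s then h u else c / tau.
have hI := speed_bound_integrable p1 sh; have pI := speed_bound_powR sh.
have [mh _ _] := sh.
have mh' : measurable_fun `[0, s + tau] h' by apply: measurable_fun_splice.
have hI' : integrable_on 0 (s + tau) h'.
  by apply: integrable_on_splice => //; exact: integrable_on_cst.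
have pE : (fun u => `|h' u| `^ p) = (fun u => if u <= s then `|h u| `^ p else `|c / tau| `^ p).
  by apply/funext => u; rewrite /h'; case: ifP.
have pI' : integrable_on 0 (s + tau) (fun u => `|h' u| `^ p).
  by rewrite pE; apply: integrable_on_splice => //; exact: integrable_on_cst.
have ct0 : 0 <= c / tau by rewrite divr_ge0// ltW.
have Wg u v : s <= u -> u <= v -> Wp (gam ((u - s) / tau)) (gam ((v - s) / tau)) <= (c / tau) * (v - u).
  move=> su uv; apply: le_trans (gW _ _) _.
  have -> : (u - s) / tau - (v - s) / tau = - ((v - u) / tau) by ring.
  rewrite normrN ger0_norm; last by rewrite mulr_ge0 ?subr_ge0// invr_ge0 ltW.
  by rewrite le_eqVlt; apply/orP; left; apply/eqP; field; rewrite gt_eqF.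
have same0 : same_measure (sigma s) (gam ((s - s) / tau)).
  by rewrite subrr mul0r => A mA; rewrite g0.
have W0 v : s <= v -> Wp (sigma s) (gam ((v - s) / tau)) <= (c / tau) * (v - s).
  by move=> sv; rewrite (Wp_same_l p1 _ same0); exact: Wg.
exists sig, h'; split.
- apply: speed_bound_intro => //.
  move=> a b a0 ab bt; rewrite /sig.
  have iab := integrable_onS a0 bt hI'.
  have [bs|sb] := leP b s.
    rewrite (le_trans ab bs) (le_trans (speed_bound_W sh a0 ab bs))//.
    rewrite le_eqVlt; apply/orP; left; apply/eqP.
    by apply: eq_itg => u /andP[_ ub]; rewrite /h' (le_trans ub bs).
  have icst x y (k : R) := integrable_on_cst x y k.
  have E x : s <= x -> x <= b -> itg x b h' = (c / tau) * (b - x).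
    move=> sx xb; rewrite -itg_cst//; apply: eq_itg_oc => //.
      exact: integrable_onS (le_trans s0 sx) bt hI'.
    by move=> u /andP[xu _]; rewrite /h' leNgt (le_lt_trans sx xu).
  have [as_|sa] := leP a s; last by rewrite [leRHS]E ?(ltW sa)//; apply: Wg => //; exact: ltW.
  apply: le_trans (Wp_triangle p1 (sigma s) _ _) _.
  rewrite [leRHS](itg_split as_ (ltW sb) iab); apply: lerD.
    rewrite (le_trans (speed_bound_W sh a0 as_ (lexx s)))//.
    rewrite le_eqVlt; apply/orP; left; apply/eqP.
    by apply: eq_itg => u /andP[_ ub]; rewrite /h' ub.
  by rewrite E ?(ltW sb)//; apply: W0; exact: ltW.
- rewrite /sig leNgt ltrDl tau0/= addrAC subrr add0r mulfV ?gt_eqF//.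
- by move=> u us; rewrite /sig us.
- move=> u /andP[su ut]; rewrite /sig; case: ifPn => us.
    by rewrite (@le_anti _ _ u s) ?su ?us// Wp_xx.
  apply: le_trans (W0 u su) _.
  rewrite mulrAC ler_pdivrMr// ler_wpM2l// lerBlDl//.
- have [eq1 st0] : itg 0 s (fun u => `|h' u| `^ p) = itg 0 s (fun u => `|h u| `^ p) /\ 0 <= s + tau.
    split; last exact: le_trans st.
    by apply: eq_itg => u /andP[_ us]; rewrite /h' us.
  rewrite /energy (itg_split s0 st pI') eq1 mulrDr; congr (_ + _ * _).
  have -> : tau * (c / tau) `^ p = itg s (s + tau) (fun=> `|c / tau| `^ p).
    by rewrite itg_cst// addrAC subrr add0r (ger0_norm ct0) mulrC.
  apply: eq_itg_oc; [exact: integrable_onS pI'|exact: integrable_on_cst|].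
  by move=> u /andP[su _]; rewrite /h' leNgt su.
Qed.

End extension.

(** * Regularity of the value function *)

Fact near_action_arith (R : realType) (g E x a b y z v : R) :
  g + E / 4 - x <= a -> b <= g - y -> x <= z -> - y <= v -> a < b + 1 -> E <= 4 * (1 + v + z).
Proof. move=> *; lra. Qed.

Section value.
Context {R : realType} {d : nat} {p q : R}.
Hypothesis p1 : 1 < p.
Hypothesis pq : p^-1 + q^-1 = 1.
Variables (G V : Wspace d p -> R) (A L beta : R) (rho : Wspace d p).
Hypothesis A0 : 0 <= A.
Hypothesis L0 : 0 <= L.
Hypothesis GL : forall nu nu', `|G nu - G nu'| <= L * Wp nu nu'.
Hypothesis cV : Wcontinuous V.
Hypothesis VA : forall nu, V nu <= A * (Wp nu rho) `^ p + beta.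
Implicit Types (sigma : R -> Wspace d p) (h k : R -> R) (t : R) (nu : Wspace d p).
Local Notation Rd := (borelRd R d).
Local Notation energy := (energy (p := p)).
Local Notation action := (action G V).
Let p0 : 0 < p := lt_trans ltr01 p1.
Let q1 : 1 < q := conjugate_gt1 p1 pq.
Let q0 : 0 < q := lt_trans ltr01 q1.

(** The summand 1 makes the horizon at most 1, so that [t^(p-1) <= 1] below it. *)
Definition horizon : R := (1 + 2 * p * A * 2 `^ p)^-1.

Lemma horizon_gt0 : 0 < horizon.
Proof. by rewrite invr_gt0 ltr_pwDl// !mulr_ge0 ?powR_ge0// ltW. Qed.

Lemma horizon_le1 : horizon <= 1.
Proof.
rewrite invf_le1 ?lerDl ?mulr_ge0 ?powR_ge0 ?(ltW p0)//.
by rewrite ltr_pwDl// !mulr_ge0 ?powR_ge0// ltW.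
Qed.

Lemma action_split sigma h s t : speed_bound sigma t h -> 0 <= s -> s <= t ->
  action sigma h t = action sigma h s + energy h s t - itg s t (fun u => V (sigma u)).
Proof.
move=> sh s0 st; rewrite /action (energy_split sh s0 st).
rewrite (itg_split s0 st (integrable_on_V p1 pq cV (le_trans s0 st) sh)).
by ring.
Qed.

Lemma speed_bound_restrict sigma h s t : 0 <= s -> s <= t -> speed_bound sigma t h -> speed_bound sigma s h.
Proof.
move=> s0 st sh; have [mh _ W] := sh.
apply: speed_bound_intro.
- by apply: measurable_funS mh => //; apply: subset_itv; rewrite bnd_simp.
- exact: integrable_onS (speed_bound_powR sh).
- by move=> a b a0 ab bs; apply: W => //; exact: le_trans st.
Qed.

(* Young's inequality with [l = (w / (s2 - s1)) `^ (p - 1)] is Jensen's. *)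
Lemma energy_jensen sigma t h s1 s2 : speed_bound sigma t h -> 0 <= s1 -> s1 < s2 -> s2 <= t ->
  p^-1 * ((s2 - s1) * (Wp (sigma s1) (sigma s2) / (s2 - s1)) `^ p) <= energy h s1 s2.
Proof.
move=> sh a b c; set w := Wp _ _; set x := w / (s2 - s1).
have D0 : 0 < s2 - s1 by rewrite subr_gt0.
have x0 : 0 <= x by rewrite divr_ge0 ?Wp_ge0// ltW.
have := W_young p1 pq sh (powR_ge0 x (p - 1)) a (ltW b) c.
rewrite powR_conjugate// -/w.
have -> : x `^ (p - 1) * w = (s2 - s1) * x `^ p.
  by rewrite -(mulr_powRB1 x0 p0) /x; field; rewrite gt_eqF.
have -> : q^-1 = 1 - p^-1 by rewrite -pq addrC addKr.
lra.
Qed.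

Lemma Wp_powR_energy sigma t h s : speed_bound sigma t h -> 0 <= s -> s <= t ->
  Wp (sigma s) (sigma t) `^ p <= p * (t `^ (p - 1) * energy h 0 t).
Proof.
move=> sh s0; rewrite le_eqVlt => /predU1P[->|st].
  rewrite Wp_xx// powR0 ?gt_eqF//; apply: mulr_ge0; first exact: ltW.
  by apply: mulr_ge0; [exact: powR_ge0|exact: energy_ge0].
have D0 : 0 < t - s by rewrite subr_gt0.
have := energy_jensen sh s0 st (lexx t); set w := Wp _ _ => H.
have w0 : 0 <= w by exact: Wp_ge0.
have E : w `^ p = (t - s) `^ (p - 1) * ((t - s) * (w / (t - s)) `^ p).
  rewrite mulrA [_ * (t - s)]mulrC mulr_powRB1 ?(ltW D0)// -powRM ?divr_ge0 ?(ltW D0)//.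
  by rewrite mulrC divfK// gt_eqF.
rewrite -(ler_pM2l p0) mulrA mulfV ?gt_eqF// mul1r in H.
rewrite E [leRHS]mulrCA; apply: ler_pM.
- exact: powR_ge0.
- by rewrite mulr_ge0 ?powR_ge0// ltW.
- by apply: le_powR; rewrite ?subr_ge0 ?(ltW p1) ?(ltW D0)// ?subr_ge0 ?(ltW st)// gerBl.
- apply: le_trans H _; rewrite ler_pM2l//.
  exact: (energy_sub p1 sh s0 (ltW st) (lexx t)).
Qed.

(** The part of the lower bound of the action that does not involve the energy. The first term is
    the price of absorbing the Lipschitz loss of [G] into a quarter of the energy, by [W_young] with
    slope [4 L]; the others come from the growth of [V], measured from the end point of the path. *)
Definition growth nu : R :=
  q^-1 * (4 * L) `^ q + A * 2 `^ p * (Wp nu rho) `^ p + `|beta|.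

Lemma growth_ge0 nu : 0 <= growth nu.
Proof. by rewrite !addr_ge0// !mulr_ge0 ?powR_ge0 ?invr_ge0// ltW. Qed.

Lemma GW nu nu' : G nu' - L * Wp nu nu' <= G nu.
Proof. by have := GL nu nu'; rewrite ler_norml => /andP[]; lra. Qed.

Lemma same_measure_G nu nu' : same_measure nu nu' -> G nu = G nu'.
Proof.
move=> s; have := GL nu nu'; rewrite (same_measure_Wp p1 s) mulr0 normr_le0 subr_eq0.
by move/eqP.
Qed.

(* Small horizons make the possible gain [V] at most half of the kinetic energy. *)
Lemma action_lower sigma h t : 0 <= t -> t < horizon -> speed_bound sigma t h ->
  G (sigma t) + energy h 0 t / 4 - t * growth (sigma t) <= action sigma h t.
Proof.
move=> t0 tT sh.
have t1 : t <= 1 by exact: le_trans (ltW tT) horizon_le1.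
set E := energy h 0 t; set W := Wp (sigma t) rho.
have E0 : 0 <= E by exact: energy_ge0.
have W0 : 0 <= W by exact: Wp_ge0.
have tp0 : 0 <= t `^ (p - 1) by exact: powR_ge0.
(* A bound for [V] along the whole path: the distance to [rho] is split at the end point, and the
   distance to the end point is paid for by the energy. *)
pose c := A * (2 `^ p * (p * (t `^ (p - 1) * E) + W `^ p)) + `|beta|.
have Vc s : 0 <= s <= t -> V (sigma s) <= c.
  move=> /andP[s0 st]; apply: le_trans (VA _) _; apply: lerD; last exact: ler_norm.
  rewrite ler_wpM2l//; apply: (@le_trans _ _ ((Wp (sigma s) (sigma t) + W) `^ p)).
    by apply: le_powR; rewrite ?(ltW p0) ?Wp_ge0//; exact: Wp_triangle.
  apply: le_trans (powRD_le p1 _ W0) _; first exact: Wp_ge0.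
  by rewrite ler_wpM2l ?powR_ge0// lerD2r; exact: Wp_powR_energy.
have I1 : itg 0 t (fun u => V (sigma u)) <= t * c.
  rewrite mulrC -{2}(subr0 t) -itg_cst//; apply: le_itg => //.
    exact: (integrable_on_V p1 pq cV t0 sh).
  exact: integrable_on_cst.
have k1 : t * (t `^ (p - 1)) <= horizon.
  rewrite (le_trans _ (ltW tT))// ler_piMr//.
  have [->|tn] := eqVneq t 0; first by rewrite powR0 ?subr_eq0 ?gt_eqF.
  have : t `^ (p - 1) <= 1 `^ (p - 1) by apply: le_powR => //; rewrite subr_ge0 ltW.
  by rewrite powR1.
have k2 : A * 2 `^ p * p * horizon <= 1 / 2.
  rewrite /horizon ler_pdivrMr; last by rewrite ltr_pwDl// !mulr_ge0 ?powR_ge0// ltW.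
  have -> : 1 / 2 * (1 + 2 * p * A * 2 `^ p) = 1 / 2 + A * 2 `^ p * p by field.
  by rewrite lerDr.
have k3 : t * c <= E / 2 + t * (A * 2 `^ p * W `^ p + `|beta|).
  have -> : t * c = (A * 2 `^ p * p * (t * t `^ (p - 1))) * E + t * (A * 2 `^ p * W `^ p + `|beta|).
    by rewrite /c; ring.
  rewrite lerD2r mulrC ler_wpM2l//.
  apply: le_trans (_ : _ <= A * 2 `^ p * p * horizon) _; last by lra.
  by rewrite ler_wpM2l// !mulr_ge0 ?powR_ge0// ltW.
have k4 : L * Wp (sigma 0) (sigma t) <= E / 4 + t * (q^-1 * (4 * L) `^ q) / 4.
  have := W_young p1 pq sh (_ : 0 <= 4 * L) (lexx 0) t0 (lexx t).
  rewrite mulr_ge0// => /(_ isT); rewrite subr0 -/E; lra.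
have k5 : 0 <= t * (q^-1 * (4 * L) `^ q) by rewrite !mulr_ge0 ?powR_ge0 ?invr_ge0// ltW.
have := GW (sigma 0) (sigma t).
rewrite /action -/E /growth -/W.
have -> : t * (q^-1 * (4 * L) `^ q + A * 2 `^ p * W `^ p + `|beta|) =
  t * (q^-1 * (4 * L) `^ q) + t * (A * 2 `^ p * W `^ p + `|beta|) by ring.
move: I1 k3 k4 k5; set X := t * (q^-1 * _); set Y := t * (_ + `|beta|); set Z := t * c.
set I := itg _ _ _; set w := L * _; clearbody X Y Z I w => *; lra.
Qed.

Lemma constant_speed nu t : speed_bound (fun=> nu) t (fun=> 0).
Proof.
apply: speed_bound_intro.
- exact: measurable_cst.
- exact: integrable_on_cst.
- by move=> a b a0 ab bt; rewrite Wp_xx// itg_cst// mul0r.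
Qed.

Let U := value_function G V.

(** The infimum is tested with the constant path. *)
Lemma value_upper nu t : 0 <= t -> (U nu t <= (G nu - t * V nu)%:E)%E.
Proof.
move=> t0; have := value_function_le p1 pq G cV t0 (fun A mA => erefl) (constant_speed nu t).
rewrite /U /Defs.value_function => /le_trans; apply.
rewrite lee_fin /action /energy !itg_cst//.
by rewrite normr0 powR0 ?gt_eqF// mul0r mulr0 addr0 subr0 mulrC.
Qed.

Lemma value_lower nu t : 0 <= t -> t < horizon -> ((G nu - t * growth nu)%:E <= U nu t)%E.
Proof.
move=> t0 tT; rewrite leNgt; apply/negP => /(value_function_lt p1 pq cV t0)[sigma [h [st sh]]].
have := action_lower t0 tT sh.
have -> : growth (sigma t) = growth nu by rewrite /growth (Wp_same_l p1 _ st).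
rewrite (same_measure_G st); have := energy_ge0 p1 h 0 t; lra.
Qed.

Lemma value_fin nu t : 0 <= t -> t < horizon -> U nu t \is a fin_num.
Proof.
move=> t0 tT; rewrite fin_numElt (lt_le_trans _ (value_lower nu t0 tT)) ?ltNyr//.
by rewrite (le_lt_trans (value_upper nu t0)) ?ltry.
Qed.

Let u nu t : R := fine (U nu t).

Lemma value_fineE nu t : 0 <= t -> t < horizon -> U nu t = (u nu t)%:E.
Proof. by move=> t0 tT; rewrite /u fineK// value_fin. Qed.

Lemma value_le_action sigma h nu t : 0 <= t -> t < horizon -> same_measure (sigma t) nu ->
  speed_bound sigma t h -> u nu t <= action sigma h t.
Proof.
move=> t0 tT st sh; rewrite -lee_fin -value_fineE//.
exact: (value_function_le p1 pq G cV t0 st sh).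
Qed.

Lemma value_near_action nu t (e : R) : 0 <= t -> t < horizon -> 0 < e ->
  exists sigma h, [/\ same_measure (sigma t) nu, speed_bound sigma t h &
    action sigma h t < u nu t + e].
Proof.
move=> t0 tT e0; apply: (value_function_lt p1 pq cV t0).
by rewrite -/U value_fineE// lte_fin ltrDl.
Qed.

(** Compares the lower bound of the action, which retains [E / 4], with the upper bound of the value
    given by the constant path. The result is uniform in [t], as needed for end points that vary in
    time. *)
Lemma near_action_energy sigma h nu t : 0 <= t -> t < horizon -> same_measure (sigma t) nu ->
  speed_bound sigma t h -> action sigma h t < u nu t + 1 ->
  energy h 0 t <= 4 * (1 + `|V nu| + growth nu).
Proof.
move=> t0 tT st sh H.
have t1 : t <= 1 by exact: le_trans (ltW tT) horizon_le1.
have h1 := action_lower t0 tT sh.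
have eg : growth (sigma t) = growth nu by rewrite /growth (Wp_same_l p1 _ st).
rewrite eg (same_measure_G st) in h1.
have h2 : u nu t <= G nu - t * V nu.
  by have := value_upper nu t0; rewrite value_fineE// lee_fin.
have h3 : t * growth nu <= growth nu by apply: ler_piMl; [exact: growth_ge0|exact: t1].
have h4 : - (t * V nu) <= `|V nu|.
  apply: le_trans (ler_norm _) _; rewrite normrN normrM (ger0_norm t0).
  by apply: ler_piMl; [exact: normr_ge0|exact: t1].
exact: near_action_arith h1 h2 h3 h4 H.
Qed.

(** One half of dynamic programming, for a given path: the appended segment stays within [c] of
    [sigma s], so a lower bound [m] of [V] on that ball is collected during the time [tau]. *)
Lemma value_extend sigma s h (tau : R) nu (pi : probability (Rd * Rd)%type R) (m : R)
  (c := pnorm pi p (fun z => enorm ((z.1 : 'rV[R]_d) - z.2))) :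
  0 <= s -> 0 < tau -> s + tau < horizon -> speed_bound sigma s h -> coupling (sigma s) nu pi ->
  (forall nu', Wp (sigma s) nu' <= c -> m <= V nu') ->
  u nu (s + tau) <= action sigma h s + p^-1 * (tau * (c / tau) `^ p) - m * tau.
Proof.
move=> s0 tau0 sT sh cpi mV.
have [sig [h' [sh' st' sE sW eE]]] := extend_path p1 s0 tau0 sh cpi.
have st : s <= s + tau by rewrite lerDl ltW.
have S0 : 0 <= s + tau by exact: le_trans st.
apply: le_trans (value_le_action S0 sT st' sh') _.
have VI := integrable_on_V p1 pq cV S0 sh'.
rewrite /action eE (itg_split s0 st VI) sE//.
have -> : itg 0 s (fun u0 => V (sig u0)) = itg 0 s (fun u0 => V (sigma u0)).
  by apply: eq_itg => u0 /andP[_ us]; rewrite sE.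
have : m * tau <= itg s (s + tau) (fun u0 => V (sig u0)).
  have -> : m * tau = itg s (s + tau) (fun=> m) by rewrite itg_cst// addrAC subrr add0r.
  apply: le_itg; [exact: integrable_on_cst|exact: integrable_onS VI|].
  by move=> u0 us; apply: mV; exact: sW.
rewrite -/c; set x := p^-1 * _; set y := itg s _ _; set z := m * tau; set g := G _.
set e1 := energy _ _ _; set y1 := itg 0 s _; clearbody x y z g e1 y1; clear sT => *; lra.
Qed.

Lemma value_limit nu : U nu t @[t --> 0^'+] --> (G nu)%:E.
Proof.
apply: cvg_trans (_ : (u nu t)%:E @[t --> 0^'+] --> _).
  apply: near_eq_cvg; near=> t; rewrite value_fineE//.
  by near: t; exact: nbhs_right_lt horizon_gt0.
apply: cvg_EFin; first by near=> t.
have -> : fine \o (fun t : R => (u nu t)%:E) = u nu by [].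
pose K := growth nu + `|V nu|.
have K0 : 0 <= K by rewrite addr_ge0// growth_ge0.
apply/cvgrPdist_le => e e0; near=> t.
have t0 : 0 <= t by exact: ltW.
have tT : t < horizon by near: t; exact: nbhs_right_lt horizon_gt0.
have tK : t * K <= e.
  apply: (@le_trans _ _ (t * (K + 1))); first by rewrite ler_wpM2l// lerDl.
  rewrite -ler_pdivlMr ?ltr_pwDr//.
  by near: t; apply: nbhs_right_le; rewrite divr_gt0// ltr_pwDr.
have := value_upper nu t0; have := value_lower nu t0 tT; rewrite value_fineE// !lee_fin => a b.
apply: le_trans tK; rewrite /K mulrDr ler_norml.
have c : - (t * V nu) <= t * `|V nu|.
  by rewrite -mulrN ler_wpM2l// -normrN ler_norm.
have c' : 0 <= t * growth nu by rewrite mulr_ge0 ?growth_ge0.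
have c'' : 0 <= t * `|V nu| by rewrite mulr_ge0.
by apply/andP; split; move: a b c c' c''; set x := t * growth nu; set y := t * V nu; set z := t * `|_|;
  set w := u nu t; set g := G nu; clearbody x y z w g; clear tT => *; lra.
Unshelve. all: by end_near. Qed.

Local Opaque Wp pnorm itg Defs.value_function.

(* On the last piece of a near-optimal path, [V] is locally bounded and the
   path can be replaced by a segment ending at a nearby point. *)
Lemma value_modulus nu0 t0 (e : R) : 0 < t0 -> t0 < horizon -> 0 < e ->
  exists2 r, 0 < r & forall nu1 nu2 t1 t2, Wp nu0 nu1 < r -> Wp nu0 nu2 < r ->
    `|t1 - t0| < r -> `|t2 - t0| < r -> u nu1 t1 <= u nu2 t2 + e.
Proof.
move=> t00 t0T e0.
have [rV rV0 rVP] := cV nu0 ltr01.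
pose r0 := Num.min rV 1.
have r00 : 0 < r0 by rewrite lt_min rV0 ltr01.
pose M := `|V nu0| + 1.
have VM nu : Wp nu0 nu < r0 -> `|V nu| <= M.
  rewrite lt_min => /andP[/rVP H _].
  rewrite -[V nu](subrK (V nu0)) addrC (le_trans (ler_normD _ _))// lerD2l distrC.
  exact: ltW.
(* An energy bound common to all near-optimal paths that end within [r0 <= 1] of [nu0]: the bound of
   [near_action_energy], with [|V|] at most [M] and the distance to [rho] enlarged by 1. *)
pose B := 4 * (1 + M + (q^-1 * (4 * L) `^ q + A * 2 `^ p * (Wp nu0 rho + 1) `^ p + `|beta|)).
have B0 : 0 < B.
  rewrite mulr_gt0// ltr_wpDr//; last by rewrite addr_gt0// ltr_wpDl.
  by rewrite !addr_ge0// !mulr_ge0 ?powR_ge0 ?invr_ge0// ltW.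
have r04 : 0 < r0 / 4 by rewrite divr_gt0.
have [d0 d00 d0P] := @W_small R d p q p1 pq B (r0 / 4) B0 r04.
have M0 : 0 < M by rewrite ltr_wpDl.
(* Duration of the final piece to be replaced: the path then moves by less than [r0 / 4], the cut
   comes at a nonnegative time, and [V] changes the action by at most [M del <= e / 32]. The radius
   [r] is chosen afterwards, small with respect to [del]. *)
pose del := Num.min d0 (Num.min (t0 / 4) (e / (32 * M))).
have del0 : 0 < del by rewrite !lt_min d00 !divr_gt0// mulr_gt0.
have e4 : 0 < e / 4 by rewrite divr_gt0.
have [rs rs0 rsP] := segment_cost_pert p1 pq del0 e4.
pose r := Num.min rs (Num.min (r0 / 16) (Num.min (t0 / 8) (Num.min ((horizon - t0) / 2) (e / (32 * M))))).
have r_gt0 : 0 < r.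
  by rewrite !lt_min rs0 !divr_gt0// ?subr_gt0// mulr_gt0.
exists r => // nu1 nu2 t1 t2 W1 W2.
rewrite !ltr_norml => /andP[a1 b1] /andP[a2 b2].
have [r1 r2 r3 r4 r5] : [/\ r <= rs, r <= r0 / 16, r <= t0 / 8, r <= (horizon - t0) / 2 & r <= e / (32 * M)].
  have := lexx r; rewrite {2}/r !le_min => /and5P[]; by split.
have [c1 c2 c3] : [/\ del <= d0, del <= t0 / 4 & del <= e / (32 * M)].
  have := lexx del; rewrite {2}/del !le_min => /and3P[]; by split.
have t2T : t2 < horizon by lra.
have t1T : t1 < horizon by lra.
have t20 : 0 <= t2 by lra.
(* The new segment starts at the cut [s] and ends at [s + tau = t1]; thus [tau] is within [2 r] of
   [del]. *)
pose s := t2 - del; pose tau := t1 - t2 + del.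
have tau_le : tau <= del + 2 * r by rewrite /tau; lra.
have s0 : 0 <= s by rewrite /s; lra.
have st2 : s < t2 by rewrite /s; lra.
have W2r0 : Wp nu0 nu2 < r0 by apply: lt_le_trans W2 _; lra.
have W21 : Wp nu2 nu1 < 2 * r.
  by apply: le_lt_trans (Wp_triangle p1 nu0 _ _) _; rewrite (Wp_sym p1 nu2) mulr_natl mulr2n ltrD.
have r01 : r0 <= 1 by rewrite ge_min lexx orbT.
pose e' := Num.min 1 (e / 4).
have e'0 : 0 < e' by rewrite lt_min ltr01 divr_gt0.
have [sigma [h [st sh H]]] := value_near_action nu2 t20 t2T e'0.
have H1 : action sigma h t2 < u nu2 t2 + 1.
  by apply: lt_le_trans H _; rewrite lerD2l ge_min lexx.
have H2 : action sigma h t2 < u nu2 t2 + e / 4.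
  by apply: lt_le_trans H _; rewrite lerD2l ge_min lexx orbT.
have hB : energy h 0 t2 <= B.
  apply: le_trans (near_action_energy t20 t2T st sh H1) _.
  rewrite ler_pM2l// lerD ?lerD2l ?VM// /growth lerD2r lerD2l ler_wpM2l ?mulr_ge0 ?powR_ge0//.
  apply: le_powR; rewrite ?(ltW p0) ?Wp_ge0//.
  have := Wp_triangle p1 nu0 nu2 rho; rewrite (Wp_sym p1 nu2 nu0); lra.
have hsB s' : s <= s' -> s' <= t2 -> energy h s' t2 <= B.
  move=> ss' s't2; apply: le_trans hB.
  exact: (energy_sub p1 sh (le_trans s0 ss') s't2 (lexx t2)).
have Wsmall s' : s <= s' -> s' <= t2 -> Wp (sigma s') nu2 < r0 / 4.
  move=> ss' s't2; rewrite (Wp_sym p1) -(Wp_same_l p1 _ st) (Wp_sym p1).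
  apply: (d0P sigma t2 h) => //; [exact: hsB|exact: le_trans ss'|].
  by move: ss'; rewrite /s; lra.
have [pi cpi cW] := Wp_adherent p1 (sigma s) nu1 r_gt0.
move: cW; set c := pnorm _ _ _ => cW.
set w := Wp (sigma s) nu2.
have w0 : 0 <= w by exact: Wp_ge0.
have wr : w < r0 / 4 by apply: Wsmall; rewrite // ltW.
have c0 : 0 <= c by exact: pnorm_ge0.
(* [w] from the cut to [nu2], less than [2 r] from there to [nu1], and [r] for the defect of
   optimality of [pi]. *)
have cw : c <= w + 3 * r.
  apply: le_trans (ltW cW) _; have -> : w + 3 * r = w + 2 * r + r by ring.
  by rewrite lerD2r (le_trans (Wp_triangle p1 nu2 _ _))// lerD2l ltW.
have [tau0 cost] : 0 < tau /\ p^-1 * (tau * (c / tau) `^ p) <= p^-1 * (del * (w / del) `^ p) + e / 4.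
  clear H H1 H2 hB cW W1 W2 W2r0 W21; apply: (rsP r); rewrite ?(ltW r_gt0)//; first by lra.
  by rewrite /tau ler_norml; apply/andP; lra.
have stau : s + tau = t1 by rewrite /s /tau; ring.
have near_s nu' : Wp (sigma s) nu' <= c -> - M <= V nu'.
  move=> Wc; suff /VM : Wp nu0 nu' < r0 by rewrite ler_norml => /andP[].
  have := Wp_triangle p1 nu2 nu0 nu'; have := Wp_triangle p1 (sigma s) nu2 nu'.
  clear H H1 H2 hB; rewrite (Wp_sym p1 nu2 (sigma s)) -/w; lra.
have := value_extend s0 tau0 (_ : s + tau < horizon) (speed_bound_restrict s0 (ltW st2) sh) cpi near_s.
rewrite stau => /(_ t1T); rewrite -/c => step.
have split_a := action_split sh s0 (ltW st2).
have jen := energy_jensen sh s0 st2 (lexx t2).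
have ww : Wp (sigma s) (sigma t2) = w by rewrite (Wp_sym p1) (Wp_same_l p1 _ st) (Wp_sym p1).
have td : t2 - s = del by rewrite /s; ring.
rewrite ww td in jen.
have IV : itg s t2 (fun x => V (sigma x)) <= M * del.
  rewrite -td -itg_cst ?(ltW st2)//; apply: le_itg.
  - exact: (integrable_onS s0 (lexx t2) (integrable_on_V p1 pq cV t20 sh)).
  - exact: integrable_on_cst.
  - move=> s' /andP[ss' s't2]; apply: le_trans (ler_norm _) _; apply: VM.
    have := Wsmall s' ss' s't2; have := Wp_triangle p1 nu2 nu0 (sigma s').
    clear split_a jen step H H1 H2 cost hB.
    rewrite (Wp_sym p1 nu2 (sigma s')); lra.
have Md : M * del <= e / 32.
  rewrite mulrC -ler_pdivlMr//; apply: le_trans c3 _.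
  by rewrite le_eqVlt; apply/orP; left; apply/eqP; field; rewrite gt_eqF.
have Mr : M * r <= e / 32.
  rewrite mulrC -ler_pdivlMr//; apply: le_trans r5 _.
  by rewrite le_eqVlt; apply/orP; left; apply/eqP; field; rewrite gt_eqF.
have Mt : M * tau <= M * del + 2 * (M * r).
  have -> : M * del + 2 * (M * r) = M * (del + 2 * r) by ring.
  by rewrite ler_wpM2l ?(ltW M0).
move: step cost jen IV Md Mr Mt H2; rewrite split_a mulNr.
set x1 := p^-1 * (tau * _); set x2 := p^-1 * (del * _); set x3 := energy _ _ _.
set x4 := itg _ _ _; set x5 := M * tau; set x6 := M * del; set x7 := M * r.
set x8 := action _ _ _; set x9 := u _ _; set x10 := u _ _.
clearbody x1 x2 x3 x4 x5 x6 x7 x8 x9 x10; clear -e0 p0 q0 q1 U u p1 pq A0 L0 GL VA cV=> *; lra.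
Qed.

End value.

(** * Neighbourhoods in terms of Wasserstein balls *)

Section neighbourhoods.
Context {R : realType} {d : nat} {p : R}.
Implicit Types (V : Wspace d p -> R) (P : set (Wspace d p * R)).

Lemma nbhs_WspaceP (nu0 : Wspace d p) (P : set (Wspace d p)) :
  nbhs nu0 P <-> exists2 r : R, 0 < r & forall nu, Wp nu0 nu < r -> P nu.
Proof. by split=> -[r r0 rP]; exists r. Qed.

Lemma continuous_Wcontinuous V : continuous V -> Wcontinuous V.
Proof.
move=> cV nu e e0; apply/nbhs_WspaceP.
by apply: (cV nu (ball (V nu) e)); exact: nbhsx_ballx.
Qed.

Lemma nbhs_cylinderP nu0 (t0 : R) P : nbhs (nu0, t0) P <->
  exists2 r : R, 0 < r & forall nu t, Wp nu0 nu < r -> `|t - t0| < r -> P (nu, t).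
Proof.
split=> [[[A B] [/= /nbhs_WspaceP[r r0 rA] [s /= s0 sB]] AB]|[r r0 rP]].
  exists (Num.min r s); first by rewrite lt_min r0.
  move=> nu t; rewrite !lt_min => /andP[Wr _] /andP[_ ts].
  by apply: AB; split; [exact: rA|apply: sB; rewrite /= distrC].
exists (Wball nu0 r, ball t0 r).
  split; first by apply/nbhs_WspaceP; exists r.
  exact: nbhsx_ballx.
by move=> [nu t] [/= Wr]; rewrite /ball/= distrC; exact: rP.
Qed.

End neighbourhoods.

(** * Semidiscrete optimal couplings *)

Section nested_limit.
Context d (T : measurableType d) {R : realType} (lam : probability T R) (M : R).
Implicit Types (g : T -> R) (K : nat -> set (T -> R)).

(** The bounds hold everywhere and not only almost everywhere, so that integrands can be dominated
    pointwise. *)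
Definition box g := measurable_fun setT g /\ forall x, 0 <= g x <= M.

Lemma bounded_integrable g (C : R) : measurable_fun setT g -> (forall x, `|g x| <= C) ->
  lam.-integrable setT (EFin \o g).
Proof.
move=> mg gC; apply: (@le_integrable _ _ _ lam _ measurableT _ (EFin \o cst C)).
- exact/measurable_EFinP.
- by move=> x _ /=; rewrite lee_fin (le_trans (gC x))// ler_norm.
- exact: finite_measure_integrable_cst.
Qed.

Let RintegralP_cst (r : R) : \int[lam]_x r = r.
Proof.
have := Rintegral_cst lam measurableT r.
by have -> : fine (lam setT) = 1 by [rewrite probability_setT]; rewrite mulr1 => ->.
Qed.

Lemma box_diff_integrable g g' : box g -> box g' ->
  lam.-integrable setT (EFin \o (fun x => `|g x - g' x| ^+ 2)).
Proof.
move=> [mg bg] [mg' bg']; apply: (@bounded_integrable _ ((M + M) ^+ 2)).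
  by apply: measurable_funX; apply: measurableT_comp => //; exact: measurable_funB.
move=> x; have /andP[a b] := bg x; have /andP[a' b'] := bg' x.
rewrite normrX normr_id ler_pXn2r ?nnegrE ?normr_ge0//; last by lra.
by rewrite ler_norml; lra.
Qed.

Lemma box_mid g g' : box g -> box g' -> box (fun x => (g x + g' x) / 2).
Proof.
move=> [mg bg] [mg' bg']; split.
  by apply: measurable_funM => //; exact: measurable_funD.
move=> x; have /andP[a b] := bg x; have /andP[a' b'] := bg' x; lra.
Qed.

Let N g : R := \int[lam]_x (g x ^+ 2).

Let NI g : box g -> lam.-integrable setT (EFin \o (fun x => g x ^+ 2)).
Proof.
move=> [mg bg]; apply: (@bounded_integrable _ (M ^+ 2)); first exact: measurable_funX.
move=> x; have /andP[a b] := bg x.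
by rewrite ger0_norm ?sqr_ge0// ler_pXn2r ?nnegrE//; lra.
Qed.

Let midpoint g g' : T -> R := fun x => (g x + g' x) / 2.



Let parallelogram g g' : box g -> box g' ->
  \int[lam]_x (`|g x - g' x| ^+ 2) = 2 * N g + 2 * N g' - 4 * N (midpoint g g').
Proof.
move=> bg bg'; rewrite /N -!RintegralZl ?NI//; last exact: box_mid.
have I1 : lam.-integrable setT (EFin \o (fun x => 2 * g x ^+ 2)).
  by rewrite /comp; under eq_fun do rewrite EFinM; apply: integrableZl => //; exact: NI.
have I2 : lam.-integrable setT (EFin \o (fun x => 2 * g' x ^+ 2)).
  by rewrite /comp; under eq_fun do rewrite EFinM; apply: integrableZl => //; exact: NI.
have I3 : lam.-integrable setT (EFin \o (fun x => 4 * midpoint g g' x ^+ 2)).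
  by rewrite /comp; under eq_fun do rewrite EFinM; apply: integrableZl => //; exact/NI/box_mid.
rewrite -RintegralD// -RintegralB//; last first.
  by rewrite /comp; under eq_fun do rewrite EFinD; exact: integrableD.
by apply: eq_Rintegral => x _; rewrite real_normK ?num_real// /midpoint; field.
Qed.

(* The elements of least L2 norm of a decreasing sequence of convex sets form a
   Cauchy sequence, by the parallelogram identity. *)
Lemma nested_limit K : (forall n g, K n g -> box g) -> (forall n, K n !=set0) ->
  (forall n m, (n <= m)%N -> K m `<=` K n) ->
  (forall n g g', K n g -> K n g' -> K n (fun x => (g x + g' x) / 2)) ->
  exists g (gs : nat -> T -> R), [/\ box g, forall n, K n (gs n) &
    {ae lam, forall x, gs ^~ x @ \oo --> g x}].
Proof.
move=> Kbox K0 Kmono Kmid.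
(* [S] gathers the lower bounds of the squared norm on some [K n]; its supremum [m] is the limit of
   the nondecreasing infima over the sets [K n]. *)
pose S := [set r | exists n, forall g, K n g -> r <= N g].
have Nub n g : K n g -> N g <= M ^+ 2.
  move=> /Kbox bg; have [mg bM] := bg.
  rewrite -[M ^+ 2]RintegralP_cst; apply: le_Rintegral => //; [exact: NI|exact: finite_measure_integrable_cst|].
  by move=> x _; have /andP[a b] := bM x; rewrite ler_pXn2r ?nnegrE//; exact: le_trans b.
have supS : has_sup S.
  split; first by exists 0, 0%N => g _; apply: Rintegral_ge0 => x _; exact: sqr_ge0.
  exists (M ^+ 2) => r [n rn]; have [g Kg] := K0 n.
  exact: le_trans (rn _ Kg) (Nub _ _ Kg).
pose m := sup S.
have low (e : R) : 0 < e -> exists n, forall g, K n g -> m - e <= N g.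
  move=> e0; have [r [n rn] mr] := sup_adherent e0 supS.
  by exists n => g /rn; apply: le_trans; exact: ltW.
have up n (e : R) : 0 < e -> exists g, K n g /\ N g < m + e.
  move=> e0; apply: contrapT => H.
  have : m + e <= m.
    apply: sup_upper_bound => //; exists n => g Kg.
    by rewrite leNgt; apply/negP => Ng; apply: H; exists g.
  by rewrite gerDl leNgt e0.
(* With near-minimality errors [e k], the parallelogram identity bounds the squared [L^2] norm of a
   successive difference by [8 e k]; its [L^1] norm is then at most [1 / 2^(k+1)], which is
   summable. *)
pose e k : R := (64 * (2 ^ k.+1)%:R ^+ 2)^-1.
have e0 k : 0 < e k by rewrite invr_gt0 mulr_gt0// exprn_gt0// ltr0n expn_gt0.
have [n_ nP] := choice (fun k => low _ (e0 k)).
(* The indices are nondecreasing and at least [n_ k], so that midpoints of consecutive terms stay in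
   [K (n_ k)]; they are at least [k], so that [gs k] lies in [K k]. *)
pose nu k := (\sum_(i < k.+1) n_ i + k)%N.
have nuS k : (nu k <= nu k.+1)%N by rewrite /nu [in leqRHS]big_ord_recr/= -addnA leq_add2l addnS -addSn leq_addl.
have n_nu k : (n_ k <= nu k)%N by rewrite /nu big_ord_recr/= -addnA addnCA leq_addr.
have k_nu k : (k <= nu k)%N by exact: leq_addl.
have [gs gsP] := choice (fun k => up (nu k) _ (e0 k)).
have Kgs k : K (nu k) (gs k) by have [] := gsP k.
have bgs k : box (gs k) by exact: Kbox (Kgs k).
pose D k x := `|gs k.+1 x - gs k x|.
have mD k : measurable_fun setT (D k).
  by apply: measurableT_comp => //; apply: measurable_funB; [have [] := bgs k.+1|have [] := bgs k].
have D2 k : \int[lam]_x (D k x ^+ 2) <= 8 * e k.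
  rewrite parallelogram//.
  have Kmk : K (n_ k) (midpoint (gs k.+1) (gs k)).
    apply: (Kmono _ _ (n_nu k)); apply: Kmid; last exact: Kgs.
    exact: Kmono (nuS k) _ (Kgs k.+1).
  have := nP k _ Kmk; have [_] := gsP k; have [_] := gsP k.+1.
  have : e k.+1 <= e k.
    rewrite /e lef_pV2 ?posrE ?mulr_gt0 ?exprn_gt0 ?ltr0n ?expn_gt0//.
    by rewrite ler_pM2l// ler_pXn2r ?nnegrE// ler_nat leq_pexp2l.
  lra.
have D1 k : (\int[lam]_x (D k x)%:E <= (1 / (2 ^ k.+1)%:R)%:E)%E.
  set c : R := (2 ^ k.+1)%:R; have c0 : 0 < c by rewrite ltr0n expn_gt0.
  have I2 := box_diff_integrable (bgs k.+1) (bgs k).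
  have I : lam.-integrable setT (EFin \o (fun x => 2 * c * D k x ^+ 2 + 1 / (2 * c))).
    rewrite /comp; under eq_fun do rewrite EFinD; apply: integrableD => //.
      by under eq_fun do rewrite EFinM; exact: integrableZl.
    exact: finite_measure_integrable_cst.
  apply: (@le_trans _ _ (\int[lam]_x (2 * c * D k x ^+ 2 + 1 / (2 * c))%:E)%E).
    apply: ge0_le_integral => //.
    - by move=> x _; rewrite lee_fin normr_ge0.
    - exact/measurable_EFinP.
    - exact: measurable_int I.
    (* A weak form of [D <= 2 c D^2 + 1 / (8 c)], which turns the [L^2] bound into an [L^1] bound
       without a square root. *)
    - move=> x _; rewrite lee_fin -subr_ge0.
      have -> : 2 * c * D k x ^+ 2 + 1 / (2 * c) - D k x = 2 * c * (D k x - 1 / (4 * c)) ^+ 2 + 3 / (8 * c).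
        by field; rewrite gt_eqF.
      have cw : 0 <= c by exact: ltW.
      apply: addr_ge0; last by apply: divr_ge0 => //; exact: mulr_ge0.
      by apply: mulr_ge0; [exact: mulr_ge0|exact: sqr_ge0].
  have := integrable_fin_num measurableT I => /fineK <-.
  rewrite lee_fin; change (fine _) with (\int[lam]_x (2 * c * D k x ^+ 2 + 1 / (2 * c))).
  rewrite RintegralD//; last 2 first.
  - by rewrite /comp; under eq_fun do rewrite EFinM; exact: integrableZl.
  - exact: finite_measure_integrable_cst.
  rewrite RintegralZl// RintegralP_cst.
  apply: (@le_trans _ _ (2 * c * (8 * e k) + 1 / (2 * c))).
    by rewrite lerD2r ler_wpM2l ?D2// mulr_ge0// ltW.
  rewrite /e -/c le_eqVlt; apply/orP; right.
  have -> : 1 / c = 2 * c * (8 * (64 * c ^+ 2)^-1) + 1 / (2 * c) + 1 / (4 * c).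
    by field; rewrite gt_eqF.
  by rewrite ltrDl divr_gt0// mulr_gt0.
have DI : (\int[lam]_x (\sum_(k <oo) (D k x)%:E) < +oo)%E.
  rewrite integral_nneseries//; last 2 first.
  - by move=> k; exact/measurable_EFinP.
  - by move=> k x _; rewrite lee_fin normr_ge0.
  apply: (@le_lt_trans _ _ 1%:E); last exact: ltry.
  apply: le_trans (epsilon_trick0 xpredT (@ler01 R)).
  apply: lee_nneseries => k _; last by rewrite D1.
  by move=> _; apply: integral_ge0 => x _; rewrite lee_fin normr_ge0.
pose ls x : R := limn_sup (gs ^~ x).
(* The upper limit is clipped to [[0, M]], so that [g] lies in the box also at the points where [gs]
   does not converge. *)
pose g x := Num.max 0 (Num.min M (ls x)).
have [z _] : [set: T] !=set0.
  apply/set0P/eqP => T0; have := @probability_setT _ _ _ lam.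
  by rewrite T0 measure0 => /eqP; rewrite eqe eq_sym oner_eq0.
have M0 : 0 <= M by have [_ /(_ z)/andP[]] := bgs 0%N; exact: le_trans.
exists g, gs; split.
- split.
    apply: measurable_maxr => //; apply: measurable_minr => //.
    apply: measurable_fun_limn_sup => [x _|x _|n].
    + by exists M => _ [n _ <-]; have [_ /(_ x)/andP[]] := bgs n.
    + by exists 0 => _ [n _ <-]; have [_ /(_ x)/andP[]] := bgs n.
    + by have [] := bgs n.
  by move=> x; rewrite le_max lexx/= ge_max M0/= ge_min lexx.
- by move=> n; apply: Kmono (k_nu n) _ (Kgs n).
- have iD : lam.-integrable setT (fun x => \sum_(k <oo) (D k x)%:E)%E.
    apply/integrableP; split.
      apply: ge0_emeasurable_sum => // [k x _ _|k _]; first by rewrite lee_fin normr_ge0.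
      exact/measurable_EFinP.
    under eq_integral => x _.
      rewrite gee0_abs; last by apply: nneseries_ge0 => k _ _; rewrite lee_fin normr_ge0.
      over.
    exact: DI.
  have := integrable_ae measurableT iD; apply: filterS => x /(_ Logic.I) fx.
  have cD : cvgn [normed series (telescope (gs ^~ x))].
    apply: nondecreasing_is_cvgn; first by apply: nondecreasing_series => k _ _; exact: normr_ge0.
    exists (fine (\sum_(k <oo) (D k x)%:E)%E) => _ [n _ <-].
    rewrite -lee_fin fineK// /= -sumEFin.
    by apply: nneseries_lim_ge => k _; rewrite lee_fin normr_ge0.
  have cg : cvgn (gs ^~ x).
    have := normed_cvg cD; rewrite telescopeK => cs.
    have -> : gs ^~ x = [sequence gs n x - gs 0%N x]_n + cst (gs 0%N x).
      by apply/funext => n /=; rewrite /GRing.add/= subrK.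
    by apply: is_cvgD => //; exact: is_cvg_cst.
  have gE : gs ^~ x @ \oo --> ls x.
    by rewrite /ls cvg_limn_supE.
  suff -> : g x = ls x by [].
  have /andP[l0 lM] : 0 <= ls x <= M.
    rewrite /ls cvg_limn_supE//; apply/andP; split.
      by apply: limr_ge => //; near=> n; have [_ /(_ x)/andP[]] := bgs n.
    by apply: limr_le => //; near=> n; have [_ /(_ x)/andP[]] := bgs n.
  by rewrite /g min_r// max_r.
Unshelve. all: by end_near. Qed.

End nested_limit.

(** * Plans as bounded densities *)

Section density.
Context d (T : measurableType d) {R : realType} (lam : probability T R) (M : R).

Lemma box_integrable g : box M g -> lam.-integrable setT (EFin \o g).
Proof.
move=> [mg gM]; apply: (@bounded_integrable _ _ _ _ _ M) => // x.
by have /andP[g0 gl] := gM x; rewrite ger0_norm.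
Qed.

(** The Radon-Nikodym derivative is truncated at [M]. On the set where it exceeds [M], the
    domination of [pi] by [M lam] shows that truncation does not lower the integral, so the two
    functions agree almost everywhere. *)
Lemma bounded_density (pi : probability T R) :
  (forall C, measurable C -> pi C <= M%:E * lam C)%E ->
  exists2 g, box M g & forall f : T -> \bar R, (forall x, 0 <= f x)%E -> measurable_fun setT f ->
    (\int[pi]_x f x = \int[lam]_x (f x * (g x)%:E))%E.
Proof.
move=> piM.
have M0 : 0 <= M.
  have := piM _ measurableT; rewrite !probability_setT mule1 lee_fin; exact: le_trans.
have dom : pi `<< lam.
  move=> A nA B mB BA; apply/eqP; rewrite eq_le measure_ge0 andbT.
  by have := piM B mB; rewrite (nA B mB BA) mule0.
pose f0 := Radon_Nikodym_SigmaFinite.f pi lam.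
have f00 : forall x, (0 <= f0 x)%E := Radon_Nikodym_SigmaFinite.f_ge0 dom.
have f0fin : forall x, f0 x \is a fin_num := Radon_Nikodym_SigmaFinite.f_fin_num dom.
have f0I : lam.-integrable setT f0 := Radon_Nikodym_SigmaFinite.f_integrable dom.
have mf0 := measurable_int _ f0I.
pose g x := Num.min (fine (f0 x)) M.
have mg : measurable_fun setT g.
  by apply: measurable_minr => //; exact: measurableT_comp mf0.
have bg : box M g.
  by split=> // x; rewrite ge_min lexx orbT andbT le_min M0 andbT fine_ge0.
have f0g : ae_eq lam setT f0 (EFin \o g).
  apply: integral_ae_eq => //; first exact/measurable_EFinP.
  move=> E _ mE; pose B := [set x | (M%:E < f0 x)%E].
  have mB : measurable B by rewrite -[B]setTI; exact: emeasurable_fun_o_infty.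
  have mEB : measurable (E `&` B) by exact: measurableI.
  have mEC : measurable (E `\` B) by exact: measurableD.
  have dEB : [disjoint (E `&` B) & (E `\` B)].
    by apply/disj_setPS => x [[_ ?] []].
  apply/eqP; rewrite eq_le; apply/andP; split.
    rewrite -[E](setUIDK E B) !ge0_integral_setU//; last 3 first.
    - by apply: measurable_funTS; exact/measurable_EFinP.
    - by move=> x _; rewrite lee_fin; have /andP[] := bg.2 x.
    - exact: measurable_funTS.
    apply: leeD.
      rewrite -Radon_Nikodym_SigmaFinite.f_integral//.
      apply: le_trans (piM _ mEB) _; rewrite -integral_cst//; apply: ge0_le_integral => //.
      - by apply: measurable_funTS; exact/measurable_EFinP.
      - by move=> x [_ Bx]; rewrite /= lee_fin le_min lexx andbT -lee_fin fineK// ltW.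
    apply: ge0_le_integral => //.
    - exact: measurable_funTS.
    - by apply: measurable_funTS; exact/measurable_EFinP.
    - move=> x [_ /negP]; rewrite -leNgt => Bx.
      by rewrite /= /g min_l -?lee_fin fineK.
  apply: ge0_le_integral => //.
  - by move=> x _; rewrite lee_fin; have /andP[] := bg.2 x.
  - by apply: measurable_funTS; exact/measurable_EFinP.
  - exact: measurable_funTS.
  - by move=> x _; rewrite -(fineK (f0fin x)) lee_fin ge_min lexx.
exists g => // f fge mf.
rewrite -(Radon_Nikodym_SigmaFinite.change_of_variables dom fge measurableT mf).
apply: ge0_ae_eq_integral => //.
- exact: emeasurable_funM.
- by apply: emeasurable_funM => //; exact/measurable_EFinP.
- by move=> x _; rewrite mule_ge0.
- by move=> x _; rewrite mule_ge0// lee_fin; have /andP[] := bg.2 x.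
- by move: f0g; apply: filterS => x /(_ Logic.I) /= <-.
Qed.

Lemma density_probability g : box M g -> (\int[lam]_x (g x)%:E = 1)%E ->
  exists pi : probability T R, forall f : T -> \bar R, (forall x, 0 <= f x)%E ->
    measurable_fun setT f -> (\int[pi]_x f x = \int[lam]_x (f x * (g x)%:E))%E.
Proof.
move=> bg g1.
have g0 x : (0 <= (g x)%:E)%E by rewrite lee_fin; have /andP[] := bg.2 x.
pose m (A : set T) : \bar R := (\int[lam]_(x in A) (g x)%:E)%E.
have m0 : m set0 = 0%E by rewrite /m integral_set0.
have mge A : (0 <= m A)%E by apply: integral_ge0.
have mS : semi_sigma_additive m.
  apply: semi_sigma_additive_nng_induced => //.
  exact: measurable_int (box_integrable bg).
pose mi := isMeasure.Build _ _ _ m m0 mge mS.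
pose mm : {measure set T -> \bar R} := HB.pack m mi.
have mm1 : mm setT = 1%E by [].
pose pi : probability T R := to_probability mm1.
exists pi => f f0 mf.
have dom : pi `<< lam.
  move=> A nA B mB BA; change (m B = 0%E); apply/eqP; rewrite eq_le mge andbT.
  apply: (@le_trans _ _ (\int[lam]_(x in B) (cst M%:E) x)%E).
    apply: ge0_le_integral => //.
    - by apply: measurable_funTS; apply/measurable_EFinP; have [] := bg.
    - by move=> x _; rewrite lee_fin; have /andP[] := bg.2 x.
  by rewrite integral_cst// [X in (_ * X)%E](nA B mB BA) mule0.
rewrite -(Radon_Nikodym_SigmaFinite.change_of_variables dom f0 measurableT mf).
have gI := box_integrable bg.
have f0I := Radon_Nikodym_SigmaFinite.f_integrable dom.
apply: ge0_ae_eq_integral => //.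
- by apply: emeasurable_funM => //; exact: measurable_int f0I.
- by apply: emeasurable_funM => //; exact: measurable_int gI.
- by move=> x _; rewrite mule_ge0// Radon_Nikodym_SigmaFinite.f_ge0.
- by move=> x _; rewrite mule_ge0.
have : ae_eq lam setT (Radon_Nikodym_SigmaFinite.f pi lam) (EFin \o g).
  apply: integral_ae_eq => //; first exact: measurable_int gI.
  by move=> E _ mE; rewrite -Radon_Nikodym_SigmaFinite.f_integral.
by apply: filterS => x /(_ Logic.I) /= ->.
Qed.

End density.

(** * Optimal plans towards finitely supported measures *)

Section semidiscrete.
Context {R : realType} {d : nat} {p : R}.
Hypothesis p1 : 1 < p.
Local Notation Rd := (borelRd R d).
Local Notation plan := (probability (Rd * Rd)%type R).
Implicit Types mu nu : Wspace d p.
Let p0 : 0 < p := lt_trans ltr01 p1.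

Lemma measurable_seq (s : seq 'rV[R]_d) : measurable ([set y | y \in s] : set Rd).
Proof.
elim: s => [|y s IH]; first by rewrite (_ : [set _ | _] = set0)//; apply/seteqP; split.
rewrite (_ : [set _ | _] = [set y] `|` [set y | y \in s]).
  by apply: measurableU => //; exact: measurable_singleton.
apply/seteqP; split => z /=; rewrite in_cons; first by move/orP => [/eqP|]; [left|right].
by move=> [->|->]; rewrite ?eqxx ?orbT.
Qed.

(** Within the row above an atom [y], the set [C] is a product of [Cy] and the point [y]; there [pi]
    is at most [mu Cy], whereas [lam] is [mu Cy] times the mass of [y]. A row whose atom has mass
    zero is [pi]-null, in accordance with [0^-1 = 0]. Summing over the rows gives the constant. *)
Lemma semidiscrete_dominated mu nu (s : seq 'rV[R]_d) (lam : plan) :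
  (nu ([set y | y \in s] : set Rd) = 1)%E ->
  (forall A B, measurable A -> measurable B -> lam (A `*` B) = (mu A * nu B)%E) ->
  forall pi, coupling mu nu pi -> forall C, measurable C ->
    (pi C <= (\sum_(y <- s) (fine (nu ([set y] : set Rd)))^-1)%:E * lam C)%E.
Proof.
move=> nus lamE pi [_ m1 m2] C mC.
have mS := measurable_seq s.
have mrow y : measurable (setT `*` ([set y] : set Rd) : set (Rd * Rd)).
  by apply: measurableX => //; exact: measurable_singleton.
have row y : (pi (C `&` (setT `*` [set y])) <= ((fine (nu ([set y] : set Rd)))^-1)%:E * lam C)%E.
  pose Cy : set Rd := ysection C y.
  have mCy : measurable Cy by exact: measurable_ysection.
  have CyE x : Cy x <-> C (x, y) by rewrite /Cy /ysection/= inE.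
  have CE : C `&` (setT `*` [set y]) = Cy `*` [set y].
    apply/seteqP; split => [[x z] [/= Cxz [_ /= zy]]|[x z] [/= /CyE Cx zy]].
      by split => //=; apply/CyE; rewrite -zy.
    by rewrite zy.
  have mY := measurable_singleton y.
  have fny : nu ([set y] : set Rd) = (fine (nu ([set y] : set Rd)))%:E by rewrite fineK// fin_num_measure.
  have [z|nz] := eqVneq (fine (nu ([set y] : set Rd))) 0.
    rewrite z invr0 mul0e; have -> : 0%E = pi (setT `*` ([set y] : set Rd)) by rewrite m2// fny z.
    by apply: le_measure; rewrite ?inE//; exact: measurableI.
  have ny0 : 0 < fine (nu ([set y] : set Rd)) by rewrite lt_neqAle eq_sym nz fine_ge0.
  apply: (@le_trans _ _ ((fine (nu ([set y] : set Rd)))^-1%:E * lam (Cy `*` [set y]))%E); last first.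
    rewrite lee_pmul2l ?lte_fin ?invr_gt0// -CE.
    by apply: le_measure; rewrite ?inE//; exact: measurableI.
  rewrite lamE// [in leRHS]fny muleCA -EFinM mulVf// mule1 CE -m1//.
  by apply: le_measure; rewrite ?inE//; [exact: measurableX|exact: measurableX|move=> [x z] []].
have rows : (pi (C `&` (setT `*` [set y | y \in s])) <=
    (\sum_(y <- s) (fine (nu ([set y] : set Rd)))^-1)%:E * lam C)%E.
  elim: s {nus mS} => [|y s IH].
    by rewrite big_nil mul0e (_ : _ `*` _ = set0) ?setI0 ?measure0//; apply/seteqP; split => // -[x y] [].
  rewrite big_cons EFinD ge0_muleDl ?lee_fin ?invr_ge0 ?fine_ge0//; last first.
    by apply: sumr_ge0 => z _; rewrite invr_ge0 fine_ge0.
  apply: (@le_trans _ _ (pi (C `&` (setT `*` [set y])) + pi (C `&` (setT `*` [set y | y \in s])))%E); last exact: leeD.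
  have mS := measurable_seq s.
  have msS : measurable (C `&` (setT `*` ([set y | y \in s] : set Rd))) by apply: measurableI => //; exact: measurableX.
  have msy : measurable (C `&` (setT `*` ([set y] : set Rd))) by exact: measurableI.
  apply: le_trans (measureU2 _ msy msS).
  apply: le_measure; rewrite ?inE//.
  - by apply: measurableI => //; apply: measurableX => //; exact: measurable_seq.
  - exact: measurableU.
  - move=> [x z] [Cxz [_ /=]]; rewrite in_cons => /orP[/eqP zy|zs]; [left|right]; by split.
apply: le_trans rows.
have mCS : measurable (C `&` (setT `*` ([set y | y \in s] : set Rd))) by apply: measurableI => //; exact: measurableX.
have mSc : measurable (setT `*` (~` [set y | y \in s]) : set (Rd * Rd)) by apply: measurableX => //; exact: measurableC.
have z0 : pi (setT `*` (~` [set y | y \in s])) = 0%E.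
  by rewrite m2; [rewrite probability_setC// nus subee|exact: measurableC].
rewrite -[leRHS]adde0 -[X in (_ + X)%E]z0; apply: le_trans (measureU2 _ mCS mSc).
apply: le_measure; rewrite ?inE//; first exact: measurableU.
move=> [x z] Cxz; have [zs|zs] := boolP (z \in s); [left|right]; split => //=.
by apply/negP.
Qed.

Section limits.
Context d1 (T : measurableType d1) (lam : probability T R) (M : R) (f : T -> R).
Hypotheses (fI : lam.-integrable setT (EFin \o f)).

Let mf : measurable_fun setT f.
Proof. exact/measurable_EFinP/(measurable_int _ fI). Qed.

Lemma integrableM_box g : box M g -> lam.-integrable setT (EFin \o (fun x => f x * g x)).
Proof.
move=> [mg bg]; apply: (@le_integrable _ _ _ lam _ measurableT _ (fun x => M%:E * (EFin \o f) x)%E).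
- by apply/measurable_EFinP; exact: measurable_funM.
- move=> x _ /=; have /andP[g0 gM] := bg x; rewrite lee_fin !normrM [leRHS]mulrC.
  by rewrite ler_wpM2l// !ger0_norm//; exact: le_trans gM.
- exact: integrableZl.
Qed.

Lemma Rintegral_midpoint g g' : box M g -> box M g' ->
  \int[lam]_x (f x * ((g x + g' x) / 2)) =
  (\int[lam]_x (f x * g x) + \int[lam]_x (f x * g' x)) / 2.
Proof.
move=> bg bg'; have I := integrableM_box bg; have I' := integrableM_box bg'.
rewrite -RintegralD// -RintegralZr//; last by rewrite /comp; under eq_fun do rewrite EFinD; exact: integrableD.
by apply: eq_Rintegral => x _; rewrite mulrA mulrDr.
Qed.

(** Dominated by [M |f|], so that [f] may be the unbounded cost as well as an indicator: both the
    constraints on the marginals and the cost pass to the limit. *)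
Lemma Rintegral_box_cvg g (gs : nat -> T -> R) : box M g -> (forall n, box M (gs n)) ->
  {ae lam, forall x, gs ^~ x @ \oo --> g x} ->
  \int[lam]_x (f x * gs n x) @[n --> \oo] --> \int[lam]_x (f x * g x).
Proof.
move=> bg bgs ae.
have [] := @dominated_convergence _ _ _ lam setT measurableT
  (fun n x => (f x * gs n x)%:E) (fun x => (f x * g x)%:E) (fun x => `|M%:E * (f x)%:E|%E).
- by move=> n; apply/measurable_EFinP; apply: measurable_funM => //; have [] := bgs n.
- by apply/measurable_EFinP; apply: measurable_funM => //; have [] := bg.
- move: ae; apply: filterS => x H _; apply: cvg_EFin; first by near=> n.
  by apply: cvgMl_tmp; exact: H.
- by apply: integrable_abse; exact: integrableZl.
- apply: aeW => x n _ /=; have [_ /(_ x)/andP[g0 gM]] := bgs n; rewrite lee_fin !normrM [leRHS]mulrC.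
  by rewrite ler_wpM2l// !ger0_norm//; exact: le_trans gM.
- move=> _ _; rewrite -(fineK (integrable_fin_num measurableT (integrableM_box bg))).
  by move/fine_cvg.
Unshelve. all: by end_near. Qed.

End limits.

Lemma semidiscrete_optimal mu nu (s : seq 'rV[R]_d) :
  (nu ([set y | y \in s] : set Rd) = 1)%E -> exists pi, optimal_coupling mu nu pi.
Proof.
move=> nus; have [lam clam lamE] := product_plan p1 mu nu.
set M := (\sum_(y <- s) (fine (nu ([set y] : set Rd)))^-1).
have dens := semidiscrete_dominated nus lamE.
pose c (z : Rd * Rd) := enorm ((z.1 : 'rV[R]_d) - z.2).
have c0 z : 0 <= c z by exact: enorm_ge0.
have fc (pi : plan) : coupling mu nu pi -> finite_pmoment pi p c.
  by move=> cpi; apply: has_law_dist; [exact: p1|exact: coupling_fst cpi|exact: coupling_snd cpi].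
pose cp z := `|c z| `^ p.
have icp (pi : plan) : coupling mu nu pi -> pi.-integrable setT (EFin \o cp).
  by move=> /fc /finite_pmoment_integrable.
have icl := icp _ clam.
have mcp : measurable_fun setT cp by apply: measurable_normpow; have [] := fc _ clam.
have ind_int (A : set (Rd * Rd)) : measurable A -> lam.-integrable setT (EFin \o (\1_A : _ -> R)).
  by move=> mA; apply: (@bounded_integrable _ _ _ _ _ 1) => // z; rewrite indicE; case: (_ \in _); rewrite ?normr1 ?normr0.
pose J (f g : Rd * Rd -> R) := \int[lam]_z (f z * g z).
(* Densities of couplings whose cost is within [1/(n+1)] of optimal. All constraints are linear in
   [g], the cost being compared in [p]-th powers, so each [K n] is stable under midpoints. *)
pose K (n : nat) := [set g | [/\ box M g,
  forall A, measurable A -> J (\1_(A `*` setT)) g = fine (mu A),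
  forall A, measurable A -> J (\1_(setT `*` A)) g = fine (nu A) &
  J cp g <= (Wp mu nu + n.+1%:R^-1) `^ p]].
have mXl A : measurable A -> measurable (A `*` setT : set (Rd * Rd)) by move=> mA; exact: measurableX.
have mXr A : measurable A -> measurable (setT `*` A : set (Rd * Rd)) by move=> mA; exact: measurableX.
have [] := @nested_limit _ _ _ lam M K.
- by move=> n g [].
- move=> n; have n0 : 0 < n.+1%:R^-1 :> R by rewrite invr_gt0.
  have [pi cpi piW] := Wp_adherent p1 mu nu n0.
  have [g bg gE] := bounded_density (dens _ cpi).
  have JE (f : Rd * Rd -> R) : (forall z, 0 <= f z) -> measurable_fun setT f -> J f g = fine (\int[pi]_z (f z)%:E)%E.
    by move=> f0 mf; rewrite gE//; exact/measurable_EFinP.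
  have [_ m1 m2] := cpi.
  exists g; split => //.
  + move=> A mA; have mX := mXl _ mA; rewrite JE; last 1 first.
    * exact: measurable_indic.
    * by rewrite integral_indic// setIT; congr fine; exact: m1.
    * by move=> z; rewrite indicE.
  + move=> A mA; have mX := mXr _ mA; rewrite JE; last 1 first.
    * exact: measurable_indic.
    * by rewrite integral_indic// setIT; congr fine; exact: m2.
    * by move=> z; rewrite indicE.
  + rewrite JE//; last by move=> z; exact: powR_ge0.
    change (\int[pi]_z (`|c z| `^ p) <= (Wp mu nu + n.+1%:R^-1) `^ p).
    by rewrite -pnorm_pow//; apply: le_powR; [exact: ltW|exact: pnorm_ge0|exact: ltW].
- move=> n m nm g [bg g1 g2 gc]; split => //; apply: le_trans gc _.
  apply: le_powR; [exact: ltW|by rewrite addr_ge0 ?invr_ge0 ?Wp_ge0|].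
  by rewrite lerD2l lef_pV2 ?posrE// ler_nat.
- move=> n g g' [bg g1 g2 gc] [bg' g1' g2' gc']; split.
  + exact: box_mid.
  + move=> A mA; rewrite /J (@Rintegral_midpoint _ _ lam M)//; last by apply: ind_int; exact: mXl.
    by move: (g1 A mA) (g1' A mA); rewrite /J => -> ->; field.
  + move=> A mA; rewrite /J (@Rintegral_midpoint _ _ lam M)//; last by apply: ind_int; exact: mXr.
    by move: (g2 A mA) (g2' A mA); rewrite /J => -> ->; field.
  + rewrite /J (@Rintegral_midpoint _ _ lam M)// ler_pdivrMr// mulr_natr mulr2n.
    exact: lerD.
- move=> g [gs [bg Kgs ae]].
  have bgs n : box M (gs n) by have [] := Kgs n.
  have g1 A : measurable A -> J (\1_(A `*` setT)) g = fine (mu A).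
    move=> mA; have := Rintegral_box_cvg (ind_int _ (mXl _ mA)) bg bgs ae.
    rewrite (_ : (fun n => _) = cst (fine (mu A))); last by apply/funext => n; have [_ + _ _] := Kgs n; exact.
    by move/(cvg_unique _ (@cvg_cst _ _ _ _ _)) => /(_ (@Rhausdorff R)) /esym.
  have g2 A : measurable A -> J (\1_(setT `*` A)) g = fine (nu A).
    move=> mA; have := Rintegral_box_cvg (ind_int _ (mXr _ mA)) bg bgs ae.
    rewrite (_ : (fun n => _) = cst (fine (nu A))); last by apply/funext => n; have [_ _ + _] := Kgs n; exact.
    by move/(cvg_unique _ (@cvg_cst _ _ _ _ _)) => /(_ (@Rhausdorff R)) /esym.
  have fing : (\int[lam]_z (g z)%:E = 1)%E.
    have := g1 setT measurableT; rewrite setXTT probability_setT /J.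
    under eq_Rintegral => z _ do rewrite indicT mul1r.
    move=> E; rewrite -(fineK (integrable_fin_num measurableT (box_integrable lam bg))).
    by congr EFin; exact: E.
  have [pi piE] := density_probability bg fing.
  have piJ (f : Rd * Rd -> R) : (forall z, 0 <= f z) -> lam.-integrable setT (EFin \o f) ->
      (\int[pi]_z (f z)%:E = (J f g)%:E)%E.
    move=> f0 fI; rewrite piE//; last exact: measurable_int fI.
    by rewrite -(fineK (integrable_fin_num measurableT (integrableM_box fI bg))).
  have pi1 A : measurable A -> pi (A `*` setT) = mu A.
    move=> mA; rewrite -[A `*` setT]setIT -integral_indic//; last exact: mXl.
    by rewrite piJ ?g1 ?fineK ?fin_num_measure//; apply: ind_int; exact: mXl.
  have pi2 A : measurable A -> pi (setT `*` A) = nu A.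
    move=> mA; rewrite -[setT `*` A]setIT -integral_indic//; last exact: mXr.
    by rewrite piJ ?g2 ?fineK ?fin_num_measure//; apply: ind_int; exact: mXr.
  have cpi : coupling mu nu pi.
    apply: coupling_has_law => //; split => // A mA.
    + by rewrite (_ : _ @^-1` _ = A `*` setT) ?pi1//; apply/seteqP; split => [[x y]|[x y] []].
    + by rewrite (_ : _ @^-1` _ = setT `*` A) ?pi2//; apply/seteqP; split => [[x y]|[x y] []].
  (* The limit inherits every one of the nested constraints, since [gs m] satisfies it for all large
     [m]. *)
  have Jn n : J cp g <= (Wp mu nu + n.+1%:R^-1) `^ p.
    have cv := Rintegral_box_cvg icl bg bgs ae.
    rewrite /J -(cvg_lim (@Rhausdorff R) cv); apply: limr_le; first by apply/cvg_ex; exists (J cp g).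
    near=> m; have [_ _ _ H] := Kgs m; apply: le_trans H _.
    apply: le_powR; [exact: ltW|by rewrite addr_ge0 ?invr_ge0 ?Wp_ge0|].
    rewrite lerD2l lef_pV2 ?posrE// ler_nat ltnS.
    by near: m; exists n.
  have piW : pnorm pi p c <= Wp mu nu.
    apply/ler_addgt0Pr => e e0.
    have [n ne] := exists_natSinv_lt e0.
    apply: (@le_trans _ _ (Wp mu nu + n.+1%:R^-1)); last by rewrite lerD2l ltW.
    rewrite leNgt; apply/negP => /(lt_powR p0 _); rewrite addr_ge0 ?invr_ge0 ?Wp_ge0// => /(_ isT).
    apply/negP; rewrite -leNgt pnorm_pow//; apply: le_trans (Jn n).
    have := piJ cp (fun z => powR_ge0 _ _) icl.
    by rewrite /Rintegral /cp => ->.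
  exists pi; split => // pi' cpi'.
  rewrite !(@transport_costE _ _ _ p1 mu nu)// lee_fin.
  apply: le_trans piW _.
  rewrite -lee_fin -(proj1 (Wp_eq p1 mu nu)) -(transport_costE p1 cpi').
  by apply: ereal_inf_lbound; exists pi'.
Unshelve. all: by end_near. Qed.

End semidiscrete.

(** * Test functions *)

Section compact_support.
Context {R : realType} {d : nat}.
Implicit Types (f : 'rV[R]_d -> R) (K : set 'rV[R]_d).

Lemma compact_support_bounded K f : compact K -> continuous f -> (forall x, ~ K x -> f x = 0) ->
  exists2 B, 0 <= B & forall x, `|f x| <= B.
Proof.
move=> cK cf f0; have cfK : {within K, continuous f} by exact: continuous_subspaceT.
have /compact_bounded[M [_ MP]] := continuous_compact cfK cK.
exists (`|M| + 1); first by rewrite addr_ge0.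
move=> x; have [Kx|nKx] := pselect (K x); last by rewrite f0// normr0 addr_ge0.
apply: (MP (`|M| + 1)); last by exists x.
by rewrite (le_lt_trans (ler_norm _))// ltrDl.
Qed.

Lemma compact_support_unif_continuous K f (e : R) : compact K -> continuous f ->
  (forall x, ~ K x -> f x = 0) -> 0 < e ->
  exists2 del, 0 < del & forall x y, `|x - y| < del -> `|f x - f y| < e.
Proof.
move=> cK cf f0 e0; have [del del0 delP] := compact_unif_continuous cK cf e0.
exists del => // x y xy; have [Kx|nKx] := pselect (K x); first exact: delP.
have [Ky|nKy] := pselect (K y); last by rewrite !f0// subrr normr0.
by rewrite distrC; apply: delP => //; rewrite distrC.
Qed.

Lemma delta_mx_neq0 (i : 'I_d) : (delta_mx 0 i : 'rV[R]_d) != 0.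
Proof. by apply/eqP => /rowP/(_ i)/eqP; rewrite !mxE !eqxx oner_eq0. Qed.

Lemma partial_out_support f i x : ~ closure [set x | f x != 0] x -> partial i f x = 0.
Proof.
move=> nx; rewrite /partial (@near_eq_derive _ _ _ f (cst 0)) ?derive_cst// ?delta_mx_neq0//.
have : open_nbhs x (~` closure [set x | f x != 0]).
  by split => //; apply: closed_openC; exact: closed_closure.
move/open_nbhs_nbhs; apply: filterS => y ny /=; apply/eqP; apply: contrapT => /negP fy.
by apply: ny; apply: subset_closure; exact: fy.
Qed.

Lemma partial_increment f i w (t : R) : (forall x, derivable f x (delta_mx 0 i)) ->
  exists2 c, `|c| <= `|t| &
    f (w + t *: delta_mx 0 i) - f w = partial i f (w + c *: delta_mx 0 i) * t.
Proof.
move=> df; pose phi (s : R) := f (w + s *: delta_mx 0 i).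
have dphi (s : R) : is_derive s 1 phi (partial i f (w + s *: delta_mx 0 i)).
  have E : (fun h : R => h^-1 *: ((phi \o shift s) (h *: (1 : R)) - phi s)) =
      (fun h : R => h^-1 *: ((f \o shift (w + s *: delta_mx 0 i)) (h *: delta_mx 0 i) -
                          f (w + s *: delta_mx 0 i))).
    apply/funext => h; rewrite /phi/=; congr (_ *: (f _ - _)).
    by rewrite [h%:A]mulr1 scalerDl addrCA.
  split; first by rewrite /derivable E; exact: df.
  by rewrite /derive E.
have cphi (s : R) : {for s, continuous phi}.
  by apply: differentiable_continuous; apply/derivable1_diffP; case: (dphi s).
have cw a b : {within `[a, b], continuous phi}.
  by apply: continuous_subspaceT => s; exact: cphi.
have f0 : f w = phi 0 by rewrite /phi scale0r addr0.
have [t0|t0] := leP 0 t.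
  have [c ct E] := MVT_segment t0 (fun s _ => dphi s) (@cw 0 t).
  move: ct; rewrite in_itv/= => /andP[c0 ct].
  by exists c; [rewrite !ger0_norm|rewrite f0 -[f _]/(phi t) E subr0].
have [c ct E] := MVT_segment (ltW t0) (fun s _ => dphi s) (@cw t 0).
move: ct; rewrite in_itv/= => /andP[ct c0].
exists c; first by rewrite !ler0_norm ?lerN2// ltW.
by rewrite f0 -[f _]/(phi t) -opprB E sub0r mulrN opprK.
Qed.

(** The coordinates are moved one at a time through the points [w k], and the one-dimensional mean
    value theorem is applied on each edge, so existence of the partial derivatives suffices. *)
Lemma gradient_increment f x y : (forall i z, derivable f z (delta_mx 0 i)) ->
  exists z : 'I_d -> 'rV[R]_d, (forall i, `|z i - x| <= `|y - x|) /\
    f y - f x = \sum_(i < d) partial i f (z i) * (y 0 i - x 0 i).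
Proof.
move=> df; pose w k : 'rV[R]_d := \row_j (if (j < k)%N then y 0 j else x 0 j).
have wS (i : 'I_d) : w i.+1 = w i + (y 0 i - x 0 i) *: delta_mx 0 i.
  apply/rowP => j; rewrite !mxE eqxx/= ltnS leq_eqVlt.
  have [->|ji] := eqVneq j i; first by rewrite ltnn eqxx/= mulr1 addrCA subrr addr0.
  by rewrite -val_eqE/= in ji; rewrite (negbTE ji)/= mulr0 addr0.
have /choice[c cP] (i : 'I_d) : exists c, `|c| <= `|y 0 i - x 0 i| /\
    f (w i + (y 0 i - x 0 i) *: delta_mx 0 i) - f (w i) =
    partial i f (w i + c *: delta_mx 0 i) * (y 0 i - x 0 i).
  by have [c] := partial_increment (w i) (y 0 i - x 0 i) (df i); exists c.
exists (fun i : 'I_d => w i + c i *: delta_mx 0 i); split => [i|].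
  rewrite [leLHS]/Num.norm/= mx_normrE; apply/bigmax_leP; split => [|[k j] _ /=] //.
  rewrite ord1 !mxE eqxx/=; have [->|ji] := eqVneq j i.
    rewrite ltnn mulr1 addrAC subrr add0r; apply: le_trans (proj1 (cP i)) _.
    by have := coord_le_norm (y - x) i; rewrite !mxE.
  rewrite mulr0 addr0; case: ifP => _; last by rewrite subrr normr0.
  by have := coord_le_norm (y - x) j; rewrite !mxE.
have -> : f y - f x = f (w d) - f (w 0%N).
  congr (f _ - f _); apply/rowP => j; rewrite mxE ?ltn_ord//.
rewrite -(telescope_sumr (fun k => f (w k)))// big_mkord.
by apply: eq_bigr => i _; rewrite wS (proj2 (cP i)).
Qed.

End compact_support.

Section test_functions.
Context {R : realType} {d : nat}.
Variable psi : 'rV[R]_d -> R.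
Hypothesis tpsi : test_function psi.
Local Notation K0 := (closure [set x | psi x != 0]).

Lemma test_function_continuous : continuous psi.
Proof. by have [/(_ [::])[]] := tpsi. Qed.

Lemma test_function_partial i : continuous (partial i psi).
Proof. by have [/(_ [:: i])[]] := tpsi. Qed.

Lemma test_function_derivable i x : derivable psi x (delta_mx 0 i).
Proof. by have [/(_ [::])[]] := tpsi. Qed.

Lemma test_function_compact : compact K0.
Proof. by have [] := tpsi. Qed.

Lemma test_function_bounded : exists2 B, 0 <= B & forall x, `|psi x| <= B.
Proof.
apply: (compact_support_bounded test_function_compact test_function_continuous).
move=> x nx; apply/eqP; apply: contrapT => /negP fx.
by apply: nx; apply: subset_closure; exact: fx.
Qed.

Lemma measurable_gradient : measurable_fun setT (gradient psi : borelRd R d -> borelRd R d).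
Proof.
apply: measurable_fun_rV => i.
rewrite (_ : (fun x => _) = partial i psi).
  by apply: continuous_measurable_rV; exact: test_function_partial.
by apply/funext => x; rewrite mxE.
Qed.

(** For [|y - x| < del], uniform continuity of the partial derivatives gives the linear term. Beyond
    [del] the crude bounds [2 B] and [S |y - x|] are absorbed by [K |y - x|^p], because
    [|y - x| / del >= 1]. A remainder of this shape integrates to at most [e c + K c^p], which is
    [e c + o(c)] as [p > 1]. *)
Lemma test_function_taylor (p e : R) : 1 < p -> 0 < e -> exists2 K, 0 <= K &
  forall x y, `|psi y - psi x - edot (gradient psi x) (y - x)| <=
    e * enorm (y - x) + K * enorm (y - x) `^ p.
Proof.
move=> p1 e0; have p0 : 0 < p := lt_trans ltr01 p1.
have out i x : ~ K0 x -> partial i psi x = 0 by exact: partial_out_support.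
have [B B0 BP] := test_function_bounded.
have /choice[G GP] (i : 'I_d) : exists G, forall x, `|partial i psi x| <= G.
  have [G _ H] := compact_support_bounded test_function_compact (@test_function_partial i) (@out i).
  by exists G.
(* One share for each of the [d] coordinates; the summand 1 keeps the divisor positive. *)
pose e' := e / (d%:R + 1).
have d1 : 0 < d%:R + 1 :> R by rewrite ltr_wpDl.
have e'0 : 0 < e' by rewrite divr_gt0.
have [del [del0 delP]] : exists del, 0 < del /\ forall i x y, `|x - y| < del -> `|partial i psi x - partial i psi y| < e'.
  suff /filter_ex[del [d0 H]] : \forall del \near (0 : R)^'+, 0 < del /\
    forall i x y, `|x - y| < del -> `|partial i psi x - partial i psi y| < e' by exists del.
  near=> del; split => //; near: del.
  apply: filter_forall => i.
  have [r r0 rP] := compact_support_unif_continuous test_function_compact (@test_function_partial i) (@out i) e'0.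
  near=> del => x y xy; apply: rP; apply: lt_trans xy _.
  by near: del; exact: nbhs_right_lt.
pose S := \sum_(i < d) `|G i|.
have S0 : 0 <= S by exact: sumr_ge0.
exists (2 * B / del `^ p + S / del `^ (p - 1)).
  by rewrite addr_ge0// divr_ge0 ?mulr_ge0 ?powR_ge0.
move=> x y; set n := enorm (y - x).
have n0 : 0 <= n by exact: enorm_ge0.
have dpos a : 0 < del `^ a by exact: powR_gt0.
have yx i : `|y 0 i - x 0 i| <= n by have := coord_le_enorm (y - x) i; rewrite !mxE.
have gE : edot (gradient psi x) (y - x) = \sum_(i < d) partial i psi x * (y 0 i - x 0 i).
  by apply: eq_bigr => i _; rewrite !mxE.
have [nd|nd] := ltP n del.
  have [z [zx E]] := gradient_increment x y test_function_derivable.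
  rewrite E gE -sumrB; apply: (@le_trans _ _ (e * n)); last first.
    by rewrite lerDl mulr_ge0 ?powR_ge0// addr_ge0// divr_ge0 ?mulr_ge0 ?powR_ge0.
  apply: le_trans (ler_norm_sum _ _ _) _.
  apply: (@le_trans _ _ (\sum_(i < d) e' * n)).
    apply: ler_sum => i _; rewrite -mulrBl normrM; apply: ler_pM => //.
    by apply/ltW/delP; apply: le_lt_trans (zx i) _; exact: le_lt_trans (norm_le_enorm _) nd.
  rewrite sumr_const card_ord -mulr_natl mulrA ler_wpM2r// /e' mulrA ler_pdivrMr// mulrC.
  by rewrite ler_pM2l// lerDl.
have np : 0 < n by exact: lt_le_trans nd.
have g1 : `|edot (gradient psi x) (y - x)| <= S * n.
  rewrite gE; apply: le_trans (ler_norm_sum _ _ _) _; rewrite mulr_suml; apply: ler_sum => i _.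
  by rewrite normrM; apply: ler_pM => //; apply: le_trans (GP i x) _; exact: ler_norm.
have g2 : `|psi y - psi x| <= 2 * B.
  by rewrite (le_trans (ler_normB _ _))// mulr_natl mulr2n lerD.
have h1 : 2 * B <= 2 * B / del `^ p * n `^ p.
  rewrite -mulrA ler_peMr ?mulr_ge0// mulrC ler_pdivlMr// mul1r.
  by apply: le_powR; rewrite // ltW.
have h2 : S * n <= S / del `^ (p - 1) * n `^ p.
  rewrite -mulrA ler_wpM2l// mulrC ler_pdivlMr// -(mulr_powRB1 n0 p0) ler_wpM2l//.
  by apply: le_powR; rewrite ?subr_ge0 // ltW.
have h3 : 0 <= e * n by rewrite mulr_ge0// ltW.
rewrite mulrDl; apply: le_trans (ler_normB _ _) _.
move: g1 g2 h1 h2 h3; set a1 := `|_|; set a2 := `|_|; set a3 := _ / _ * _; set a4 := _ / _ * _.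
set a5 := S * n; set a6 := 2 * B; set a7 := e * n; clearbody a1 a2 a3 a4 a5 a6 a7.
by clear => *; lra.
Unshelve. all: by end_near. Qed.

End test_functions.

(** * Pairings with cotangent vectors *)

Section pairing.
Context {R : realType} {d : nat} {p q : R}.
Hypothesis p1 : 1 < p.
Hypothesis pq : p^-1 + q^-1 = 1.
Local Notation Rd := (borelRd R d).
Implicit Types (mu nu : Wspace d p) (xi eta : 'rV[R]_d -> 'rV[R]_d).
Let p0 : 0 < p := lt_trans ltr01 p1.
Let q1 : 1 < q := conjugate_gt1 p1 pq.
Let q0 : 0 < q := lt_trans ltr01 q1.

Lemma Lqnorm_finite mu xi : measurable_fun setT (xi : Rd -> Rd) -> (Lqnorm q mu xi < +oo)%E ->
  finite_pmoment mu q (fun x : Rd => enorm (xi x)) /\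
  Lqnorm q mu xi = (pnorm mu q (fun x : Rd => enorm (xi x)))%:E.
Proof.
move=> mxi xiy; have F : finite_pmoment mu q (fun x : Rd => enorm (xi x)).
  by apply: finite_pmoment_Lnorm => //; exact: measurable_enorm.
by split=> //; exact: (Lnorm_pnorm F).
Qed.

Lemma edot_hoelder d1 (T : measurableType d1) (P : probability T R) (A Z : T -> Rd) :
  measurable_fun setT A -> measurable_fun setT Z ->
  finite_pmoment P q (fun w => enorm (A w)) -> finite_pmoment P p (fun w => enorm (Z w)) ->
  P.-integrable setT (EFin \o (fun w => edot (A w) (Z w))) /\
  `|\int[P]_w edot (A w) (Z w)| <=
    pnorm P q (fun w => enorm (A w)) * pnorm P p (fun w => enorm (Z w)).
Proof.
move=> mA mZ fA fZ; have qp : q^-1 + p^-1 = 1 by rewrite addrC.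
have [I H] := hoelder_pnorm q0 p0 qp fA fZ.
have le w : `|edot (A w) (Z w)| <= enorm (A w) * enorm (Z w) by exact: norm_edot_le.
have medot : measurable_fun setT (fun w => edot (A w) (Z w)) by exact: measurable_edot.
have I' : P.-integrable setT (EFin \o (fun w => edot (A w) (Z w))).
  apply: le_integrable I => //; first exact/measurable_EFinP.
  by move=> w _ /=; rewrite lee_fin (le_trans (le w))// ler_norm.
split => //; apply: le_trans H.
apply: le_trans (le_normr_Rintegral measurableT I') _.
apply: le_Rintegral => //.
- exact: (integrable_norm I').
- exact: (integrable_norm I).
- by move=> w _; apply: le_trans (le w) _; exact: ler_norm.
Qed.

Lemma pairing_le_pnorm d1 (T : measurableType d1) (P : probability T R) (X Y : T -> Rd) mu nu eta :
  has_law P X mu -> has_law P Y nu -> measurable_fun setT (eta : Rd -> Rd) ->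
  finite_pmoment mu q (fun x : Rd => enorm (eta x)) ->
  P.-integrable setT (EFin \o (fun w => edot (eta (X w)) (Y w - X w))) /\
  `|\int[P]_w edot (eta (X w)) (Y w - X w)| <=
    pnorm mu q (fun x : Rd => enorm (eta x)) * pnorm P p (fun w => enorm (X w - Y w)).
Proof.
move=> lX lY meta feta; have [mX _] := lX; have [mY _] := lY.
have metaX : measurable_fun setT (fun w => eta (X w) : Rd) by exact: (measurableT_comp meta mX).
have [E1 <-] := has_law_pnorm lX q (measurable_enorm meta).
have -> : (fun w => enorm (X w - Y w)) = (fun w => enorm (Y w - X w)).
  by apply/funext => w; rewrite enorm_distC.
apply: edot_hoelder => //; [exact: measurable_rVB|exact: (proj2 E1 feta)|].
exact: (has_law_dist p1 lY lX).
Qed.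

(* To first order, the pairing with a cotangent vector depends on the two
   marginals only. *)
Lemma gradient_pairing mu xi (e : R) : CoTan q mu xi -> 0 < e ->
  exists D : Wspace d p -> R, exists2 K : R, 0 <= K & forall d1 (T : measurableType d1) (P : probability T R) (X Y : T -> Rd) nu,
    has_law P X mu -> has_law P Y nu ->
    `|\int[P]_w edot (xi (X w)) (Y w - X w) - (D nu - D mu)| <=
      e * pnorm P p (fun w => enorm (X w - Y w)) + K * pnorm P p (fun w => enorm (X w - Y w)) `^ p.
Proof.
move=> [mxi xiy xiA] e0; have e2 : 0 < e / 2 by rewrite divr_gt0.
(* Half of [e] pays for replacing [xi] by the gradient of [psi] in [L^q], the other half for the
   Taylor remainder; [D] is the integral of [psi]. *)
have [psi tpsi Hpsi] := xiA _ e2.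
have mgrad := measurable_gradient tpsi.
have mdiff : measurable_fun setT ((fun x => xi x - gradient psi x) : Rd -> Rd) by exact: measurable_rVB.
have [fdiff Ediff] := Lqnorm_finite mdiff (lt_trans Hpsi (ltry _)).
have [fxi _] := Lqnorm_finite mxi xiy.
have [K K0 KP] := test_function_taylor tpsi p1 e2.
have [B B0 BP] := test_function_bounded tpsi.
have mpsi : measurable_fun setT (psi : Rd -> R).
  by apply: continuous_measurable_rV; exact: test_function_continuous.
have ipsi d1 (T : measurableType d1) (P : probability T R) (X : T -> Rd) nu :
    has_law P X nu -> P.-integrable setT (EFin \o (fun w => psi (X w))) /\ \int[P]_w psi (X w) = \int[nu]_x psi x.
  move=> lX; have In : nu.-integrable setT (EFin \o psi) by exact: (bounded_integrable nu mpsi BP).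
  by split; [exact/(has_law_integrable lX mpsi)|exact: (has_law_integral lX mpsi In)].
exists (fun nu => \int[nu]_x psi x), K => // d1 T P X Y nu lX lY; set c := pnorm P p _.
have [IX <-] := ipsi _ _ _ _ _ lX; have [IY <-] := ipsi _ _ _ _ _ lY.
have [I1 H1] := pairing_le_pnorm lX lY mxi fxi.
have [I2 H2] := pairing_le_pnorm lX lY mdiff fdiff.
have fd := has_law_dist p1 lX lY.
have [I3 H3] := Rintegral_le_pnorm p0 q0 pq fd.
have I4 := finite_pmoment_integrable fd.
pose r w := psi (Y w) - psi (X w) - edot (gradient psi (X w)) (Y w - X w).
have gE w : edot (gradient psi (X w)) (Y w - X w) =
    edot (xi (X w)) (Y w - X w) - edot (xi (X w) - gradient psi (X w)) (Y w - X w).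
  by rewrite -edotBl opprB addrCA subrr addr0.
have Ig : P.-integrable setT (EFin \o (fun w => edot (gradient psi (X w)) (Y w - X w))).
  rewrite (_ : EFin \o _ = (fun w => (edot (xi (X w)) (Y w - X w))%:E - (edot (xi (X w) - gradient psi (X w)) (Y w - X w))%:E)%E).
    exact: integrableB.
  by apply/funext => w /=; rewrite gE.
have Ipp : P.-integrable setT (EFin \o (fun w => psi (Y w) - psi (X w))).
  by rewrite /comp; under eq_fun do rewrite EFinB; exact: integrableB.
have Ir : P.-integrable setT (EFin \o r).
  by rewrite /comp; under eq_fun do rewrite /r EFinB; exact: integrableB.
have rle : `|\int[P]_w r w| <= e / 2 * c + K * c `^ p.
  apply: le_trans (le_normr_Rintegral measurableT Ir) _.
  have Ia : P.-integrable setT (EFin \o (fun w => e / 2 * `|enorm (X w - Y w)|)).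
    by rewrite /comp; under eq_fun do rewrite EFinM; apply: integrableZl => //; exact: (integrable_norm I3).
  have Ib : P.-integrable setT (EFin \o (fun w => K * `|enorm (X w - Y w)| `^ p)).
    by rewrite /comp; under eq_fun do rewrite EFinM; apply: integrableZl.
  apply: (@le_trans _ _ (\int[P]_w (e / 2 * `|enorm (X w - Y w)| + K * `|enorm (X w - Y w)| `^ p))).
    apply: le_Rintegral => //; first exact: (integrable_norm Ir).
      by rewrite /comp; under eq_fun do rewrite EFinD; exact: integrableD.
    move=> w _; rewrite (ger0_norm (enorm_ge0 _)) enorm_distC; exact: KP.
  rewrite RintegralD// !RintegralZl//; last exact: (integrable_norm I3).
  by rewrite /c pnorm_pow// lerD2r ler_wpM2l// ltW.
have E : \int[P]_w edot (xi (X w)) (Y w - X w) - (\int[P]_w psi (Y w) - \int[P]_w psi (X w)) =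
    \int[P]_w edot (xi (X w) - gradient psi (X w)) (Y w - X w) - \int[P]_w r w.
  rewrite /r !RintegralB//.
  under [X in _ = _ - (_ - X)]eq_Rintegral => w _ do rewrite gE.
  by rewrite RintegralB//; ring.
rewrite E; apply: le_trans (ler_normB _ _) _.
have c0 : 0 <= c by exact: pnorm_ge0.
have H4 : `|\int[P]_w edot (xi (X w) - gradient psi (X w)) (Y w - X w)| <= e / 2 * c.
  apply: le_trans H2 _; rewrite ler_wpM2r//.
  by move: Hpsi; rewrite Ediff lte_fin => /ltW.
have -> : e * c = e / 2 * c + e / 2 * c by field.
by rewrite -addrA lerD.
Qed.

End pairing.

Section simple_law.
Context {R : realType} {d : nat} {p : R}.
Hypothesis p1 : 1 < p.
Local Notation Rd := (borelRd R d).

(** [Y] lives on the same space as [X], so that besides the closeness of the laws there is an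
    explicit joint law with which pairings can be computed. *)
Lemma simple_law d1 (T : measurableType d1) (P : probability T R) (X : T -> Rd) (e : R) :
  0 < e -> measurable_fun setT X -> finite_pmoment P p (fun w => enorm (X w)) ->
  exists (Y : T -> Rd) (nu : Wspace d p) (s : seq 'rV[R]_d), [/\ has_law P Y nu,
    (nu ([set y | y \in s] : set Rd) = 1)%E,
    finite_pmoment P p (fun w => enorm (X w - Y w)) &
    pnorm P p (fun w => enorm (X w - Y w)) < e].
Proof.
move=> e0 mX fX; have p0 : 0 < p := lt_trans ltr01 p1.
have [Y [s [mY Ys fXY XYe]]] := simple_approximation_pnorm p0 e0 mX fX.
have fY := has_law_neq0 (has_law_Wlaw mX fX) mY fXY (ltW p1).
have lY := has_law_Wlaw mY fY.
exists Y, (Wlaw mY fY), s; split => //.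
rewrite -(proj2 lY); last exact: measurable_seq.
rewrite (_ : _ @^-1` _ = setT) ?probability_setT//.
by apply/seteqP; split => // w _ /=; exact: Ys.
Qed.

End simple_law.

(** * The duality map between L^q and L^p *)

Section dual_vector.
Context {R : realType} {d : nat} {p q : R}.
Hypothesis p1 : 1 < p.
Hypothesis pq : p^-1 + q^-1 = 1.
Local Notation Rd := (borelRd R d).
Let p0 : 0 < p := lt_trans ltr01 p1.
Let q1 : 1 < q := conjugate_gt1 p1 pq.
Let q0 : 0 < q := lt_trans ltr01 q1.

(** Hoelder's and Young's inequalities become equalities at this vector [v]: the product of [x] with
    [v] is [|x|^q = |v|^p]. For [q < 2] the negative power at [x = 0] is harmless, as it multiplies
    [x]. *)
Definition dual_vector (x : 'rV[R]_d) : 'rV[R]_d := enorm x `^ (q - 2) *: x.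

Lemma enorm_dual x : enorm (dual_vector x) = enorm x `^ (q - 1).
Proof.
rewrite enormZ ger0_norm ?powR_ge0//.
have := enorm_ge0 x; rewrite le_eqVlt => /predU1P[<-|x0].
  by rewrite mulr0 powR0// subr_eq0 gt_eqF.
rewrite -[X in _ * X]powRr1 ?enorm_ge0// -powRD; last by rewrite (gt_eqF x0) implybT.
by congr (_ `^ _); ring.
Qed.

Lemma edot_dual x : edot x (dual_vector x) = enorm x `^ q.
Proof.
rewrite edotZr -enorm_sqr -powR_mulrn ?enorm_ge0//.
have := enorm_ge0 x; rewrite le_eqVlt => /predU1P[<-|x0].
  by rewrite [0 `^ 2]powR0 ?mulr0 ?powR0// gt_eqF.
by rewrite -powRD ?subrK//; rewrite (gt_eqF x0) implybT.
Qed.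

Lemma pnorm_dual d1 (T : measurableType d1) (P : probability T R) (A : T -> Rd) :
  measurable_fun setT A -> finite_pmoment P q (fun w => enorm (A w)) ->
  [/\ measurable_fun setT (fun w => dual_vector (A w) : Rd),
    finite_pmoment P p (fun w => enorm (dual_vector (A w))),
    pnorm P p (fun w => enorm (dual_vector (A w))) `^ p = pnorm P q (fun w => enorm (A w)) `^ q &
    \int[P]_w edot (A w) (dual_vector (A w)) = pnorm P q (fun w => enorm (A w)) `^ q].
Proof.
move=> mA [_ fA].
have mv : measurable_fun setT (fun w => dual_vector (A w) : Rd).
  apply: measurable_rVZ => //; apply: (measurableT_comp (measurable_powR (q - 2))).
  exact: measurable_enorm.
have qp : q^-1 + p^-1 = 1 by rewrite addrC.
have E w : `|enorm (dual_vector (A w))| `^ p = `|enorm (A w)| `^ q.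
  by rewrite !ger0_norm ?enorm_ge0// enorm_dual (powR_conjugate q1 qp).
split; first exact: mv.
- by split; [exact: measurable_enorm|under eq_integral do rewrite E].
- have H1 := pnorm_pow P (fun w => enorm (dual_vector (A w))) p0.
  have H2 := pnorm_pow P (fun w => enorm (A w)) q0.
  apply: etrans H1 _; apply: etrans (esym H2).
  by apply: eq_Rintegral => w _; exact: E.
- have H2 := pnorm_pow P (fun w => enorm (A w)) q0; apply: etrans (esym H2).
  apply: eq_Rintegral => w _.
  by rewrite edot_dual (ger0_norm (enorm_ge0 _)).
Qed.

End dual_vector.

(** * Viscosity properties *)

(** The passage [e -> 0] at the end of both viscosity proofs, with [C] fixed beforehand and [e <= 1]
    available for the estimates. *)
Lemma le0_of_small (R : realFieldType) (S C : R) : 0 <= C ->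
  (forall e, 0 < e -> e <= 1 -> S <= e * C) -> S <= 0.
Proof.
move=> C0 H; rewrite leNgt; apply/negP => S0.
pose e := Num.min 1 (S / (2 * (C + 1))).
have C1 : 0 < 2 * (C + 1) by rewrite mulr_gt0// ltr_wpDl.
have e0 : 0 < e by rewrite lt_min ltr01 divr_gt0.
have := H e e0; rewrite ge_min lexx => /(_ isT).
apply/negP; rewrite -ltNge.
have : e * (2 * (C + 1)) <= S by rewrite -ler_pdivlMr// ge_min lexx orbT.
have : 0 <= e * C by rewrite mulr_ge0// ltW.
lra.
Qed.

Fact dist_lt_half (R : realFieldType) (x y e : R) : 0 < e ->
  x <= y + e / 2 -> y <= x + e / 2 -> `|x - y| < e.
Proof. by move=> *; rewrite ltr_norml; apply/andP; split; lra. Qed.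

Fact rate_lower (R : realFieldType) (a V0 Q Q0 c e B h l : R) :
  - (V0 + a + Q) <= 2 * e + (2 + l) * h -> (2 + l) * h <= B * e -> Q <= Q0 + c * e ->
  - (a + (Q0 + V0)) <= e * (2 + B + c).
Proof.
set x := (2 + l) * h => H1 H2 H3; have -> : e * (2 + B + c) = 2 * e + B * e + c * e by ring.
by move: H1 H2 H3; set y := B * e; set z := c * e; clearbody x y z; clear => *; lra.
Qed.

Fact error_lower (R : realFieldType) (x y z b r1 r2 e1 e2 : R) :
  `|r1| <= e1 -> `|r2| <= e2 -> (x%:E + y%:E + (b + r1 + r2)%:E <= z%:E)%E ->
  x + y + b - e1 - e2 <= z.
Proof. by rewrite !ler_norml -!EFinD lee_fin => /andP[? _] /andP[? _] ?; lra. Qed.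

Fact error_upper (R : realFieldType) (x y z b r1 r2 e1 e2 : R) :
  `|r1| <= e1 -> `|r2| <= e2 -> (z%:E <= x%:E + y%:E + (b + r1 + r2)%:E)%E ->
  z <= x + y + b + e1 + e2.
Proof. by rewrite !ler_norml -!EFinD lee_fin => /andP[_ ?] /andP[_ ?] ?; lra. Qed.

(** [E] and [IV] stand for the energy and the integral of [V] over the last [h] units of time, [W]
    for the distance covered, [W'] for the distance to the perturbed point and [I] for the pairing.
    The terms [l W'] cancel, and the rest is divided by [h]. *)
Fact supersolution_arith (R : realFieldType) (h e a V0 Q l N1 I E IV W W' aS as_ u0 u1 u' : R) :
  0 < h -> 0 <= l -> l = N1 + e ->
  aS < u0 + h ^+ 2 -> aS = as_ + E - IV -> u1 <= as_ -> u' <= u1 + h ^+ 2 ->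
  u0 + I - a * h - e * h - e * W' <= u' -> - (N1 * W') <= I -> W' <= W + h ^+ 2 ->
  l * W <= E + h * Q -> IV <= (V0 + e) * h ->
  - (V0 + a + Q) <= 2 * e + (2 + l) * h.
Proof.
move=> h0 l0 lE H1 H2 H3 H4 H5 H6 H7 H8 H9.
have H10 : l * W' <= l * W + l * h ^+ 2 by rewrite -mulrDr ler_wpM2l.
have H11 : - (l * W') <= I - e * W' by rewrite lE mulrDl opprD lerD2r.
rewrite -(ler_pM2r h0).
have -> : (2 * e + (2 + l) * h) * h = e * h + e * h + 2 * h ^+ 2 + l * h ^+ 2 by ring.
have -> : - (V0 + a + Q) * h = - (V0 * h) - a * h - h * Q by ring.
have H12 : (V0 + e) * h = V0 * h + e * h by ring.
rewrite H12 in H9.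
move: H1 H2 H3 H4 H5 H8 H9 H10 H11; set x1 := l * W'; set x2 := l * W; set x3 := l * _.
set x4 := h ^+ 2; set x5 := e * W'; set x6 := e * h; set x7 := a * h; set x8 := V0 * h; set x9 := h * Q.
by clearbody x1 x2 x3 x4 x5 x6 x7 x8 x9; clear => *; lra.
Qed.

Lemma powR_increment (R : realType) (p q x e : R) : 1 < p -> p^-1 + q^-1 = 1 ->
  0 <= x -> 0 < e -> e <= 1 ->
  p^-1 * (x + e) `^ p <= p^-1 * x `^ p + (x + 1) `^ (p - 1) * e.
Proof.
move=> p1 pq x0 e0 e1; have xe0 : 0 <= x + e by rewrite addr_ge0// ltW.
have p0 : 0 < p := lt_trans ltr01 p1.
have := powR_tangent p1 pq x0 xe0; rewrite [x + e - x]addrAC subrr add0r lerBlDl => H.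
have {H} H : p^-1 * (x + e) `^ p <= p^-1 * x `^ p + (x + e) `^ (p - 1) * e.
  by rewrite -(ler_pM2l p0) mulrDr !mulrA mulfV ?gt_eqF// !mul1r.
apply: le_trans H _; rewrite lerD2l ler_wpM2r ?(ltW e0)//.
by apply: le_powR; rewrite ?subr_ge0 ?(ltW p1)// lerD2l.
Qed.

Lemma segment_cost_le (R : realType) (p q h c v N : R) : 1 < p -> p^-1 + q^-1 = 1 ->
  0 <= v -> v `^ p = N -> 0 < h -> h <= 1 -> 0 <= c -> c <= h * v + h ^+ 2 ->
  p^-1 * (h * (c / h) `^ p) <= h * (p^-1 * N + (v + 1) `^ (p - 1) * h).
Proof.
move=> p1 pq v0 <- h0 h1 c0 ch; have p0 : 0 < p := lt_trans ltr01 p1.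
rewrite mulrCA ler_pM2l//; apply: le_trans (powR_increment p1 pq v0 h0 h1).
rewrite ler_pM2l ?invr_gt0//; apply: le_powR; [exact: ltW|by rewrite divr_ge0// ltW|].
by rewrite ler_pdivrMr// mulrDl -expr2 mulrC.
Qed.

(** [Pi] stands for the pairing with the optimal plan and [J] for that with the explicit joint law,
    both compared with [D]. [N] is [|xi|^q], [N0 = N / p] the leading part of the cost [E] of the
    segment per unit of time, and [K0] the remainder [K c^p]. Everything is divided by [h]. *)
Fact subsolution_arith (R : realFieldType) (h e a V0 N N0 N1 C1 C2 c W Pi D J u0 u' E K0 : R) :
  0 < h -> h <= e -> 0 <= N1 -> 0 <= C2 ->
  u' <= u0 + Pi - a * h + e * h + e * W -> u0 <= u' + E - (V0 - e) * h ->
  Pi <= D + e * c + K0 -> D <= J + e * c + K0 -> J <= - (h * N) + N1 * h ^+ 2 ->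
  c <= h * C1 -> W <= c -> K0 <= e * h -> E <= h * (N0 + C2 * h) ->
  a + (N - N0 + V0) <= e * (N1 + 3 * C1 + 4 + C2).
Proof.
move=> h0 he N10 C20 H1 H2 H3 H4 H5 H6 H7 H8 H9.
have e0 : 0 <= e by exact: le_trans (ltW h0) he.
rewrite -(ler_pM2r h0).
have -> : (a + (N - N0 + V0)) * h = a * h + h * N - h * N0 + V0 * h by ring.
have -> : e * (N1 + 3 * C1 + 4 + C2) * h = N1 * (e * h) + 3 * (e * (h * C1)) + 4 * (e * h) + C2 * (e * h) by ring.
have H10 : e * c <= e * (h * C1) by rewrite ler_wpM2l.
have H11 : e * W <= e * (h * C1) by rewrite ler_wpM2l// (le_trans H7).
have hh : h ^+ 2 <= e * h by rewrite expr2 ler_wpM2r// ltW.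
have H12 : N1 * h ^+ 2 <= N1 * (e * h) by rewrite ler_wpM2l.
have H13 : C2 * h ^+ 2 <= C2 * (e * h) by rewrite ler_wpM2l.
have H14 : h * (N0 + C2 * h) = h * N0 + C2 * h ^+ 2 by ring.
have H15 : (V0 - e) * h = V0 * h - e * h by ring.
rewrite H14 in H9; rewrite H15 in H2.
move: H1 H2 H3 H4 H5 H8 H9 H10 H11 H12 H13.
set x1 := e * (h * C1); set x2 := e * h; set x3 := N1 * x2; set x4 := C2 * x2; set x5 := h * N.
set x6 := h * N0; set x7 := V0 * h; set x8 := a * h; set x9 := e * c; set x10 := e * W.
set x11 := N1 * _; set x12 := C2 * _.
by clearbody x1 x2 x3 x4 x5 x6 x7 x8 x9 x10 x11 x12; clear => *; lra.
Qed.

Lemma small_step (R : realType) (p e K C r r' t : R) : 1 < p -> 0 < e -> 0 <= K -> 0 < C ->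
  0 < r -> 0 < r' -> 0 < t ->
  exists h, [/\ 0 < h, h <= e, h <= r / 2, h <= t / 2 & h * C + h * C < Num.min r r'] /\
    forall c, 0 <= c -> c <= h * C -> K * c `^ p <= e * h.
Proof.
move=> p1 e0 K0 C0 r0 r'0 t0; have p0 : 0 < p := lt_trans ltr01 p1.
have p10 : 0 < p - 1 by rewrite subr_gt0.
pose Kc := K * C `^ p.
have Kc0 : 0 <= Kc by rewrite mulr_ge0 ?powR_ge0.
have Kc1 : 0 < Kc + 1 by rewrite ltr_wpDl.
(* Makes [h^(p-1)] at most [e / (K C^p + 1)], so that [K c^p <= K C^p h^(p-1) h <= e h]. *)
pose hb := (e / (Kc + 1)) `^ (p - 1)^-1.
have hb0 : 0 < hb by rewrite powR_gt0// divr_gt0.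
pose rr := Num.min r r' / (2 * C).
have rr0 : 0 < rr by rewrite divr_gt0 ?mulr_gt0// lt_min r0.
pose h := Num.min (Num.min e hb) (Num.min (rr / 2) (Num.min (r / 2) (t / 2))).
have h0 : 0 < h by rewrite !lt_min e0 hb0/=; apply/and3P; split; exact: divr_gt0.
have [[he hhb hrr] [hr ht]] : [/\ h <= e, h <= hb & h <= rr / 2] /\ (h <= r / 2 /\ h <= t / 2).
  by have := lexx h; rewrite {2}/h !le_min => /andP[/andP[-> ->] /and3P[-> -> ->]].
exists h; split; first split => //.
  rewrite -mulr2n -mulr_natl mulrCA -ltr_pdivlMr ?mulr_gt0//; apply: le_lt_trans hrr _.
  by rewrite -/rr ltr_pdivrMr// mulr_natr mulr2n ltrDl.
move=> c c0 ch; have hp : h `^ (p - 1) <= e / (Kc + 1).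
  rewrite -[leRHS](powRVK p10) ?divr_ge0 ?(ltW e0) ?(ltW Kc1)//.
  by apply: le_powR; rewrite // ltW.
apply: (@le_trans _ _ (K * (h * C) `^ p)).
  by rewrite ler_wpM2l// le_powR// ltW.
rewrite powRM ?(ltW h0) ?(ltW C0)// -(mulr_powRB1 (ltW h0) p0).
have -> : K * (h * h `^ (p - 1) * C `^ p) = h `^ (p - 1) * Kc * h by rewrite /Kc; ring.
rewrite ler_pM2r//; apply: (@le_trans _ _ (e / (Kc + 1) * Kc)); first by rewrite ler_wpM2r.
by rewrite mulrAC ler_pdivrMr// ler_pM2l// lerDl.
Qed.

Section viscosity.
Context {R : realType} {d : nat} {p q : R}.
Hypothesis p1 : 1 < p.
Hypothesis pq : p^-1 + q^-1 = 1.
Variables (G V : Wspace d p -> R) (A L beta : R) (rho : Wspace d p).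
Hypothesis A0 : 0 <= A.
Hypothesis L0 : 0 <= L.
Hypothesis GL : forall nu nu', `|G nu - G nu'| <= L * Wp nu nu'.
Hypothesis cV : Wcontinuous V.
Hypothesis VA : forall nu, V nu <= A * (Wp nu rho) `^ p + beta.
Implicit Types (sigma : R -> Wspace d p) (h k : R -> R) (t : R) (mu nu : Wspace d p).
Local Notation Rd := (borelRd R d).
Local Notation action := (action G V).
Local Notation energy := (energy (p := p)).
Local Notation T := (horizon (p := p) A).
Let p0 : 0 < p := lt_trans ltr01 p1.
Let q1 : 1 < q := conjugate_gt1 p1 pq.
Let q0 : 0 < q := lt_trans ltr01 q1.
Let qp : q^-1 + p^-1 = 1 := etrans (addrC _ _) pq.

Let u nu t : R := fine (value_function G V nu t).
Let uz (z : Wspace d p * R) : R := fine (value_function G V z.1 z.2).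

Lemma value_continuous_on : continuous_on (cylinder T) uz.
Proof.
move=> [mu t] /= /andP[t0 tT] B /nbhs_ballP[e /= e0 eB]; apply/nbhs_cylinderP.
have e2 : 0 < e / 2 by rewrite divr_gt0.
have [r r0 rP] := value_modulus p1 pq A0 L0 GL cV VA mu t0 tT e2.
exists r => // nu s W st; apply: eB; rewrite /uz/=.
have Wr : Wp mu mu < r by rewrite (Wp_xx p1).
have tr : `|t - t| < r by rewrite subrr normr0.
exact: (dist_lt_half e0 (rP _ _ _ _ Wr W tr st) (rP _ _ _ _ W Wr st tr)).
Qed.

Lemma continuous_usc : continuous_on (cylinder T) uz -> usc_on (cylinder T) uz.
Proof.
move=> cu z0 Dz c uc; apply: (cu z0 Dz [set y | y < c]).
apply: open_nbhs_nbhs; split => //; exact: open_lt.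
Qed.

Lemma continuous_lsc : continuous_on (cylinder T) uz -> lsc_on (cylinder T) uz.
Proof.
move=> cu z0 Dz c uc; apply: (cu z0 Dz [set y | c < y]).
apply: open_nbhs_nbhs; split => //; exact: open_gt.
Qed.

(** A near-optimal path to [nu] is extended along the given joint law. In the subsolution it serves
    to return from the displaced measure to [mu0]. *)
Lemma value_dpp d1 (Om : measurableType d1) (P : probability Om R) (X Y : Om -> Rd) nu nu' s tau m
  (c := pnorm P p (fun w => enorm (X w - Y w))) :
  has_law P X nu -> has_law P Y nu' -> 0 <= s -> 0 < tau -> s + tau < T ->
  (forall kap, Wp nu kap <= c -> m <= V kap) ->
  u nu' (s + tau) <= u nu s + p^-1 * (tau * (c / tau) `^ p) - m * tau.
Proof.
move=> lX lY s0 tau0 sT mV; apply/ler_addgt0Pr => e e0.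
have sT' : s < T by apply: le_lt_trans sT; rewrite lerDl ltW.
have [sigma [h [st sh H]]] := value_near_action p1 pq A0 L0 GL cV VA nu s0 sT' e0.
have st' : same_measure nu (sigma s) by move=> B mB; rewrite st.
have [pi [cpi _ piE]] := law_pair_coupling p1 (same_measure_has_law lX st') lY.
have := value_extend p1 pq A0 L0 GL cV VA s0 tau0 sT sh cpi.
rewrite piE -/c => /(_ m) /= K.
apply: le_trans (K _) _.
  by move=> kap Wk; apply: mV; rewrite (Wp_same_l p1 _ st').
by rewrite [leRHS]addrAC lerD2r [leRHS]addrAC lerD2r; exact: ltW.
Qed.


Lemma pairing_finite mu nu xi (pi : probability (Rd * Rd)%type R) :
  measurable_fun setT (xi : Rd -> Rd) -> (Lqnorm q mu xi < +oo)%E -> coupling mu nu pi ->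
  ((\int[pi]_z (edot (xi z.1) ((z.2 : 'rV[R]_d) - z.1))%:E) =
    (\int[pi]_z edot (xi z.1) ((z.2 : 'rV[R]_d) - z.1))%:E)%E.
Proof.
move=> mxi xiy cpi; have [fxi _] := Lqnorm_finite p1 pq mxi xiy.
have [I _] := pairing_le_pnorm p1 pq (coupling_fst cpi) (coupling_snd cpi) mxi fxi.
by rewrite /Rintegral fineK//; exact: (integrable_fin_num measurableT I).
Qed.

Lemma little_o_near (z0 : Wspace d p * R) (r1 r2 : Wspace d p * R -> R) (B : set (Wspace d p * R)) (e : R) :
  little_o z0 r1 (fun z => z.2 - z0.2) -> little_o z0 r2 (fun z => Wp z.1 z0.1) ->
  nbhs z0 B -> 0 < e -> exists2 r : R, 0 < r & forall nu t, Wp z0.1 nu < r -> `|t - z0.2| < r ->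
    [/\ `|r1 (nu, t)| <= e * `|t - z0.2|, `|r2 (nu, t)| <= e * Wp z0.1 nu & B (nu, t)].
Proof.
case: z0 => mu0 t0 /= o1 o2 /nbhs_cylinderP[r r0 rP] e0.
have /nbhs_cylinderP[s1 s10 s1P] := o1 e e0; have /nbhs_cylinderP[s2 s20 s2P] := o2 e e0.
exists (Num.min r (Num.min s1 s2)); first by rewrite !lt_min r0 s10.
move=> nu t; rewrite !lt_min => /and3P[W1 W2 W3] /and3P[t1 t2 t3]; split.
- exact: s1P W2 t2.
- have := s2P _ _ W3 t3; rewrite /= (ger0_norm (Wp_ge0 p1 _ _)).
  by rewrite (Wp_sym p1 nu).
- exact: rP.
Qed.

(** The supremum over optimal plans is at least the pairing with the given one, which turns the
    extended-real condition into an inequality between real numbers, provided an optimal plan is at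
    hand. *)
Lemma subdifferential_near mu0 t0 a xi (e : R) : measurable_fun setT (xi : Rd -> Rd) ->
  (Lqnorm q mu0 xi < +oo)%E -> subdifferential uz (mu0, t0) a xi -> 0 < e ->
  exists2 r : R, 0 < r & forall nu t pi, Wp mu0 nu < r -> `|t - t0| < r -> optimal_coupling mu0 nu pi ->
    u mu0 t0 + \int[pi]_z edot (xi z.1) ((z.2 : 'rV[R]_d) - z.1) + a * (t - t0)
      - e * `|t - t0| - e * Wp mu0 nu <= u nu t.
Proof.
move=> mxi xiy [r1 [r2 rr]] e0; have [ho1 ho2 H] := rr; have [r r0 rP] := little_o_near ho1 ho2 H e0.
exists r => // nu t pi W tt opi; have [b1 b2 /= b3] := rP nu t W tt.
have [cpi _] := opi.
have Ile : ((\int[pi]_z edot (xi z.1) ((z.2 : 'rV[R]_d) - z.1))%:E <=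
    ereal_sup (pairings mu0 xi nu))%E.
  by rewrite -(pairing_finite mxi xiy cpi); apply: ereal_sup_ubound; exists pi.
exact: error_lower b1 b2 (le_trans (leeD2r _ (leeD2l (uz (mu0, t0))%:E Ile)) b3).
Qed.

Lemma superdifferential_near mu0 t0 a xi (e : R) : measurable_fun setT (xi : Rd -> Rd) ->
  (Lqnorm q mu0 xi < +oo)%E -> superdifferential uz (mu0, t0) a xi -> 0 < e ->
  exists2 r : R, 0 < r & forall nu t pi, Wp mu0 nu < r -> `|t - t0| < r -> optimal_coupling mu0 nu pi ->
    u nu t <= u mu0 t0 + \int[pi]_z edot (xi z.1) ((z.2 : 'rV[R]_d) - z.1) + a * (t - t0)
      + e * `|t - t0| + e * Wp mu0 nu.
Proof.
move=> mxi xiy [r1 [r2 rr]] e0; have [ho1 ho2 H] := rr; have [r r0 rP] := little_o_near ho1 ho2 H e0.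
exists r => // nu t pi W tt opi; have [b1 b2 /= b3] := rP nu t W tt.
have [cpi _] := opi.
have Ile : (ereal_inf (pairings mu0 xi nu) <=
    (\int[pi]_z edot (xi z.1) ((z.2 : 'rV[R]_d) - z.1))%:E)%E.
  by rewrite -(pairing_finite mxi xiy cpi); apply: ereal_inf_lbound; exists pi.
exact: error_upper b1 b2 (le_trans b3 (leeD2r _ (leeD2l (uz (mu0, t0))%:E Ile))).
Qed.


Lemma value_supersolution mu0 t0 a xi : 0 < t0 -> t0 < T -> CoTan q mu0 xi ->
  subdifferential uz (mu0, t0) a xi -> 0 <= a + hamiltonian q V mu0 xi.
Proof.
move=> t00 t0T [mxi xiy _] sub.
have [fxi xiE] := Lqnorm_finite p1 pq mxi xiy.
rewrite /hamiltonian xiE /=; set N1 := pnorm _ _ _.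
have N10 : 0 <= N1 by exact: pnorm_ge0.
have N11 : 0 <= (N1 + 1) `^ (q - 1) by exact: powR_ge0.
rewrite -oppr_le0; apply: (@le0_of_small _ _ (2 + (2 + (N1 + 1)) + (N1 + 1) `^ (q - 1))).
  by rewrite !addr_ge0.
move=> e e0 e1.
have [r r0 rP] := subdifferential_near mxi xiy sub e0.
have [rV rV0 rVP] := cV mu0 e0.
pose B := 4 * (1 + `|V mu0| + growth (q := q) A L beta rho mu0).
have B0 : 0 < B.
  by rewrite mulr_gt0// ltr_wpDr ?growth_ge0// ltr_wpDr.
pose rr := Num.min (r / 2) rV.
have rr0 : 0 < rr by rewrite lt_min rV0 divr_gt0.
have [del del0 delP] := @W_small R d p q p1 pq B rr B0 rr0.
(* [h] is fixed before the path and the approximating measure, whose errors can then be taken of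
   size [h^2]. *)
pose h := Num.min (Num.min e del) (Num.min (r / 2) (t0 / 2)).
have h0 : 0 < h by rewrite !lt_min e0 del0 !divr_gt0.
have [he hd hr ht] : [/\ h <= e, h <= del, h <= r / 2 & h <= t0 / 2].
  by have := lexx h; rewrite {2}/h !le_min => /andP[/andP[-> ->] /andP[-> ->]].
have h1 : h <= 1 by exact: le_trans he e1.
have hh : h ^+ 2 <= h by rewrite expr2 ler_piMl// ltW.
have hh0 : 0 < h ^+ 2 by exact: exprn_gt0.
have [sigma [k [st sh H]]] := value_near_action p1 pq A0 L0 GL cV VA mu0 (ltW t00) t0T hh0.
have kB : energy k 0 t0 <= B.
  apply: (near_action_energy p1 pq A0 L0 GL cV VA (ltW t00) t0T st sh).
  by apply: lt_le_trans H _; rewrite lerD2l (le_trans hh).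
have s0 : 0 < t0 - h by rewrite subr_gt0; apply: le_lt_trans ht _; rewrite ltr_pdivrMr// mulr_natr mulr2n ltrDl.
have st0 : t0 - h <= t0 by rewrite gerBl ltW.
have near s : t0 - h <= s -> s <= t0 -> Wp mu0 (sigma s) < rr.
  move=> ss s1; rewrite -(Wp_same_l p1 _ st) (Wp_sym p1).
  have s00 : 0 <= s by apply: le_trans ss; exact: ltW.
  apply: (delP sigma t0 k) => //.
    by apply: le_trans kB; exact: (energy_sub p1 sh s00 s1).
  by rewrite (le_trans _ hd)// lerBlDr -lerBlDl.
set mu1 := sigma (t0 - h).
have sT : t0 - h < T by exact: le_lt_trans t0T.
have [rM rM0 rMP] := value_modulus p1 pq A0 L0 GL cV VA mu1 s0 sT hh0.
(* The finitely supported [nu] will be close enough to [mu1] for the value to change by at most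
   [h^2], and within [h^2] in distance. *)
have m0 : 0 < Num.min rM (h ^+ 2) by rewrite lt_min rM0.
have lid := has_law_id mu1.
have [Y [nu [s [lY nus fY WY]]]] := simple_law p1 m0 (proj1 lid) (has_law_moment lid).
have W1 : Wp mu1 nu < Num.min rM (h ^+ 2) by apply: le_lt_trans WY; exact: Wp_le_pnorm.
move: W1; rewrite lt_min => /andP[W1 W2].
have [pi opi] := semidiscrete_optimal p1 mu0 nus.
have z1 : `|t0 - h - (t0 - h)| < rM by rewrite subrr normr0.
have u1 : u nu (t0 - h) <= u mu1 (t0 - h) + h ^+ 2.
  by apply: (rMP nu mu1) => //; rewrite (Wp_xx p1).
have W3 : Wp mu0 nu <= Wp (sigma (t0 - h)) (sigma t0) + h ^+ 2.
  apply: le_trans (Wp_triangle p1 mu1 _ _) _; apply: lerD; last exact: ltW.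
  by rewrite -(Wp_same_l p1 _ st) (Wp_sym p1).
have dt : t0 - h - t0 = - h by rewrite addrAC subrr add0r.
have Wr : Wp mu0 nu < r.
  apply: le_lt_trans W3 _; rewrite [r]splitr; apply: ltr_leD; last exact: le_trans hr.
  rewrite (Wp_sym p1) (Wp_same_l p1 _ st); apply: lt_le_trans (near _ (lexx _) st0) _.
  by rewrite ge_min lexx.
have hr' : `|t0 - h - t0| < r.
  rewrite dt normrN gtr0_norm//; apply: le_lt_trans hr _.
  by rewrite ltr_pdivrMr// mulr_natr mulr2n ltrDl.
have key := rP _ _ _ Wr hr' opi; rewrite dt normrN (gtr0_norm h0) mulrN in key.
have [cpi _] := opi.
have [_ HI] := pairing_le_pnorm p1 pq (coupling_fst cpi) (coupling_snd cpi) mxi fxi.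
have piW : pnorm pi p (fun z => enorm ((z.1 : 'rV[R]_d) - z.2)) = Wp mu0 nu.
  apply/le_anti/andP; split; last by exact: (Wp_le_pnorm p1 (coupling_fst cpi) (coupling_snd cpi)).
  rewrite -lee_fin -(proj1 (Wp_eq p1 mu0 nu)) -(transport_costE p1 cpi).
  by apply: le_ereal_inf_tmp => _ [pi' cpi' <-]; exact: (proj2 opi).
rewrite piW -/N1 ler_norml in HI; have {HI} /andP[HI _] := HI.
(* In the slope [N1 + e], the part [N1] absorbs the lower bound of the pairing and [e] the error
   proportional to the distance. *)
have Wy := W_young p1 pq sh (_ : 0 <= N1 + e) (ltW s0) st0 (lexx t0).
have {}Wy := Wy (addr_ge0 N10 (ltW e0)).
have split_a := action_split p1 pq G cV sh (ltW s0) st0.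
have low : u mu1 (t0 - h) <= action sigma k (t0 - h).
  apply: (value_le_action p1 pq A0 L0 GL cV VA (ltW s0) sT) => //.
  exact: (speed_bound_restrict (ltW s0) st0 sh).
have IV : itg (t0 - h) t0 (fun s => V (sigma s)) <= (V mu0 + e) * h.
  have -> : (V mu0 + e) * h = itg (t0 - h) t0 (fun=> V mu0 + e) by rewrite itg_cst// subKr.
  apply: le_itg.
  - exact: (integrable_onS (ltW s0) (lexx t0) (integrable_on_V p1 pq cV (ltW t00) sh)).
  - exact: integrable_on_cst.
  - move=> s' /andP[ss s1]; have := rVP (sigma s'); rewrite ltr_distlC.
    have -> : Wp mu0 (sigma s') < rV.
      by apply: lt_le_trans (near _ ss s1) _; rewrite ge_min lexx orbT.
    by move=> /(_ isT) /andP[_ /ltW].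
rewrite subKr in Wy.
have l0 : 0 <= N1 + e by rewrite addr_ge0// ltW.
have F := supersolution_arith h0 l0 erefl H split_a low u1 key HI W3 Wy IV.
(* Returns from the slope [N1 + e] to [N1] at a cost of order [e]. *)
have Q := powR_increment q1 qp N10 e0 e1.
have F2 : (2 + (N1 + e)) * h <= (2 + (N1 + 1)) * e.
  by apply: ler_pM; rewrite ?lerD2l ?addr_ge0 ?(ltW h0) ?(ltW e0).
exact: rate_lower F F2 Q.
Qed.

Local Opaque Wp pnorm.

Lemma value_subsolution mu0 t0 a xi : 0 < t0 -> t0 < T -> CoTan q mu0 xi ->
  superdifferential uz (mu0, t0) a xi -> a + hamiltonian q V mu0 xi <= 0.
Proof.
move=> t00 t0T cxi sup; have [mxi xiy _] := cxi.
have [fxi xiE] := Lqnorm_finite p1 pq mxi xiy.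
have [N1 [N1E N10]] : exists N1, pnorm mu0 q (fun x : Rd => enorm (xi x)) = N1 /\ 0 <= N1.
  by exists (pnorm mu0 q (fun x : Rd => enorm (xi x))); split => //; exact: pnorm_ge0.
rewrite /hamiltonian xiE /= N1E.
have [mv fv] := pnorm_dual p1 pq (P := mu0) mxi fxi; rewrite N1E => nvE vE.
set v := fun x : Rd => dual_vector (q := q) (xi x) : Rd.
have [nv [nvD nv0]] : exists nv, pnorm mu0 p (fun x => enorm (v x)) = nv /\ 0 <= nv.
  by exists (pnorm mu0 p (fun x => enorm (v x))); split => //; exact: pnorm_ge0.
rewrite [X in X `^ _]nvD in nvE.
have nv1 : 0 <= nv + 1 by rewrite addr_ge0.
set C2 := (nv + 1) `^ (p - 1); have C20 : 0 <= C2 by exact: powR_ge0.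
(* The kinetic term is split into the gain of the pairing minus the cost of the segment, the two
   quantities that the displacement [- h v] realizes. *)
have -> : q^-1 * N1 `^ q = N1 `^ q - p^-1 * N1 `^ q.
  by rewrite -{2}[N1 `^ q]mul1r -mulrBl -pq addrC addKr.
apply: (@le0_of_small _ _ (N1 + 3 * (nv + 1) + 4 + C2)).
  apply: addr_ge0 C20; apply: addr_ge0 (ler0n _ 4); apply: addr_ge0 N10 _.
  exact: mulr_ge0 (ler0n _ 3) nv1.
move=> e e0 e1.
have [r r0 rP] := superdifferential_near mxi xiy sup e0.
have [D [K K0 KP]] := gradient_pairing p1 pq cxi e0.
have [rV rV0 rVP] := cV mu0 e0.
have nv2 : 0 < nv + 1 by rewrite ltr_wpDl.
have [h [[h0 he hr ht hC] Kh]] := small_step p1 e0 K0 nv2 r0 rV0 t00.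
have h1 : h <= 1 by exact: le_trans he e1.
have hh0 : 0 < h ^+ 2 by exact: exprn_gt0.
have s0 : 0 < t0 - h by rewrite subr_gt0; apply: le_lt_trans ht _; rewrite ltr_pdivrMr// mulr_natr mulr2n ltrDl.
pose Z (x : Rd) : Rd := (x : 'rV[R]_d) - h *: v x.
have mhv : measurable_fun setT (fun x : Rd => h *: v x : Rd) by apply: measurable_rVZ => //; exact: measurable_cst.
have mZ : measurable_fun setT Z by exact: measurable_rVB.
have xZ x : enorm ((x : 'rV[R]_d) - Z x) = `|h * enorm (v x)|.
  by rewrite /Z opprB addrCA subrr addr0 enormZ gtr0_norm// ger0_norm// mulr_ge0 ?enorm_ge0// ltW.
have lid := has_law_id mu0.
have [fhv' nhv'] := finite_pmomentZ h p0 fv.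
have mxZ : measurable_fun setT (fun x : Rd => enorm ((x : 'rV[R]_d) - Z x)).
  by apply: measurable_enorm; apply: measurable_rVB.
have [fxZ nxZ] : finite_pmoment mu0 p (fun x : Rd => enorm ((x : 'rV[R]_d) - Z x)) /\
    pnorm mu0 p (fun x : Rd => enorm ((x : 'rV[R]_d) - Z x)) <= h * nv.
  have := le_finite_pmoment p0 mxZ _ fhv'; rewrite nhv' nvD (gtr0_norm h0); apply=> x.
  by rewrite xZ normr_id.
have fZ := has_law_neq0 lid mZ fxZ (ltW p1).
have [Y [nu [s [lY nus fY WY]]]] := simple_law p1 hh0 mZ fZ.
have [mY _] := lY.
have [pi opi] := semidiscrete_optimal p1 mu0 nus.
have [cpi optpi] := opi.
set c := pnorm mu0 p (fun x => enorm ((x : 'rV[R]_d) - Y x)).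
have ch : c <= h * nv + h ^+ 2.
  have mYZ : measurable_fun setT (fun x : Rd => enorm (Z x - Y x)) by have [] := fY.
  have [fs ns] := finite_pmomentD (ltW p1) fxZ fY.
  have mxY : measurable_fun setT (fun x : Rd => enorm ((x : 'rV[R]_d) - Y x)).
    by apply: measurable_enorm; apply: measurable_rVB.
  have := le_finite_pmoment p0 mxY _ fs => -[x|_ le1].
    rewrite (ger0_norm (enorm_ge0 _)) /= (le_trans (ler_enorm_dist (Z x) _ _))//.
    exact: ler_norm.
  by apply: le_trans le1 _; apply: le_trans ns _; apply: lerD => //; exact: ltW.
have ch1 : c <= h * (nv + 1).
  by apply: le_trans ch _; rewrite mulrDr mulr1 lerD2l expr2 ler_piMr// ltW.
have Wc : Wp mu0 nu <= c by exact: Wp_le_pnorm.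
have c0 : 0 <= c by exact: pnorm_ge0.
(* The joint law of [x] and [Y x] is a competitor, so the optimal plan costs at most [c], which is
   of order [h]. *)
have cpic : pnorm pi p (fun z => enorm ((z.1 : 'rV[R]_d) - z.2)) <= c.
  have [pi' [cpi' _ pi'E]] := law_pair_coupling p1 lid lY.
  have := optpi _ cpi'; rewrite !(@transport_costE _ _ _ p1 mu0 nu)// lee_fin.
  by rewrite pi'E.
have c2 : c + c < Num.min r rV by apply: le_lt_trans hC; exact: lerD.
move: c2; rewrite lt_min => /andP[c2r c2V].
have cr : c < r by apply: le_lt_trans c2r; rewrite lerDl.
have dt : t0 - h - t0 = - h by rewrite addrAC subrr add0r.
have hr' : `|t0 - h - t0| < r.
  rewrite dt normrN gtr0_norm//; apply: le_lt_trans hr _.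
  by rewrite ltr_pdivrMr// mulr_natr mulr2n ltrDl.
have key := rP _ _ _ (le_lt_trans Wc cr) hr' opi; rewrite dt normrN (gtr0_norm h0) mulrN in key.
have cY : pnorm mu0 p (fun x => enorm (Y x - (x : 'rV[R]_d))) = c.
  by rewrite /c; congr (pnorm _ _ _); apply/funext => x; rewrite enorm_distC.
have tE : t0 - h + h = t0 by rewrite subrK.
(* The segment leads from [nu] at time [t0 - h] to [mu0] at time [t0]; the margin [c + c] keeps it
   in the ball where [V] is within [e] of [V mu0]. *)
have dpp : u mu0 (t0 - h + h) <= u nu (t0 - h) +
    p^-1 * (h * (pnorm mu0 p (fun x => enorm (Y x - (x : 'rV[R]_d))) / h) `^ p) - (V mu0 - e) * h.
  apply: (value_dpp lY lid (ltW s0) h0); first by rewrite tE.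
  move=> kap; rewrite cY => Wk.
  have Wk' : Wp mu0 kap < rV.
    apply: le_lt_trans (Wp_triangle p1 nu _ _) _; apply: le_lt_trans c2V; exact: lerD.
  by have := rVP _ Wk'; rewrite ltr_distlC => /andP[/ltW].
rewrite tE cY in dpp.
have KcE : K * c `^ p <= e * h by exact: Kh.
have costE : p^-1 * (h * (c / h) `^ p) <= h * (p^-1 * N1 `^ q + C2 * h).
  exact: (segment_cost_le p1 pq nv0 nvE h0 h1 c0 ch).
(* The same [D] serves two joint laws with marginals [mu0] and [nu]: the optimal plan, whose pairing
   occurs in the differential, and the law of [x] and [Y x], whose pairing is explicit. *)
have pi_pair := KP _ _ pi fst snd nu (coupling_fst cpi) (coupling_snd cpi).
have Y_pair := KP _ _ mu0 id Y nu lid lY.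
set Pi := \int[pi]_z edot (xi z.1) ((z.2 : 'rV[R]_d) - z.1) in key.
have PiD : Pi <= (D nu - D mu0) + e * c + K * c `^ p.
  move: pi_pair; rewrite ler_norml => /andP[_]; rewrite -/Pi lerBlDl => /le_trans; apply.
  rewrite -[leRHS]addrA lerD2l; apply: lerD; first by rewrite ler_pM2l.
  apply: (ler_wpM2l K0); apply: le_powR; [exact: ltW|exact: pnorm_ge0|exact: cpic].
set J := \int[mu0]_x edot (xi x) (Y x - (x : 'rV[R]_d)) in Y_pair.
have DJ : D nu - D mu0 <= J + e * c + K * c `^ p.
  move: Y_pair; rewrite ler_norml => /andP[+ _].
  by rewrite lerBrDr addrC lerBlDr addrA.
(* Decompose [Y x - x = (Y x - Z x) - h v x]: the second part pairs to exactly [- h |xi|^q], the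
   first to at most [N1 h^2]. *)
have JN : J <= - (h * N1 `^ q) + N1 * h ^+ 2.
  have mYZ' : measurable_fun setT (fun x : Rd => Y x - Z x : Rd) by exact: measurable_rVB.
  have fYZ : finite_pmoment mu0 p (fun x : Rd => enorm (Y x - Z x)).
    by under eq_fun do rewrite enorm_distC.
  have [Ia Ha] := edot_hoelder p1 pq mxi mYZ' fxi fYZ.
  have [Ib _] := edot_hoelder p1 pq mxi mv fxi fv.
  have Ic : mu0.-integrable setT (EFin \o (fun x : Rd => h * edot (xi x) (v x))).
    by rewrite /comp; under eq_fun do rewrite EFinM; exact: integrableZl.
  have -> : J = \int[mu0]_x edot (xi x) (Y x - Z x) - \int[mu0]_x (h * edot (xi x) (v x)).
    apply: etrans (RintegralB measurableT Ia Ic); apply: eq_Rintegral => x _.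
    rewrite -edotZr -edotNr -edotDr; congr edot.
    by rewrite /Z opprB [_ *: _ - _]addrC addrA addrK.
  have -> : \int[mu0]_x (h * edot (xi x) (v x)) = h * N1 `^ q.
    by rewrite -vE; exact: RintegralZl.
  rewrite addrC lerD2l.
  apply: le_trans (ler_norm _) _; apply: le_trans Ha _; rewrite [X in X * _]N1E; apply: (ler_wpM2l N10).
  rewrite (_ : (fun x => enorm (Y x - Z x)) = (fun x => enorm (Z x - Y x))); first exact: ltW.
  by apply/funext => x; rewrite enorm_distC.
have := subsolution_arith h0 he N10 C20 key dpp PiD DJ JN ch1 Wc KcE costE.
by [].
Qed.

End viscosity.

Unset Implicit Arguments.
Set Strict Implicit.
Set Printing Implicit Defensive.

Theorem theorem1p1 (R : realType) (p q : R) (hp : 1 < p)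
    (hpq : p^-1 + q^-1 = 1) (alpha : R) :
  exists2 T : R, 0 < T &
    forall (d : nat) (G V : Wspace d p -> R) (beta : R) (rho : Wspace d p),
      (0 < d)%N ->
      continuous G -> continuous V ->
      (exists L : R, forall mu nu, `|G mu - G nu| <= L * Wp mu nu) ->
      (forall mu, V mu <= alpha * (Wp mu rho) `^ p + beta) ->
      let U := value_function G V in
      let u := fun z : Wspace d p * R => fine (U z.1 z.2) in
      [/\ (forall mu t, 0 < t < T -> U mu t \is a fin_num)
            /\ continuous_on (cylinder T) u,
          forall mu, U mu t @[t --> 0^'+] --> (G mu)%:E
        & viscosity_solution q T V u].
Proof.
(* [alpha] and [L] are replaced by their absolute values, since the sections above work with
   nonnegative constants; the horizon thus depends on [|alpha|] and [p] only, not on the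
   dimension. *)
have A0 : 0 <= `|alpha| by exact: normr_ge0.
exists (horizon (p := p) `|alpha|); first exact: horizon_gt0.
move=> d G V beta rho _ _ /continuous_Wcontinuous cV [L GL] VA U u.
have L0 : 0 <= `|L| by exact: normr_ge0.
have GL' nu nu' : `|G nu - G nu'| <= `|L| * Wp nu nu'.
  apply: le_trans (GL _ _) _; apply: ler_wpM2r; last exact: ler_norm.
  exact: Wp_ge0.
have VA' nu : V nu <= `|alpha| * (Wp nu rho) `^ p + beta.
  apply: le_trans (VA _) _; rewrite lerD2r; apply: ler_wpM2r; last exact: ler_norm.
  exact: powR_ge0.
have cu := value_continuous_on hp hpq A0 L0 GL' cV VA'.
split; [split => //|exact: (value_limit hp hpq A0 L0 GL' cV VA')|split => //].
- move=> mu t /andP[t0 tT].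
  exact: (value_fin hp hpq A0 L0 GL' cV VA' mu (ltW t0) tT).
- split; first exact: continuous_usc cu.
  move=> [mu0 t0] /andP[t00 t0T] a xi.
  exact: (value_subsolution hp hpq A0 L0 GL' cV VA' t00 t0T).
- split; first exact: continuous_lsc cu.
  move=> [mu0 t0] /andP[t00 t0T] a xi cxi.
  exact: (value_supersolution hp hpq A0 L0 GL' cV VA' t00 t0T cxi).
Qed.
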